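(* With $a_{m,L}$ and $X_L$ as defined in the context, the following hold. (i) $X_0$ is a Gumbel distributed random variable with mean $0$ and variance $\frac{\pi^2}{6}$. (ii) If $0<L<\frac12$ then, as $x\to\infty$, $$\mathbb P[X_L>x]=(\kappa_L+o(1))\,e^{-x}\qquad\text{and}\qquad \log\mathbb P[X_L<-x]=-(\lambda_L+o(1))\,x^{1/L},$$ where $$\kappa_L=\frac1e\prod_{m=1}^\infty\frac{e^{-a_{m,L}}}{1-a_{m,L}},\qquad \lambda_L=L\,\Gamma(L)^{1/L}\left(-\operatorname{sinc}\left(\frac{\pi}{1-L}\right)\right)^{\frac1L-1}.$$
   Context: Let $\{\zeta_m\}_{m\ge0}$ be i.i.d. standard complex Gaussian random variables (density $\frac1\pi e^{-|\zeta|^2}$ on $\mathbb C$). Put $a_{0,0}=0$, $a_{m,0}=\frac1m$ for $m\ge1$, and $a_{m,L}=\frac{\Gamma(L+m)}{\Gamma(L)\,m!}$ for $L>0$, $m\ge0$. For $0\le L<\frac12$ define $X_L=\sum_{m=0}^\infty a_{m,L}(|\zeta_m|^2-1)$, which converges almost surely. Here $\operatorname{sinc}x=\frac{\sin x}{x}$. The Gumbel distribution with mean $0$ and variance $\frac{\pi^2}6$ is the one with cumulative distribution function $x\mapsto\exp(-e^{-x-\gamma_e})$, where $\gamma_e$ is Euler's constant. *)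

(* Defs.v *)
From HB Require Import structures.
From mathcomp Require Import all_boot all_order all_algebra.
From mathcomp Require Import complex.
From mathcomp Require Import all_classical all_reals all_analysis.
From mathcomp Require Import measurable_realfun.

Set Implicit Arguments.
Unset Strict Implicit.
Unset Printing Implicit Defensive.

Import Order.TTheory GRing.Theory Num.Theory.
Import numFieldNormedType.Exports.

Local Open Scope classical_set_scope.
Local Open Scope ring_scope.
Local Open Scope complex_scope.

Section complex_borel.
Context {R : realType}.

Definition complex_pair (z : R[i]) : R * R := (complex.Re z, complex.Im z).
Definition pair_complex (p : R * R) : R[i] := p.1 +i* p.2.

(* The libraries put no sigma-algebra on R[i]: transport the Borel one of R^2
   along z |-> (Re z, Im z). *)
Definition complex_measurable : set (set R[i]) :=
  preimage_set_system [set: R[i]] complex_pair measurable.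

Lemma sigma_algebra_complex : sigma_algebra [set: R[i]] complex_measurable.
Proof. apply: sigma_algebra_preimage; exact: sigma_algebra_measurable. Qed.

Lemma complex_measurable0 : complex_measurable set0.
Proof. by have [] := sigma_algebra_complex. Qed.

Lemma complex_measurableC A :
  complex_measurable A -> complex_measurable (~` A).
Proof. by have [_ + _] := sigma_algebra_complex => /[apply]; rewrite setTD. Qed.

Lemma complex_measurable_bigcup (F : (set R[i])^nat) :
  (forall i, complex_measurable (F i)) -> complex_measurable (\bigcup_i F i).
Proof. by have [_ _] := sigma_algebra_complex; exact. Qed.

HB.instance Definition _ := isPointed.Build R[i] 0.
HB.instance Definition _ := @isMeasurable.Build default_measure_display R[i]
  complex_measurable complex_measurable0 complex_measurableC
  complex_measurable_bigcup.

Lemma measurable_pair_complex : measurable_fun [set: R * R] pair_complex.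
Proof.
move=> _ _ [B mB <-]; rewrite setTI.
rewrite [X in measurable X](_ : _ = B)//.
by rewrite setTI; apply/seteqP; split=> [[]|[]].
Qed.

Definition complex_lebesgue : set R[i] -> \bar R :=
  pushforward (@lebesgue_measure R \x @lebesgue_measure R)%E pair_complex.

Let complex_lebesgue0 : complex_lebesgue set0 = 0%E.
Proof. by rewrite /complex_lebesgue /pushforward preimage_set0 measure0. Qed.

Let complex_lebesgue_ge0 A : (0 <= complex_lebesgue A)%E.
Proof. rewrite /complex_lebesgue /pushforward; exact: measure_ge0. Qed.

Let complex_lebesgue_sigma_additive : semi_sigma_additive complex_lebesgue.
Proof.
have mpre A : measurable A -> measurable (pair_complex @^-1` A).
  by move=> mA; rewrite -[X in measurable X]setTI; exact: measurable_pair_complex.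
move=> F mF tF mUF; rewrite /complex_lebesgue /pushforward preimage_bigcup.
apply: measure_semi_sigma_additive.
- by move=> n; exact: mpre.
- apply/trivIsetP => /= i j _ _ ij; rewrite -preimage_setI.
  by move/trivIsetP : tF => /(_ _ _ _ _ ij) ->//; rewrite preimage_set0.
- by rewrite -preimage_bigcup; exact: mpre.
Qed.

HB.instance Definition _ := isMeasure.Build _ _ _ complex_lebesgue
  complex_lebesgue0 complex_lebesgue_ge0 complex_lebesgue_sigma_additive.

End complex_borel.

Section limit_measurable.
Context d (T : measurableType d) (R : realType).

Lemma cvgn_cauchy_nat (u : R^nat) : cvgn u <->
  forall k : nat, exists N : nat, forall n, (N <= n)%N ->
    `|u n - u N| < k.+1%:R^-1.
Proof.
split=> [cu k|cu].
  have k0 : 0 < k.+1%:R^-1 / 2 :> R by rewrite divr_gt0// invr_gt0.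
  have /cvgrPdist_lt/(_ _ k0)[N _ uN] := cu.
  exists N => n Nn; rewrite (splitr k.+1%:R^-1).
  rewrite -(subrK (limn u) (u n)) -addrA.
  rewrite (le_lt_trans (ler_normD _ _))// ltrD//; last by apply: uN => /=.
  by rewrite distrC; exact: uN.
apply: cauchy_cvg; apply: cauchy_exP => e e0.
have [k ke] : exists k : nat, k.+1%:R^-1 < e.
  exists (Num.truncn e^-1); rewrite invf_plt ?posrE//.
  by rewrite truncnS_gt.
have [N uN] := cu k; exists (u N); exists N => // n /= Nn.
rewrite /ball /= distrC; exact: lt_trans (uN n Nn) ke.
Qed.

Lemma measurable_cvgn (f : (T -> R)^nat) :
  (forall n, measurable_fun [set: T] (f n)) ->
  measurable [set w | cvgn (f ^~ w)].
Proof.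
move=> mf.
rewrite (_ : [set _ | _] = \bigcap_k \bigcup_N \bigcap_(n in [set n | (N <= n)%N])
  [set w | `|f n w - f N w| < k.+1%:R^-1]).
  apply: bigcapT_measurable => k; apply: bigcupT_measurable => N.
  apply: bigcap_measurableType => n _.
  have mg : measurable_fun [set: T] (fun w => `|f n w - f N w| < k.+1%:R^-1).
    apply: measurable_fun_ltr => //.
    by apply: measurableT_comp => //; exact: measurable_funB.
  by have := mg measurableT [set true] Logic.I; rewrite setTI.
apply/seteqP; split=> w /=.
  by move=> /cvgn_cauchy_nat cu k _; have [N uN] := cu k; exists N.
by move=> cu; apply/cvgn_cauchy_nat => k; have [N _ uN] := cu k Logic.I; exists N.
Qed.

Lemma measurable_fun_limn (f : (T -> R)^nat) :
  (forall n, measurable_fun [set: T] (f n)) ->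
  measurable_fun [set: T] (fun w => limn (f ^~ w)).
Proof.
move=> mf; pose D := [set w | cvgn (f ^~ w)].
have mD : measurable D by exact: measurable_cvgn.
rewrite -(setUv D); apply/measurable_funU => //; first exact: measurableC.
split.
  by apply: (@measurable_fun_cvg _ _ _ D f) => // m; exact: measurable_funTS.
apply: (@eq_measurable_fun _ _ _ _ _ (cst point)) => // w.
by rewrite inE => /= /dvgP ->.
Qed.

End limit_measurable.

Section constants.
Context {R : realType}.
Implicit Types L s x : R.

(* Euler's integral; it is only used for s > 0, where it converges. *)
Definition Gamma s : R :=
  Rintegral (@lebesgue_measure R) `]0, +oo[ (fun t => t `^ (s - 1) * expR (- t)).

Definition euler_gamma : R :=
  limn (fun n => \sum_(1 <= k < n.+1) k%:R^-1 - ln (n%:R : R)).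

Definition sinc x : R := sin x / x.

Definition acoef (m : nat) L : R :=
  if L == 0 then (if m == 0%N then 0 else m%:R^-1)
  else Gamma (L + m%:R) / (Gamma L * m`!%:R).

Definition kappa L : R :=
  (expR 1)^-1 *
  limn (fun n => \prod_(1 <= m < n.+1) (expR (- acoef m L) / (1 - acoef m L))).

Definition lambda L : R :=
  L * Gamma L `^ L^-1 * (- sinc (pi / (1 - L))) `^ (L^-1 - 1).

(* The cdf of the Gumbel distribution of mean 0 and variance pi^2 / 6. *)
Definition gumbel_cdf x : R := expR (- expR (- x - euler_gamma)).

End constants.

Section random_series.
Context d (T : measurableType d) (R : realType) (P : probability T R).

Definition mutually_independent d' (T' : measurableType d')
    (Z : nat -> {RV P >-> T'}) : Prop :=
  forall (s : seq nat) (B : nat -> set T'), uniq s ->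
    (forall m, measurable (B m)) ->
    P (\bigcap_(m in [set` s]) (Z m @^-1` B m)) =
    (\prod_(m <- s) P (Z m @^-1` B m))%E.

Definition standard_complex_gaussian (Z : {RV P >-> R[i]}) : Prop :=
  forall B : set R[i], measurable B ->
    distribution P Z B =
    (\int[complex_lebesgue]_(z in B)
       (pi^-1 * expR (- Normc.normc z ^+ 2))%:E)%E.

Variable zeta : nat -> {RV P >-> R[i]}.

(* [limn] takes a default value on the event, negligible in the intended use,
   where the series diverges. *)
Definition Xfun (L : R) (w : T) : R :=
  limn (series (fun m => acoef m L * (Normc.normc (zeta m w) ^+ 2 - 1))).

Lemma measurable_normc_sqr :
  measurable_fun [set: R[i]] (fun z : R[i] => Normc.normc z ^+ 2).
Proof.
have mpair : measurable_fun [set: R[i]] complex_pair.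
  by move=> _ B mB; rewrite setTI; exists B => //; rewrite setTI.
rewrite (_ : (fun _ => _) =
  (fun p : R * R => p.1 ^+ 2 + p.2 ^+ 2) \o complex_pair).
  apply: measurableT_comp mpair.
  by apply: measurable_funD; apply: measurable_funX;
     [exact: measurable_fst|exact: measurable_snd].
apply/funext => -[x y] /=.
by rewrite sqr_sqrtr// addr_ge0// sqr_ge0.
Qed.

Lemma measurable_Xfun (L : R) : measurable_fun [set: T] (Xfun L).
Proof.
apply: (@measurable_fun_limn _ _ _ (fun n w =>
  series (fun m => acoef m L * (Normc.normc (zeta m w) ^+ 2 - 1)) n)).
move=> n; rewrite /series /=; apply: measurable_sum => m.
apply: measurable_funM => //; apply: measurable_funB => //.
exact: measurableT_comp measurable_normc_sqr _.
Qed.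

HB.instance Definition _ (L : R) :=
  isMeasurableFun.Build _ _ _ _ (Xfun L) (measurable_Xfun L).

Definition X (L : R) : {RV P >-> R} := Xfun L.

End random_series.

(* Main.v *)
(* With E_m = |zeta_m|^2 the variables E_m are iid exponential, so that X_L is a
   sum of independent centred variables a_m (E_m - 1) with sum a_m^2 finite.

   For L = 0 the partial sums of E_m / m are distributed as maxima of n iid
   exponential variables, which after centring by the harmonic numbers
   converge to the Gumbel law.

   For 0 < L < 1/2 the largest coefficient is a_0 = 1 and the others are at most
   L.  Writing X_L = E_0 - 1 + Y, the upper tail is P(E_0 > x + 1 - Y) =
   E min(1, e^(Y - x - 1)), which differs from e^(- x - 1) E e^Y =
   kappa_L e^(-x) by at most e^(- 2 x - 2) E e^(2 Y).

   For the lower tail, log E e^(- t X_L) = sum_m phi(t a_m) with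
   phi(v) = v - ln(1 + v).  Since a_m ~ m^(L - 1) / Gamma(L), comparison with an
   integral and the reflection formula for Gamma give C t^p + O(t) with
   p = 1 / (1 - L); Chernoff's bound and an exponential tilting turn this
   into the stated asymptotics. *)

Require Import Defs.
From HB Require Import structures.
From mathcomp Require Import all_boot all_order all_algebra.
From mathcomp Require Import complex.
From mathcomp Require Import all_classical all_reals all_analysis.
From mathcomp Require Import measurable_realfun.
From mathcomp Require Import ring lra.

Set Implicit Arguments.
Unset Strict Implicit.
Unset Printing Implicit Defensive.

Import Order.TTheory GRing.Theory Num.Theory.
Import numFieldNormedType.Exports.

Local Open Scope classical_set_scope.
Local Open Scope ring_scope.

(** The condition 0 < L < 1/2 says that p lies in ]1, 2[. Writing phi(v) as the integral of w/(1+w)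
    over ]0, v] and exchanging integrals turns the comparison integral into Euler's integral of
    w^(1-p)/(1+w); the reflection formula enters there, at 2-p, and C = Gamma(L)^(-p)
    pi/sin(pi(2-p)). That formula rests on the sine product, obtained from Wallis type integrals,
    and on Gamma(s+a) <= s^a Gamma(s) for 0 <= a <= 1, which also yields the power bounds on a_m.
    The law of |zeta|^2 is found by scaling: the area of a disc is proportional to its squared
    radius, and total mass one fixes the factor. The estimates are proved for partial sums and reach
    X_L through almost sure convergence. This passage gives upper bounds on open events only; lower
    bounds come through complements and a slight shift of the level. Partial sums are built by a
    recursion consuming one fresh variable per step, so that expectations integrate out one
    exponential variable at a time. Tilting takes the form of a pointwise inequality between
    exponentials, in place of a change of measure. *)

Local Notation mu := lebesgue_measure.
Local Notation pos := (`]0%R, +oo[%classic).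

(** * Integrals over the half-line *)

Ltac mfun := try apply: measurable_funTS; repeat first
  [ exact: measurable_id | exact: measurable_cst
  | exact: measurable_fst | exact: measurable_snd
  | match goal with H : measurable_fun _ _ |- _ => exact: H end
  | apply: (iffRL (measurable_EFinP _ _))
  | apply: measurable_funM
  | apply: measurable_funB
  | apply: measurable_funD
  | apply: measurable_funN
  | apply: measurable_funX
  | apply: (measurableT_comp (@measurable_expR _))
  | apply: (measurableT_comp (@measurable_ln _))
  | apply: (measurableT_comp (@measurable_powR _ _)) ].

Section improper_integral.
Context {R : realType}.

(** A compact exhaustion of the open half-line; the shift by two keeps the endpoints distinct even
    at [n = 0]. *)
Let cut n : set R := `[n.+2%:R^-1, n.+2%:R].

Let cut_lt n : n.+2%:R^-1 < n.+2%:R :> R.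
Proof.
have h : 1 < n.+2%:R :> R by rewrite ltr1n.
by rewrite (lt_trans _ h)// invf_lt1// (lt_trans _ h).
Qed.

Let nd_cut : nondecreasing_seq cut.
Proof.
move=> m n mn; apply/subsetPset; apply: subset_itv; rewrite bnd_simp.
  by rewrite lef_pV2 ?posrE ?ltr0n// ler_nat.
by rewrite ler_nat.
Qed.

Let bigcup_cut : \bigcup_n cut n = pos :> set R.
Proof.
apply/seteqP; split=> [x [n _]|x]; rewrite /cut/= !in_itv/= ?andbT.
  by move=> /andP[ax _]; rewrite (lt_le_trans _ ax)// invr_gt0 ltr0n.
move=> x0; exists (Num.truncn (x + x^-1)) => //; rewrite /cut /= in_itv/=.
have h : x + x^-1 < (Num.truncn (x + x^-1)).+2%:R.
  by rewrite (lt_trans (truncnS_gt _))// ltr_nat.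
have xV0 : 0 < x^-1 by rewrite invr_gt0.
apply/andP; split; last by rewrite ltW// (lt_trans _ h)// ltrDl.
by rewrite invf_ple ?posrE ?ltr0n// ltW// (lt_trans _ h)// ltrDr.
Qed.

Let cvg_cutl (F : R -> R) l : F x @[x --> 0^'+] --> l ->
  (F n.+2%:R^-1)%:E @[n --> \oo] --> l%:E.
Proof.
move=> /cvg_at_rightP Fl; apply/fine_cvgP; split; first exact: nearW.
apply: (Fl (fun n => n.+2%:R^-1)); split=> [n|]; first by rewrite invr_gt0 ltr0n.
by have := @cvg_harmonic R; rewrite -cvg_shiftS.
Qed.

Let cvg_cutr (F : R -> R) l : F x @[x --> +oo] --> l ->
  (F n.+2%:R)%:E @[n --> \oo] --> l%:E.
Proof.
move=> /cvg_pinftyP Fl; apply/fine_cvgP; split; first exact: nearW.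
apply: (Fl (fun n => n.+2%:R)).
by have := @cvgr_idn R; rewrite -2!cvg_shiftS.
Qed.

Lemma measurable_fun_0y (f : R -> R) :
  (forall x : R, 0 < x -> {for x, continuous f}) -> measurable_fun (pos : set R) f.
Proof.
move=> cf; apply: open_continuous_measurable_fun; first exact: interval_open.
by move=> x; rewrite inE/= in_itv/= andbT => /cf.
Qed.

(* The two nonnegative parts of the integrand are kept on separate sides, so
   that no integrability has to be known beforehand. *)
Lemma ge0_FTC2_0y (f g F : R -> R) (l0 l1 : R) :
  (forall x : R, 0 < x -> 0 <= f x) -> (forall x : R, 0 < x -> 0 <= g x) ->
  (forall x : R, 0 < x -> {for x, continuous f}) ->
  (forall x : R, 0 < x -> {for x, continuous g}) ->
  (forall x : R, 0 < x -> is_derive x 1 F (f x - g x)) ->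
  F x @[x --> 0^'+] --> l0 -> F x @[x --> +oo] --> l1 ->
  (\int[mu]_(x in pos) (f x)%:E + l0%:E =
   \int[mu]_(x in pos) (g x)%:E + l1%:E)%E.
Proof.
move=> f0 g0 cf cg dF Fl0 Fl1.
have cut0 n x : cut n x -> 0 < x.
  by rewrite /cut /= in_itv/= => /andP[ax _]; rewrite (lt_le_trans _ ax)// invr_gt0 ltr0n.
have cvgint (h : R -> R) : (forall x : R, 0 < x -> 0 <= h x) ->
    (forall x : R, 0 < x -> {for x, continuous h}) ->
    (\int[mu]_(x in cut n) (h x)%:E)%E @[n --> \oo] -->
    (\int[mu]_(x in pos) (h x)%:E)%E.
  move=> h0 ch; rewrite -bigcup_cut; apply: ge0_nondecreasing_set_cvg_integral => //.
  - by move=> n; exact: measurable_itv.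
  - move=> n; apply/measurable_EFinP.
    apply: (@measurable_funS _ _ _ _ (pos : set R)) => //.
      by rewrite -bigcup_cut; exact: bigcup_sup.
    exact: measurable_fun_0y.
  - by move=> n x /cut0 x0; rewrite lee_fin h0.
have within (h : R -> R) n : (forall x : R, 0 < x -> {for x, continuous h}) ->
    {within cut n, continuous (h : R -> R)}.
  move=> ch; apply: continuous_in_subspaceT => x /[!inE] /cut0; exact: ch.
(* On a compact interval both integrals are finite, so the fundamental theorem can be rearranged
   into an equality of sums. In this form it survives the monotone limit, even when the limits are
   infinite. *)
have E n : (\int[mu]_(x in cut n) (f x)%:E + (F n.+2%:R^-1)%:E =
    \int[mu]_(x in cut n) (g x)%:E + (F n.+2%:R)%:E)%E.
  have If (h : R -> R) : (forall x : R, 0 < x -> {for x, continuous h}) ->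
      mu.-integrable (cut n) (EFin \o h).
    move=> ch; apply: continuous_compact_integrable; first exact: segment_compact.
    exact: within.
  have dFx (x : R) : 0 < x -> derivable F x 1 by move=> /dF [].
  have cF (x : R) : 0 < x -> {for x, continuous F}.
    by move=> x0; apply/differentiable_continuous/derivable1_diffP/dFx.
  have := @continuous_FTC2 R (fun x => f x - g x) F _ _ (cut_lt n).
  have -> : (\int[mu]_(x in cut n) (f x - g x)%:E =
      \int[mu]_(x in cut n) (f x)%:E - \int[mu]_(x in cut n) (g x)%:E)%E.
    under eq_integral do rewrite EFinB.
    by apply: integralB_EFin; [exact: measurable_itv|exact: If|exact: If].
  have Ff : (\int[mu]_(x in cut n) (f x)%:E)%E \is a fin_num.
    by apply: integrable_fin_num; [exact: measurable_itv|exact: If].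
  have Fg : (\int[mu]_(x in cut n) (g x)%:E)%E \is a fin_num.
    by apply: integrable_fin_num; [exact: measurable_itv|exact: If].
  rewrite -(fineK Ff) -(fineK Fg) -!EFinD => H.
  congr EFin; suff : ((fine (\int[mu]_(x in cut n) (f x)%:E) -
     fine (\int[mu]_(x in cut n) (g x)%:E))%:E = (F n.+2%:R - F n.+2%:R^-1)%:E)%E
    by move=> [] ?; lra.
  have n0 : 0 < n.+2%:R^-1 :> R by rewrite invr_gt0 ltr0n.
  apply: H.
  - by apply: within => x x0; apply: continuousB; [exact: cf|exact: cg].
  - split; first by move=> x; rewrite in_itv/= => /andP[x0 _]; apply: dFx; exact: lt_trans x0.
    + by apply/cvg_at_right_filter/cF.
    + by apply/cvg_at_left_filter/cF; rewrite ltr0n.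
  - move=> x; rewrite in_itv/= => /andP[x0 _]; rewrite derive1E.
    by have [_ ->] := dF x (lt_trans n0 x0).
have /cvg_lim <-// : (\int[mu]_(x in cut n) (f x)%:E + (F n.+2%:R^-1)%:E)%E @[n --> \oo] -->
    (\int[mu]_(x in pos) (f x)%:E + l0%:E)%E.
  apply: cvgeD; [|exact: cvgint|exact: cvg_cutl].
  by rewrite fin_num_adde_defl.
have /cvg_lim <-// : (\int[mu]_(x in cut n) (g x)%:E + (F n.+2%:R)%:E)%E @[n --> \oo] -->
    (\int[mu]_(x in pos) (g x)%:E + l1%:E)%E.
  apply: cvgeD; [|exact: cvgint|exact: cvg_cutr].
  by rewrite fin_num_adde_defl.
by under eq_fun do rewrite E.
Qed.

End improper_integral.

Section product_domain.
Local Open Scope ereal_scope.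
Context d1 d2 (T1 : measurableType d1) (T2 : measurableType d2) (R : realType).
Variables (m1 : {sigma_finite_measure set T1 -> \bar R})
          (m2 : {sigma_finite_measure set T2 -> \bar R}).

(** Extending [f] by zero off the rectangle gives a function that is nonnegative everywhere, to
    which Tonelli's theorem applies. This serves integrands that may be negative outside the
    quadrant. *)
Lemma fubini_tonelli_in (D1 : set T1) (D2 : set T2) (f : T1 * T2 -> \bar R) :
  measurable D1 -> measurable D2 -> measurable_fun setT f ->
  (forall x y, D1 x -> D2 y -> 0 <= f (x, y)) ->
  \int[m1]_(x in D1) \int[m2]_(y in D2) f (x, y) =
  \int[m2]_(y in D2) \int[m1]_(x in D1) f (x, y).
Proof.
move=> mD1 mD2 mf f0; pose g := f \_ (D1 `*` D2).
have mg : measurable_fun setT g.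
  apply/(measurable_restrictT _ _).1; first exact: measurableX.
  exact: measurable_funTS.
have g0 z : 0 <= g z.
  rewrite /g patchE; case: ifPn => // /set_mem [? ?].
  by rewrite [z]surjective_pairing; exact: f0.
have gin x y : g (x, y) = if (x \in D1) && (y \in D2) then f (x, y) else 0.
  by rewrite /g patchE in_setX.
transitivity (\int[m1]_x \int[m2]_y g (x, y)); last rewrite fubini_tonelli//.
  rewrite integral_mkcond; apply: eq_integral => x _; rewrite patchE.
  case: ifPn => xD; last by rewrite integral0_eq// => y _; rewrite gin (negbTE xD).
  by rewrite integral_mkcond; apply: eq_integral => y _; rewrite gin xD patchE.
rewrite [RHS]integral_mkcond; apply: eq_integral => y _; rewrite patchE.
case: ifPn => yD; last first.
  by rewrite integral0_eq// => x _; rewrite gin (negbTE yD) andbF.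
by rewrite [RHS]integral_mkcond; apply: eq_integral => x _; rewrite gin yD andbT patchE.
Qed.

End product_domain.

Section scaling.
Context {R : realType}.
Local Open Scope ereal_scope.

Let measurable_mulr (k : R) : measurable_fun [set: R] ( *%R k).
Proof. exact: mulrl_measurable. Qed.

(** Uniqueness of Lebesgue measure: the image under multiplication by [k], scaled by [k], gives
    half-open intervals their length. *)
Lemma lebesgue_measure_scale (k : R) (A : set R) : (0 < k)%R -> measurable A ->
  mu A = k%:E * mu ( *%R k @^-1` A).
Proof.
move=> k0 mA.
pose m : {measure set (measurableTypeR R) -> \bar R} :=
  mscale (NngNum (ltW k0)) (pushforward mu ( *%R k : _ -> measurableTypeR R)).
rewrite -[RHS]/(m (@measurable_mulr k) A); apply: lebesgue_measure_unique => // _ [[a b]] _ <-.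
rewrite /m /= /mscale /pushforward -[X in _ = _ * X]/(mu ( *%R k @^-1` `]a, b])).
have -> : *%R k @^-1` `]a, b]%classic = `](a / k)%R, (b / k)%R]%classic.
  apply/seteqP; split=> x /=;
    by rewrite !in_itv/= ltr_pdivrMr// ler_pdivlMr// ![(x * _)%R]mulrC.
rewrite !lebesgue_measure_itv/= !lte_fin ltr_pM2r ?invr_gt0//.
case: ifPn => ab; last by rewrite mule0.
by rewrite -EFinB -EFinM; congr EFin; rewrite -mulrBl mulrC divfK// gt_eqF.
Qed.

Lemma ge0_integral_scale (k : R) (D : set R) (f : R -> \bar R) : (0 < k)%R ->
  measurable D -> measurable_fun D f -> (forall x, D x -> 0 <= f x) ->
  \int[mu]_(x in D) f x = k%:E * \int[mu]_(x in *%R k @^-1` D) f (k * x)%R.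
Proof.
move=> k0 mD mf f0.
pose m : {measure set (measurableTypeR R) -> \bar R} :=
  mscale (NngNum (ltW k0)) (pushforward mu ( *%R k : _ -> measurableTypeR R)).
rewrite (eq_measure_integral (m (@measurable_mulr k))); last first.
  by move=> A mA _; exact: (lebesgue_measure_scale k0 mA).
rewrite ge0_integral_mscale// ge0_integral_pushforward//.
by move=> x; rewrite inE; exact: f0.
Qed.

End scaling.

Section gamma_integral.
Context {R : realType}.
Implicit Types s t x : R.

Lemma continuous_powR_gt0 s x : 0 < x -> {for x, continuous (fun t : R => t `^ s)}.
Proof.
move=> x0; apply/differentiable_continuous/derivable1_diffP.
by have [] := is_derive1_powR s x0.
Qed.

Lemma continuous_expRN x : {for x, continuous (fun t : R => expR (- t))}.
Proof.
apply: (@continuous_comp _ _ _ (fun t : R => - t)); last exact: continuous_expR.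
exact: (@continuousN _ R^o).
Qed.

Lemma continuous_powR_expR s x : 0 < x ->
  {for x, continuous (fun t : R => t `^ s * expR (- t))}.
Proof.
move=> x0; apply: continuousM; [exact: continuous_powR_gt0|exact: continuous_expRN].
Qed.

Lemma is_derive_expRN x : is_derive x 1 (fun t : R => expR (- t)) (- expR (- x)).
Proof. by apply: is_derive_eq; rewrite mulrN1. Qed.

(** Half of the exponential absorbs the power, by [ln u <= u] at [u = t / (2 * s)]; the remaining
    half gives decay at infinity. *)
Lemma powR_expR_le s t : 0 < s -> 0 < t ->
  t `^ s * expR (- t) <= (2 * s) `^ s * expR (- (t / 2)).
Proof.
move=> s0 t0; have s20 : 0 < 2 * s by rewrite mulr_gt0.
rewrite /powR !gt_eqF// -!expRD ler_expR.
have : ln (t / (2 * s)) <= t / (2 * s) by rewrite ltW// ln_sublinear// divr_gt0.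
rewrite ln_div ?posrE// -(ler_pM2l s0) mulrBr (_ : s * (t / _) = t / 2); last by field; lra.
lra.
Qed.

Lemma cvg_powR_expR s : 0 < s -> t `^ s * expR (- t) @[t --> +oo] --> 0.
Proof.
move=> s0; apply: (@squeeze_cvgr _ _ _ _ (cst 0) (fun t => (2 * s) `^ s * expR (- (t / 2)))).
- near=> t; rewrite mulr_ge0 ?powR_ge0 ?expR_ge0//=.
  by apply: powR_expR_le => //; near: t; exact: nbhs_pinfty_gt.
- exact: cvg_cst.
- rewrite -[X in _ --> X](mulr0 ((2 * s) `^ s)); apply: cvgMr.
  apply: (@cvg_comp _ _ _ (fun t : R => t / 2) (fun t => expR (- t)) _ +oo);
      last exact: cvgr_expR.
  exact: gt0_cvgMly.
Unshelve. all: end_near. Qed.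

Lemma cvg0_powR_expR s : 0 < s -> t `^ s * expR (- t) @[t --> 0^'+] --> 0.
Proof.
move=> s0; rewrite -[X in _ --> X](mul0r (expR (- 0))); apply: cvgM.
  exact: powR_cvg0.
by apply: cvg_at_right_filter; exact: continuous_expRN.
Qed.

(** Euler's integral with extended values: the functional equation and the convexity bound are
    proved for it first, and finiteness is then deduced from them. *)
Definition gamma_int s : \bar R :=
  (\int[mu]_(t in pos) (t `^ (s - 1) * expR (- t))%:E)%E.

Lemma measurable_powR_expR (D : set R) s :
  measurable_fun D (fun t => (t `^ s * expR (- t))%:E).
Proof.
apply: measurable_funTS; apply/measurable_EFinP; apply: measurable_funM.
  exact: measurable_powR.
by apply: measurableT_comp => //; exact: measurable_expR.
Qed.

Lemma gamma_int_ge0 s : (0 <= gamma_int s)%E.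
Proof. by apply: integral_ge0 => t _; rewrite lee_fin mulr_ge0 ?powR_ge0 ?expR_ge0. Qed.

Lemma gamma_intS s : 0 < s -> (s%:E * gamma_int s = gamma_int (s + 1))%E.
Proof.
move=> s0; rewrite /gamma_int addrK -ge0_integralZl//; last 3 first.
- exact: measurable_powR_expR.
- by move=> t _; rewrite lee_fin mulr_ge0 ?powR_ge0 ?expR_ge0.
- by rewrite lee_fin ltW.
have := @ge0_FTC2_0y R (fun t => s * (t `^ (s - 1) * expR (- t)))
  (fun t => t `^ s * expR (- t)) (fun t => t `^ s * expR (- t)) 0 0.
rewrite !adde0; apply=> [x x0|x x0|x x0|x x0|x x0||].
- by rewrite !mulr_ge0 ?powR_ge0 ?expR_ge0// ltW.
- by rewrite !mulr_ge0 ?powR_ge0 ?expR_ge0// ltW.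
- by apply: continuousM; [exact: cst_continuous|exact: continuous_powR_expR].
- exact: continuous_powR_expR.
- have d1 := is_derive1_powR s x0; have d2 := is_derive_expRN x.
  by apply: is_derive_eq; rewrite /GRing.scale/=; ring.
- exact: cvg0_powR_expR.
- exact: cvg_powR_expR.
Qed.

Lemma integral_expR (c : R) : 0 < c ->
  (\int[mu]_(t in pos) (expR (- (c * t)))%:E = (c^-1)%:E)%E.
Proof.
move=> c0; have := @ge0_FTC2_0y R (fun t : R => expR (- (c * t))) (cst 0)
  (fun t : R => - (c^-1 * expR (- (c * t)))) (- c^-1) 0.
have cM (x : R) : {for x, continuous (fun t : R => expR (- (c * t)))}.
  apply: (@continuous_comp _ _ _ (fun t : R => c * t) (fun t => expR (- t))).
    by apply: (@continuousM _ R^o (cst c) id) => //; exact: cst_continuous.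
  exact: continuous_expRN.
have -> : (\int[mu]_(x in pos) (cst 0 x : R)%:E = 0)%E by rewrite integral0_eq.
rewrite add0e => H; suff : (\int[mu]_(t in pos) (expR (- (c * t)))%:E + (- c^-1)%:E = 0%:E)%E.
  by move/(congr1 (fun z => z + (c^-1)%:E)%E) => /=; rewrite -addeA -EFinD addNr adde0 add0e.
apply: H.
- by move=> x _; exact: expR_ge0.
- by [].
- by move=> x _; exact: cM.
- by move=> x _; exact: cst_continuous.
- move=> x x0; apply: is_derive_eq; rewrite /GRing.scale/= subr0.
  by field; rewrite gt_eqF.
- rewrite -[X in _ --> X](_ : - (c^-1 * expR (- (c * 0))) = _); last first.
    by rewrite mulr0 oppr0 expR0 mulr1.
  apply: cvg_at_right_filter; apply: cvgN; apply: cvgMr; exact: cM.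
- rewrite -oppr0 -[X in _ --> - X](mulr0 c^-1); apply: cvgN; apply: cvgMr.
  apply: (@cvg_comp _ _ _ (fun t : R => c * t) (fun t => expR (- t)) _ +oo);
      last exact: cvgr_expR.
  exact: gt0_cvgMry.
Qed.

Lemma gamma_int1 : gamma_int 1 = 1%E.
Proof.
rewrite /gamma_int subrr -[RHS]/((1 : R)%:E) -[in RHS]invr1 -integral_expR//.
by apply: eq_integral => t _; rewrite powRr0 !mul1r.
Qed.

Lemma integral_expRN : (\int[mu]_(u in pos) (expR (- u : R))%:E = 1)%E.
Proof.
by rewrite -gamma_int1; apply: eq_integral => u _; rewrite subrr powRr0 mul1r.
Qed.

End gamma_integral.

(** * The gamma function *)

Section gamma.
Context {R : realType}.
Implicit Types s t x : R.

(** Weighted mean inequality: [m] is the mean of [t] and 1 with weights [a] and [1 - a]. Bounding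
    [ln (t / m)] and [ln m^-1] by [u - 1] and averaging with these weights leaves zero on the
    right. *)
Lemma powR_le_tangent (a t : R) : 0 <= a <= 1 -> 0 <= t ->
  t `^ a <= 1 + a * (t - 1).
Proof.
move=> /andP[a0 a1]; rewrite le_eqVlt => /predU1P[<-|t0].
  by rewrite /powR eqxx; case: (eqVneq a 0) => [->|_] /=; lra.
set m := 1 + a * (t - 1).
have m0 : 0 < m.
  rewrite /m; have [t1|t1] := leP 1 t.
    by rewrite ltr_wpDr ?ltr01// mulr_ge0// subr_ge0.
  have : a * (1 - t) <= 1 - t by rewrite ler_piMl ?subr_ge0// ltW.
  lra.
rewrite /powR gt_eqF// -[leRHS]lnK ?posrE// ler_expR.
have h1 : ln (t / m) <= t / m - 1.
  have := @le_ln1Dx R (t / m - 1); rewrite subrKC; apply.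
  by rewrite ltrBDr addNr divr_gt0.
have h2 : ln m^-1 <= m^-1 - 1.
  have := @le_ln1Dx R (m^-1 - 1); rewrite subrKC; apply.
  by rewrite ltrBDr addNr invr_gt0.
move: h1 h2; rewrite ln_div ?lnV ?posrE// => h1 h2.
have h3 : a * (ln t - ln m) <= a * (t / m - 1) by rewrite ler_wpM2l.
have h4 : (1 - a) * (- ln m) <= (1 - a) * (m^-1 - 1) by rewrite ler_wpM2l// subr_ge0.
have h5 : a * (t / m - 1) + (1 - a) * (m^-1 - 1) = 0.
  by rewrite /m; field; rewrite gt_eqF.
lra.
Qed.

(** Wendel's inequality. The tangent bound for the power [a], taken at the point [s], is integrated
    against the gamma density; its linear part is evaluated by the functional equation. *)
Lemma gamma_int_le s a : 0 < s -> 0 <= a <= 1 ->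
  (gamma_int (s + a) <= (s `^ a)%:E * gamma_int s)%E.
Proof.
move=> s0 a01; have [a0 a1] := andP a01.
have sa0 : 0 <= s `^ a by exact: powR_ge0.
(* The right-hand side becomes the integral of the tangent line [s]^ a * (1 - a) + s
   [^ a * (a / s) * t]. *)
have -> : ((s `^ a)%:E * gamma_int s = (s `^ a * (1 - a))%:E * gamma_int s +
    (s `^ a * (a / s))%:E * gamma_int (s + 1))%E.
  rewrite -gamma_intS// muleA -EFinM -mulrA divfK ?gt_eqF//.
  rewrite -ge0_muleDl ?lee_fin ?mulr_ge0 ?subr_ge0//.
  by congr (_ * _)%E; rewrite -EFinD; congr EFin; ring.
rewrite /gamma_int addrK -!ge0_integralZl//;
  try by [exact: measurable_powR_expR |
          move=> t _; rewrite lee_fin mulr_ge0 ?powR_ge0 ?expR_ge0 |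
          rewrite lee_fin !mulr_ge0 ?subr_ge0 ?invr_ge0 ?(ltW s0)].
rewrite -ge0_integralD//; try by [
  move=> t _; rewrite -EFinM lee_fin !mulr_ge0 ?powR_ge0 ?expR_ge0 ?subr_ge0 ?invr_ge0// ltW|
  apply: measurable_funeM; exact: measurable_powR_expR].
apply: ge0_le_integral => //; try by [
  move=> t _; rewrite lee_fin mulr_ge0 ?powR_ge0 ?expR_ge0|
  exact: measurable_powR_expR |
  apply: emeasurable_funD; apply: measurable_funeM; exact: measurable_powR_expR].
move=> t /=; rewrite in_itv/= andbT => t0.
rewrite -!EFinM -EFinD lee_fin !mulrA -mulrDl ler_wpM2r ?expR_ge0//.
have -> : s + a - 1 = (s - 1) + a by ring.
rewrite powRD ?(gt_eqF t0) ?implybT//.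
have ts : s `^ a * (t / s) `^ a = t `^ a.
  by rewrite -powRM ?ltW// ?divr_gt0// mulrCA divff ?gt_eqF// mulr1.
have -> : t `^ s = t `^ (s - 1) * t.
  by rewrite -{3}(powRr1 (ltW t0)) -powRD ?subrK// (gt_eqF t0) implybT.
have := powR_le_tangent a01 (ltW (divr_gt0 t0 s0)).
move=> /(ler_wpM2l sa0); rewrite ts.
move=> /(ler_wpM2l (powR_ge0 t (s - 1)))/le_trans; apply.
by rewrite le_eqVlt; apply/orP; left; apply/eqP; field; rewrite gt_eqF.
Qed.

(** For [s <= 1], Wendel's inequality from 1 to [1 + s] bounds [s * gamma_int s] by 1, and from [s]
    to 1 it excludes the value 0. The functional equation carries both facts to larger [s]. *)
Lemma gamma_int_fin s : 0 < s -> gamma_int s \is a fin_num /\ (0 < gamma_int s)%E.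
Proof.
move=> s0; have [n sn] : exists n, s <= n.+1%:R.
  by exists (Num.truncn s); rewrite ltW// truncnS_gt.
elim: n s s0 sn => [|n IH] s s0 sn.
  split.
    have : (s%:E * gamma_int s <= 1)%E.
      rewrite gamma_intS// addrC (le_trans (gamma_int_le ltr01 _))//.
        by rewrite ltW.
      by rewrite powR1 gamma_int1 mule1.
    have := gamma_int_ge0 s; case: (gamma_int s) => // _.
    by rewrite gt0_muley ?lte_fin.
  have : (1 <= (s `^ (1 - s))%:E * gamma_int s)%E.
    rewrite -(@gamma_int1 R) (le_trans _ (gamma_int_le _ _))//.
      by rewrite addrC subrK.
    by rewrite subr_ge0 sn gerBl ltW.
  move=> h; rewrite lt_neqAle gamma_int_ge0 andbT; apply/negP => /eqP G0.
  by move: h; rewrite -G0 mule0 lee_fin leNgt ltr01.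
have [s1|s1] := leP s 1; first by apply: IH => //; rewrite (le_trans s1)// ler1n.
have s10 : 0 < s - 1 by rewrite subr_gt0.
have [|fG G0] := IH (s - 1) s10; first by rewrite lerBlDr natr1.
rewrite -(subrK 1 s) -gamma_intS//; split; first by rewrite fin_numM.
by rewrite mule_gt0.
Qed.

Lemma GammaE s : 0 < s -> (Gamma s)%:E = gamma_int s.
Proof. by move=> /gamma_int_fin[fG _]; rewrite /Gamma /Rintegral fineK. Qed.

Lemma Gamma_gt0 s : 0 < s -> 0 < Gamma s.
Proof. by move=> s0; rewrite -lte_fin GammaE//; have [] := gamma_int_fin s0. Qed.

Lemma GammaS s : 0 < s -> Gamma (s + 1) = s * Gamma s.
Proof.
by move=> s0; apply: EFin_inj; rewrite EFinM !GammaE ?addr_gt0// gamma_intS.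
Qed.

Lemma Gamma1 : Gamma 1 = 1 :> R.
Proof. by apply: EFin_inj; rewrite GammaE// gamma_int1. Qed.

Lemma Gamma_nat n : Gamma n.+1%:R = n`!%:R :> R.
Proof.
elim: n => [|n IH]; first by rewrite Gamma1.
by rewrite -natr1 GammaS// IH factS natrM.
Qed.

Lemma Gamma_le s a : 0 < s -> 0 <= a <= 1 -> Gamma (s + a) <= s `^ a * Gamma s.
Proof.
move=> s0 a01; rewrite -lee_fin EFinM !GammaE// ?gamma_int_le//.
by have /andP[a0 _] := a01; rewrite ltr_wpDr.
Qed.

End gamma.

(** * The sine product *)

Section derive_le.
Context {R : realType}.

Lemma is_derive_le (f df : R -> R) (a b : R) : a <= b ->
  (forall x : R, a <= x <= b -> is_derive x 1 f (df x)) ->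
  (forall x : R, a <= x <= b -> 0 <= df x) -> f a <= f b.
Proof.
move=> ab fdf df0.
have d (x : R) : x \in `]a, b[ -> is_derive x 1 f (df x).
  by rewrite in_itv/= => /andP[ax xb]; apply: fdf; rewrite !ltW.
have cf : {within `[a, b], continuous f}.
  apply: derivable_within_continuous => x; rewrite in_itv/= => xab.
  by have [] := fdf x xab.
have [c] := MVT_segment ab d cf; rewrite in_itv/= => cab fE.
by rewrite -subr_ge0 fE mulr_ge0 ?subr_ge0// df0.
Qed.

Lemma is_derive_expn (f : R -> R) (df x : R) n : is_derive x 1 f df ->
  is_derive x 1 (fun t => f t ^+ n.+1) (n.+1%:R * f x ^+ n * df).
Proof.
move=> d; rewrite -[fun t => _]exprfctE.
by apply: is_derive_eq.
Qed.

Lemma sin_le (x : R) : 0 <= x -> sin x <= x.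
Proof.
move=> x0; rewrite -subr_ge0.
have := @is_derive_le (fun t => t - sin t) (fun t => 1 - cos t) _ _ x0.
by rewrite sin0 subr0; apply=> t _; rewrite subr_ge0 cos_le1.
Qed.

Lemma cos_ge (x : R) : 1 - x ^+ 2 / 2 <= cos x.
Proof.
have h (t : R) : 0 <= t -> 1 - t ^+ 2 / 2 <= cos t.
  move=> t0; rewrite -subr_ge0.
  have := @is_derive_le (fun u => cos u - (1 - u ^+ 2 / 2)) (fun u => u - sin u) _ _ t0.
  rewrite cos0 expr0n/= mul0r subr0 subrr; apply => u /andP[u0 _].
    have d := is_derive_expn 1 (is_derive_id u 1).
    by apply: is_derive_eq; rewrite /GRing.scale/=; field; rewrite ?pnatr_eq0.
  by rewrite subr_ge0 sin_le.
have [x0|x0] := leP 0 x; first exact: h.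
by rewrite -cosN -sqrrN h// oppr_ge0 ltW.
Qed.

Lemma xcos_le_sin (x : R) : 0 <= x <= pi -> x * cos x <= sin x.
Proof.
move=> /andP[x0 xpi]; rewrite -subr_ge0.
have := @is_derive_le (fun t => sin t - t * cos t) (fun t => t * sin t) _ _ x0.
rewrite sin0 mul0r subrr; apply => t /andP[t0 tx].
  by apply: is_derive_eq; rewrite /GRing.scale/=; ring.
by rewrite mulr_ge0// sin_ge0_pi// t0 (le_trans tx).
Qed.

End derive_le.

Section sine_product.
Context {R : realType}.
Implicit Types (f g : R -> R) (b s x : R) (n k : nat).

Let J f : R := \int[mu]_(x in `[0, pi / 2]) f x.

Let intJ f : continuous f -> mu.-integrable `[0, pi / 2] (EFin \o f).
Proof.
move=> cf; apply: continuous_compact_integrable; first exact: segment_compact.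
exact: continuous_subspaceT.
Qed.

Let JD f g : continuous f -> continuous g -> J (fun x => f x + g x) = J f + J g.
Proof. by move=> cf cg; apply: RintegralD => //; exact: intJ. Qed.

Let JZ f (c : R) : continuous f -> J (fun x => c * f x) = c * J f.
Proof. by move=> cf; apply: RintegralZl => //; exact: intJ. Qed.

Let Jle f g : continuous f -> continuous g ->
  (forall x, 0 <= x <= pi / 2 -> f x <= g x) -> J f <= J g.
Proof.
by move=> cf cg fg; apply: le_Rintegral => //; exact: intJ.
Qed.

Let J_FTC f (F : R -> R) : continuous f ->
  (forall x, is_derive x 1 F (f x)) -> J f = F (pi / 2) - F 0.
Proof.
move=> cf dF; rewrite /J /Rintegral (@continuous_FTC2 _ _ F).
- by [].
- by rewrite divr_gt0// pi_gt0.
- exact: continuous_subspaceT.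
- have cF x : {for x, continuous F}.
    by apply/differentiable_continuous/derivable1_diffP; have [] := dF x.
  split; first by move=> x _; have [] := dF x.
  + by apply/cvg_at_right_filter/cF.
  + by apply/cvg_at_left_filter/cF.
- by move=> x _; rewrite derive1E; have [_ ->] := dF x.
Qed.

(** At [b = 2 * s] the ratio of [J (cI 0 b)] to [J (cI 0 0)] is [sin (pi * s) / (pi * s)], and
    raising the exponent by two splits off one factor of the sine product. *)
Let cI n b x := cos x ^+ n * cos (b * x).

Let continuous_cosM b : continuous (fun x : R => cos (b * x)).
Proof.
move=> x; apply: (@continuous_comp _ _ _ (fun t : R => b * t) cos).
  exact: mulrl_continuous.
exact: continuous_cos.
Qed.

Let continuous_cI n b : continuous (cI n b).
Proof.
move=> x; apply: (@continuousM _ _ (fun t => cos t ^+ n)); last exact: continuous_cosM.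
apply: (@continuous_comp _ _ _ cos (fun t => t ^+ n)); first exact: continuous_cos.
exact: exprn_continuous.
Qed.

Let is_derive_cosM b x : is_derive x 1 (fun t : R => cos (b * t)) (- (b * sin (b * x))).
Proof.
by apply: is_derive_eq; rewrite /GRing.scale/=; ring.
Qed.

Let is_derive_sinM b x : is_derive x 1 (fun t : R => sin (b * t)) (b * cos (b * x)).
Proof.
by apply: is_derive_eq; rewrite /GRing.scale/=; ring.
Qed.

(* u = cos^n and v = cos (b x) satisfy v'' = - b^2 v and
   u'' = n (n - 1) cos^(n - 2) - n^2 u, so both sides differ by the
   integral of (u v' - u' v)'. *)
Let J_cI_rec n b :
  (n.+2%:R ^+ 2 - b ^+ 2) * J (cI n.+2 b) = n.+2%:R * n.+1%:R * J (cI n b).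
Proof.
have cZ (c : R) m : continuous (fun x => c * cI m b x).
  by move=> x; apply: continuousM; [exact: cst_continuous|exact: continuous_cI].
suff : J (fun x => (n.+2%:R ^+ 2 - b ^+ 2) * cI n.+2 b x +
    - (n.+2%:R * n.+1%:R) * cI n b x) = 0.
  by rewrite JD// !JZ//; lra.
apply: (eq_trans (@J_FTC _ (fun x => - b * (cos x ^+ n.+2 * sin (b * x)) +
  n.+2%:R * (cos x ^+ n.+1 * (sin x * cos (b * x)))) _ _)).
- by move=> x; apply: cvgD; exact: cZ.
- move=> x; have d2 := is_derive_expn n.+1 (is_derive_cos x).
  have d1 := is_derive_expn n (is_derive_cos x).
  have ds := is_derive_sinM b x; have dc := is_derive_cosM b x.
  apply: is_derive_eq; rewrite /GRing.scale/= /cI !exprSr.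
  have s2 : sin x * sin x = 1 - cos x * cos x by rewrite -!expr2 sin2cos2.
  ring: s2.
- by rewrite mulr0 sin0 cos_pihalf !expr0n/=; ring.
Qed.

Let J_cI0 b : b != 0 -> J (cI 0 b) = sin (b * (pi / 2)) / b.
Proof.
move=> b0; apply: (eq_trans (@J_FTC _ (fun x => b^-1 * sin (b * x)) _ _)).
- exact: continuous_cI.
- move=> x; have ds := is_derive_sinM b x.
  by apply: is_derive_eq; rewrite /GRing.scale/= /cI expr0; field.
- by rewrite mulr0 sin0 mulr0 subr0 mulrC.
Qed.

Let J_cI00 : J (cI 0 0) = pi / 2.
Proof.
apply: (eq_trans (@J_FTC _ id _ _)); last by rewrite subr0.
- exact: continuous_cI.
- by move=> x; apply: is_derive_eq; rewrite /cI expr0 mul0r cos0 mul1r.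
Qed.

Let J_cI_gt0 k : 0 < J (cI k.*2 0).
Proof.
elim: k => [|k IH]; first by rewrite J_cI00 divr_gt0// pi_gt0.
have := J_cI_rec k.*2 0; rewrite expr0n subr0 => /eqP.
by rewrite doubleS -(pmulr_rgt0 _ (exprn_gt0 2 (ltr0Sn _ k.*2.+1))) => /eqP ->;
    rewrite !mulr_gt0.
Qed.

(** High powers of cos concentrate at 0. With [1 - cos (b * x) <= b ^+ 2 * x ^+ 2 / 2] and
    [x * cos x <= sin x], the defect is at most [b ^+ 2 / 2] times the integral of [h], which
    integration by parts evaluates as the integral of the power of cos divided by its exponent. *)
Let J_cI_ratio k b : `|J (cI k.+1.*2 b) / J (cI k.+1.*2 0) - 1| <= b ^+ 2 / 2 / k.+1%:R.
Proof.
set n := k.+1.*2; have nE : n = n.-1.+1 by [].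
have J0 : 0 < J (cI n 0) by exact: J_cI_gt0.
have kn : (k.+1 <= n)%N by rewrite /n -addnn leq_addr.
have n0 : n%:R != 0 :> R by rewrite pnatr_eq0.
move: n nE J0 kn n0 => [//|n] _ J0 kn n0.
have c0 x : 0 <= x <= pi / 2 -> 0 <= cos x.
  move=> /andP[x0 xpi]; rewrite cos_ge0_pihalf// xpi (le_trans _ x0)//.
  by rewrite oppr_le0 divr_ge0// pi_ge0.
pose h x := x * (cos x ^+ n * sin x).
have ch : continuous h.
  move=> x; apply: (@continuousM _ _ id) => //.
  apply: (@continuousM _ _ (fun t => cos t ^+ n)); last exact: continuous_sin.
  apply: (@continuous_comp _ _ _ cos (fun t => t ^+ n)); first exact: continuous_cos.
  exact: exprn_continuous.
have cZ (c : R) : continuous (fun x => c * cI n.+1 0 x).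
  by move=> x; apply: continuousM; [exact: cst_continuous|exact: continuous_cI].
have hE : J h = n.+1%:R^-1 * J (cI n.+1 0).
  suff : J (fun x => h x + - n.+1%:R^-1 * cI n.+1 0 x) = 0.
    by rewrite JD// JZ// mulNr => /eqP; rewrite subr_eq0 => /eqP.
  apply: (eq_trans (@J_FTC _ (fun x => - n.+1%:R^-1 * (x * cos x ^+ n.+1)) _ _)).
  - by move=> x; apply: cvgD; [exact: ch|exact: cZ].
  - move=> x; have d1 := is_derive_expn n (is_derive_cos x).
    apply: is_derive_eq; rewrite /GRing.scale/= /cI /h mul0r cos0 /=.
    by rewrite exprSr; field; rewrite ?nat1r ?pnatr_eq0.
  - by rewrite cos_pihalf mul0r expr0n/= !mulr0 subrr.
have up : J (cI n.+1 b) <= J (cI n.+1 0).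
  apply: Jle; [exact: continuous_cI|exact: continuous_cI|move=> x xpi].
  by rewrite /cI mul0r cos0 ler_wpM2l ?exprn_ge0 ?c0 ?cos_le1.
have lo : J (cI n.+1 0) - b ^+ 2 / 2 * J h <= J (cI n.+1 b).
  have ch2 : continuous (fun x => - (b ^+ 2 / 2) * h x).
    by move=> x; apply: (@continuousM _ _ (cst (- (b ^+ 2 / 2))) h);
        [exact: cst_continuous|exact: ch].
  have -> : J (cI n.+1 0) - b ^+ 2 / 2 * J h =
      J (fun x => cI n.+1 0 x + - (b ^+ 2 / 2) * h x) by rewrite JD// JZ// mulNr.
  apply: Jle => [x||x /[dup] xpi /andP[x0 xpi2]].
  - by apply: cvgD; [exact: continuous_cI|exact: ch2].
  - exact: continuous_cI.
  have xs : x * cos x <= sin x.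
    by rewrite xcos_le_sin// x0 (le_trans xpi2)// ler_pdivrMr// ler_peMr ?pi_ge0// ler1n.
  have cn : 0 <= cos x ^+ n by rewrite exprn_ge0 ?c0.
  have : cI n.+1 0 x * (b ^+ 2 * x ^+ 2 / 2) <= b ^+ 2 / 2 * h x.
    rewrite /cI /h mul0r cos0 mulr1 exprSr.
    rewrite (_ : _ * _ = b ^+ 2 / 2 * (x * (cos x ^+ n * (x * cos x)))); last by field.
    by rewrite ler_wpM2l ?divr_ge0 ?sqr_ge0// ler_wpM2l// ler_wpM2l.
  have := cos_ge (b * x); rewrite exprMn => /(ler_wpM2l (exprn_ge0 n.+1 (c0 x xpi))).
  rewrite /cI mul0r cos0 mulr1; lra.
have Jn0 : J (cI n.+1 0) != 0 by rewrite gt_eqF.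
rewrite -[X in _ / _ - X](divff Jn0) -mulrBl normrM normfV (gtr0_norm J0).
rewrite ler_pdivrMr// ler0_norm ?subr_le0// opprB.
move: lo; rewrite hE => lo.
have : b ^+ 2 / 2 * (n.+1%:R^-1 * J (cI n.+1 0)) <= b ^+ 2 / 2 / k.+1%:R * J (cI n.+1 0).
  rewrite mulrA ler_wpM2r ?(ltW J0)// ler_wpM2l ?divr_ge0 ?sqr_ge0//.
  by rewrite lef_pV2 ?posrE ?ltr0n ?ler_nat// (leq_trans _ kn).
move=> /(le_trans _); apply; rewrite lerBlDr addrC -lerBlDr.
exact: lo.
Qed.

(** The recursion with exponents [2 * k] and [b = 2 * s] reads [r k = r k.+1 * (1 - s ^+ 2 / k.+1%:R
    ^+ 2)]. Hence [r k] times the k-th partial product is constantly [r 0], while [r k] tends to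
    1. *)
Lemma cvg_sine_product s : 0 < s ->
  \prod_(j < k) (1 - s ^+ 2 / j.+1%:R ^+ 2) @[k --> \oo] --> sin (pi * s) / (pi * s).
Proof.
move=> s0; have pin0 : (pi : R) != 0 by rewrite gt_eqF// pi_gt0.
have sn0 : s != 0 by rewrite gt_eqF.
pose r k := J (cI k.*2 (2 * s)) / J (cI k.*2 0).
have r0E : r 0%N = sin (pi * s) / (pi * s).
  rewrite /r J_cI00 J_cI0 ?mulf_neq0 ?gt_eqF//.
  have -> : 2 * s * (pi / 2) = pi * s :> R by move: (pi : R) => p; field.
  move: (sin _) => q; move: (pi : R) pin0 => p p0.
  by field; rewrite p0 sn0.
have rS k : r k = r k.+1 * (1 - s ^+ 2 / k.+1%:R ^+ 2).
  have J1 := J_cI_gt0 k; have J2 := J_cI_gt0 k.+1.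
  have e1 := J_cI_rec k.*2 (2 * s); have e2 := J_cI_rec k.*2 0.
  rewrite /r; move: e1 e2 J1 J2; rewrite doubleS expr0n subr0.
  have kE : k.*2.+2%:R = 2 * k.+1%:R :> R by rewrite -doubleS -muln2 mulnC natrM.
  rewrite kE; set A := J (cI _.+2 (2 * s)); set B := J (cI _.+2 0).
  set C := J (cI _ (2 * s)); set D := J (cI _ 0) => e1 e2 D0 B0.
  have k0 : (k.+1%:R : R) != 0 by rewrite pnatr_eq0.
  have m0 : (k.*2.+1%:R : R) != 0 by rewrite pnatr_eq0.
  have C' : C = ((2 * k.+1%:R) ^+ 2 - (2 * s) ^+ 2) * A / (2 * k.+1%:R * k.*2.+1%:R).
    by rewrite e1; move: (k.+1%:R) k0 (k.*2.+1%:R) m0 => p p0 q q0; field; rewrite p0 q0.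
  have D' : D = (2 * k.+1%:R) ^+ 2 * B / (2 * k.+1%:R * k.*2.+1%:R).
    by rewrite e2; move: (k.+1%:R) k0 (k.*2.+1%:R) m0 => p p0 q q0; field; rewrite p0 q0.
  have Bn0 : B != 0 by rewrite gt_eqF.
  by rewrite C' D'; move: (k.+1%:R) k0 (k.*2.+1%:R) m0 => p p0 q q0; field; rewrite p0 q0 Bn0.
have rp k : r k * \prod_(j < k) (1 - s ^+ 2 / j.+1%:R ^+ 2) = r 0%N.
  elim: k => [|k IH]; first by rewrite big_ord0 mulr1.
  by rewrite big_ord_recr/= mulrCA -rS mulrC.
have r1 : r k @[k --> \oo] --> (1 : R).
  apply/cvgrPdist_le => e e0.
  have [N Ne] : exists N : nat, (2 * s) ^+ 2 / 2 / e < N%:R.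
    by exists (Num.truncn ((2 * s) ^+ 2 / 2 / e)).+1; exact: truncnS_gt.
  exists N.+1 => // -[//|k] /= Nk; rewrite distrC (le_trans (J_cI_ratio k (2 * s)))//.
  rewrite ler_pdivrMr// -ler_pdivrMl// mulrC (le_trans (ltW Ne))// ler_nat.
  by rewrite ltnW// ltnS ltnW.
rewrite -r0E -[X in _ --> X]mulr1 -[X in _ * X]invr1.
have : r 0%N / r k @[k --> \oo] --> r 0%N * 1^-1.
  by apply: cvgM; [exact: cvg_cst|apply: cvgV => //; exact: oner_neq0].
apply: cvg_trans; apply: near_eq_cvg.
have : \forall k \near \oo, 0 < r k.
  by apply: (cvgr_gt 1) => //.
apply: filterS => k rk0; rewrite -(rp k) mulrC mulKf ?gt_eqF//.
Qed.

End sine_product.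

(** * The reflection formula *)

Section reflection.
Context {R : realType}.
Implicit Types a : R.

Lemma preimage_scale_0y (k : R) : 0 < k -> *%R k @^-1` pos = pos :> set R.
Proof.
by move=> k0; apply/seteqP; split=> x /=; rewrite !in_itv/= !andbT pmulr_rgt0.
Qed.

(** In the product of the two integrals, substitute [t = y * v] in the one for [a]: the powers of
    [y] cancel. Integrating [expR (- ((1 + v) * y))] over [y] first leaves [(1 + v)^-1]. *)
Lemma gamma_int_reflection a : 0 < a < 1 ->
  (gamma_int a * gamma_int (1 - a) =
   \int[mu]_(v in pos) (v `^ (a - 1) / (1 + v))%:E)%E.
Proof.
move=> /andP[a0 a1].
have [fa _] := gamma_int_fin a0.
pose f (z : R * R) : \bar R := (z.2 `^ (a - 1) * expR (- ((1 + z.2) * z.1)))%:E.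
have mf : measurable_fun setT f.
  by rewrite /f; mfun.
have f0 z : (0 <= f z)%E by rewrite lee_fin mulr_ge0 ?powR_ge0 ?expR_ge0.
rewrite {2}/gamma_int -ge0_integralZl//; last 3 first.
- exact: measurable_powR_expR.
- by move=> t _; rewrite lee_fin mulr_ge0 ?powR_ge0 ?expR_ge0.
- exact: gamma_int_ge0.
transitivity (\int[mu]_(y in pos) \int[mu]_(v in pos) f (y, v))%E.
  apply: eq_integral => y; rewrite inE/= in_itv/= andbT => y0.
  rewrite /gamma_int (@ge0_integral_scale _ y)//; last 2 first.
  - exact: measurable_powR_expR.
  - by move=> t _; rewrite lee_fin mulr_ge0 ?powR_ge0 ?expR_ge0.
  rewrite preimage_scale_0y// muleAC -EFinM -ge0_integralZl//; last 3 first.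
  - by mfun.
  - by move=> t _; rewrite lee_fin mulr_ge0 ?powR_ge0 ?expR_ge0.
  - by rewrite lee_fin mulr_ge0 ?mulr_ge0 ?powR_ge0 ?expR_ge0// ltW.
  apply: eq_integral => v; rewrite inE/= in_itv/= andbT => v0.
  rewrite /f/= -EFinM; congr EFin; rewrite powRM ?ltW//.
  have -> : 1 - a - 1 = - a by ring.
  have y1 : y * y `^ (- a) * y `^ (a - 1) = 1.
    rewrite -{1}(powRr1 (ltW y0)) -!powRD ?(gt_eqF y0) ?implybT//.
    by rewrite (_ : _ + _ = 0) ?powRr0//; ring.
  rewrite (_ : - ((1 + v) * y) = - y + - (y * v)); last by ring.
  rewrite expRD.
  transitivity ((y * y `^ (- a) * y `^ (a - 1)) * (v `^ (a - 1) * (expR (- y) * expR (-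
      (y * v))))).
    by ring.
  by rewrite y1 mul1r.
rewrite fubini_tonelli_in//.
apply: eq_integral => v; rewrite inE/= in_itv/= andbT => v0.
rewrite /f/=; under eq_integral do rewrite EFinM.
rewrite ge0_integralZl//.
- by rewrite integral_expR ?addr_gt0// -EFinM.
- by mfun.
- by rewrite lee_fin powR_ge0.
Qed.

(** Wendel's inequality raises [a + n] by [1 - a] and [1 - a + n] by [a]; both land on [n + 1], and
    the exponents of the two power factors add up to one. *)
Lemma Gamma_mul_ge a n : 0 < a < 1 ->
  n`!%:R ^+ 2 <= n.+1%:R * (Gamma (a + n%:R) * Gamma (1 - a + n%:R)).
Proof.
move=> /andP[a0 a1].
have an0 : 0 < a + n%:R by rewrite ltr_wpDr.
have bn0 : 0 < 1 - a + n%:R by rewrite ltr_wpDr// subr_gt0.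
have n1 : n.+1%:R = n%:R + 1 :> R by rewrite natr1.
have h1 : n`!%:R <= (n.+1%:R : R) `^ (1 - a) * Gamma (a + n%:R).
  have c01 : 0 <= 1 - a <= 1 by lra.
  rewrite -Gamma_nat (_ : n.+1%:R = a + n%:R + (1 - a)); last by lra.
  apply: (le_trans (Gamma_le an0 c01)).
  apply: ler_wpM2r; first by rewrite ltW ?Gamma_gt0.
  by apply: ge0_ler_powR; rewrite ?nnegrE; lra.
have h2 : n`!%:R <= (n.+1%:R : R) `^ a * Gamma (1 - a + n%:R).
  have c01 : 0 <= a <= 1 by lra.
  rewrite -Gamma_nat (_ : n.+1%:R = 1 - a + n%:R + a); last by lra.
  apply: (le_trans (Gamma_le bn0 c01)).
  apply: ler_wpM2r; first by rewrite ltW ?Gamma_gt0.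
  by apply: ge0_ler_powR; rewrite ?nnegrE; lra.
rewrite expr2 (le_trans (ler_pM _ _ h1 h2))// mulrACA -powRD ?pnatr_eq0 ?implybT//.
by rewrite subrK powRr1.
Qed.

(** Wendel's inequality in the other direction, starting from [n + 1] and raising it by [a] and by
    [1 - a]. *)
Lemma Gamma_mul_le a n : 0 < a < 1 ->
  Gamma (a + n.+1%:R) * Gamma (1 - a + n.+1%:R) <= n.+1%:R * n`!%:R ^+ 2.
Proof.
move=> /andP[a0 a1]; have n0 : 0 < n.+1%:R :> R by [].
have c0 : 0 <= a <= 1 by lra.
have c1 : 0 <= 1 - a <= 1 by lra.
have nE : n.+1%:R `^ a * n.+1%:R `^ (1 - a) = n.+1%:R :> R.
  by rewrite -powRD ?pnatr_eq0 ?implybT// subrKC powRr1.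
have -> : n.+1%:R * n`!%:R ^+ 2 =
    (n.+1%:R `^ a * n`!%:R) * (n.+1%:R `^ (1 - a) * n`!%:R) :> R.
  by rewrite mulrACA nE expr2.
have n0' := ltW n0.
rewrite ![_ + n.+1%:R]addrC -Gamma_nat; apply: ler_pM.
- by rewrite ltW// Gamma_gt0//; lra.
- by rewrite ltW// Gamma_gt0//; lra.
- exact: Gamma_le.
- exact: Gamma_le.
Qed.

(** The functional equation iterated. The factor [a + n] turns [Gamma (a + n)] into
    [Gamma (1 + a + n)], so that each step multiplies by the symmetric
    [(n + 1 + a) * (n + 1 - a)]. *)
Lemma Gamma_mul_prod a n : 0 < a < 1 ->
  (a + n%:R) * (Gamma (a + n%:R) * Gamma (1 - a + n%:R)) =
  Gamma a * Gamma (1 - a) * a * n`!%:R ^+ 2 *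
  \prod_(j < n) (1 - a ^+ 2 / j.+1%:R ^+ 2).
Proof.
move=> /andP[a0 a1]; elim: n => [|n IH].
  by rewrite big_ord0 !addr0 fact0; ring.
have n0 : n.+1%:R != 0 :> R by rewrite pnatr_eq0.
have an0 : 0 < a + n%:R by rewrite ltr_wpDr.
have bn0 : 0 < 1 - a + n%:R by rewrite ltr_wpDr// subr_gt0.
rewrite -natr1 !addrA !GammaS//.
rewrite big_ord_recr/= factS natrM.
transitivity ((a + n%:R) * (Gamma (a + n%:R) * Gamma (1 - a + n%:R)) *
   (n.+1%:R ^+ 2 - a ^+ 2)).
  by rewrite -natr1; ring.
rewrite IH; move: (n.+1%:R) n0 => p p0; by field.
Qed.

(** Used with [q] equal to n + 1, [F] to the square of n! and [G] to the product of gamma values at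
    [a + q] and [1 - a + q], so that [q ^+ 2 * F] is the square of (n + 1)!. *)
Let squeeze_bound a q G F : 0 < a < 1 -> 0 < q -> 0 <= G -> G <= q * F ->
  q ^+ 2 * F <= (q + 1) * G ->
  (1 - (q + 1)^-1) * (q ^+ 2 * F) <= (a + q) * G <= (1 + q^-1) * (q ^+ 2 * F).
Proof.
move=> /andP[a0 a1] q0 G0 G1 G2.
have aqG : q * G <= (a + q) * G by rewrite ler_wpM2r// lerDr ltW.
have aqG' : (a + q) * G <= (q + 1) * G by rewrite ler_wpM2r// addrC lerD2l ltW.
have q1 : 0 < q + 1 by rewrite addr_gt0.
have qn0 : q != 0 by rewrite gt_eqF.
have q1n0 : q + 1 != 0 by rewrite gt_eqF.
apply/andP; split.
  apply: le_trans aqG; rewrite (_ : 1 - (q + 1)^-1 = q / (q + 1)); last by field.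
  by rewrite mulrAC ler_pdivrMr// -[q * G * _]mulrA ler_pM2l// [G * _]mulrC.
apply: (le_trans aqG'); rewrite (_ : (1 + q^-1) * _ = (q + 1) * (q * F)).
  by rewrite ler_pM2l.
by field.
Qed.

(** The sequence [g * a * p n.+1] has two limits: one from the sine product, and 1 from Wendel's
    bounds. Equating them gives the formula. *)
Lemma Gamma_reflection a : 0 < a < 1 -> Gamma a * Gamma (1 - a) = pi / sin (pi * a).
Proof.
move=> /[dup] a01 /andP[a0 a1].
set g := Gamma a * Gamma (1 - a); pose p n := \prod_(j < n) (1 - a ^+ 2 / j.+1%:R ^+ 2).
have spos : 0 < sin (pi * a).
  by rewrite sin_gt0_pi// mulr_gt0 ?pi_gt0//= gtr_pMr ?pi_gt0.
have c1 : g * a * p n.+1 @[n --> \oo] --> g * a * (sin (pi * a) / (pi * a)).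
  apply: cvgMr; have := cvg_sine_product a0.
  by rewrite -cvg_shiftS.
have c2 : g * a * p n.+1 @[n --> \oo] --> (1 : R).
  have h0 : @harmonic R @ \oo --> 0 := @cvg_harmonic R.
  apply: (@squeeze_cvgr _ _ _ _ (fun n => 1 - harmonic n.+1) (fun n => 1 + harmonic n)).
  - apply: nearW => n; have gp := Gamma_mul_prod n.+1 a01.
    have ff : 0 < n.+1`!%:R ^+ 2 :> R by rewrite exprn_gt0// ltr0n fact_gt0.
    have E : g * a * p n.+1 = (a + n.+1%:R) * (Gamma (a + n.+1%:R) * Gamma
        (1 - a + n.+1%:R)) / n.+1`!%:R ^+ 2.
      by rewrite gp; apply/esym; rewrite mulrAC mulfK ?gt_eqF.
    rewrite E ler_pdivlMr// ler_pdivrMr//.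
    have an : 0 < a + n.+1%:R by rewrite addr_gt0.
    have := Gamma_mul_ge n.+1 a01; have := Gamma_mul_le n a01.
    rewrite factS natrM exprMn -[n.+2%:R]natr1 /harmonic/= -[n.+2%:R]natr1 => G1 G2.
    apply: squeeze_bound => //.
    by rewrite mulr_ge0// ltW// Gamma_gt0// addr_gt0// subr_gt0.
  - rewrite -[X in _ --> X]subr0; apply: cvgB; first exact: cvg_cst.
    by move: h0; rewrite -cvg_shiftS.
  - by rewrite -[X in _ --> X]addr0; apply: cvgD; first exact: cvg_cst.
have : g * a * (sin (pi * a) / (pi * a)) = 1 by exact: cvg_unique c1 c2.
have pin0 : (pi : R) != 0 by rewrite gt_eqF// pi_gt0.
move: spos; move: (sin _) => q q0; move: (pi : R) pin0 => r r0 h.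
have qn0 : q != 0 by rewrite gt_eqF.
have an0 : a != 0 by rewrite gt_eqF.
apply: (@mulIf _ (q / r)); first by rewrite mulf_neq0 ?invr_neq0.
rewrite (_ : r / q * (q / r) = 1); last by field; rewrite r0 qn0.
by rewrite -h; field; rewrite r0 an0.
Qed.

Lemma integral_powR_div1D a : 0 < a < 1 ->
  (\int[mu]_(v in pos) (v `^ (a - 1) / (1 + v))%:E = (pi / sin (pi * a))%:E)%E.
Proof.
move=> /[dup] a01 /andP[a0 a1].
by rewrite -gamma_int_reflection// -!GammaE ?subr_gt0// -EFinM Gamma_reflection.
Qed.

End reflection.

(** * The logarithmic moment generating function *)

Section phi.
Context {R : realType}.
Implicit Types (v A L : R).

Definition phi v : R := v - ln (1 + v).

Lemma is_derive_phi v : 0 <= v -> is_derive v 1 phi (v / (1 + v)).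
Proof.
move=> v0; have v1 : 0 < 1 + v by rewrite ltr_pwDl.
have d1 := is_derive1_ln v1.
have d2 : is_derive v 1 (fun t : R => ln (1 + t)) ((1 + v)^-1).
  have -> : (fun t : R => ln (1 + t)) = @ln R \o (fun t => 1 + t) by [].
  by apply: is_derive_eq; rewrite add0r !mulr1.
rewrite -[phi]/(fun t => t - ln (1 + t)).
by apply: is_derive_eq; field; rewrite gt_eqF.
Qed.

Lemma phi0 : phi 0 = 0. Proof. by rewrite /phi addr0 ln1 subrr. Qed.

Lemma phi_le v w : 0 <= v -> v <= w -> phi v <= phi w.
Proof.
move=> v0 vw; apply: (@is_derive_le _ phi (fun t => t / (1 + t))) => // t /andP[vt _].
  exact/is_derive_phi/(le_trans v0).
by have t0 := le_trans v0 vt; rewrite divr_ge0// addr_ge0.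
Qed.

Lemma phi_ge0 v : 0 <= v -> 0 <= phi v.
Proof. by move=> v0; rewrite -phi0 phi_le. Qed.

Lemma phi_le_id v : 0 <= v -> phi v <= v.
Proof. by move=> v0; rewrite /phi gerBl ln_ge0// lerDl. Qed.

(** Compares the derivatives [t / (1 + t)] and [t / 2]. It later converts a bound on sums of [phi]
    into one on sums of squared coefficients. *)
Lemma phi_ge_sqr v : 0 <= v <= 1 -> v ^+ 2 / 4 <= phi v.
Proof.
move=> /andP[v0 v1]; rewrite -subr_ge0.
have := @is_derive_le _ (fun t => phi t - t ^+ 2 / 4) (fun t => t / (1 + t) - t / 2) _ _ v0.
rewrite phi0 expr0n/= mul0r subrr; apply => t /andP[t0 tv].
  have d1 := is_derive_phi t0; have d2 := is_derive_expn 1 (is_derive_id t 1).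
  by apply: is_derive_eq; rewrite /GRing.scale/=; field; rewrite gt_eqF// ltr_pwDl.
have t1 : 0 < 1 + t by rewrite ltr_pwDl.
rewrite subr_ge0 ler_wpM2l// lef_pV2 ?posrE//.
by rewrite -[2]/(1 + 1) lerD2l (le_trans tv).
Qed.

(* [w `^ (-1)] rather than [w^-1] for the sake of measurability *)
Lemma phi_integral v : 0 <= v ->
  (phi v)%:E = (\int[mu]_(w in `]0%R, v]) (w * (1 + w) `^ (-1))%:E)%E.
Proof.
rewrite le_eqVlt => /predU1P[<-|v0].
  by rewrite set_itv_ge ?bnd_simp ?ltxx// integral_set0 phi0.
have cf (x : R) : 0 <= x -> {for x, continuous (fun w : R => w * (1 + w) `^ (-1))}.
  move=> x0; apply: (@continuousM _ _ id) => //.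
  apply: (@continuous_comp _ _ _ (fun w : R => 1 + w) (fun w => w `^ (-1))).
    by apply: cvgD; [exact: cvg_cst|exact: cvg_id].
  by apply: continuous_powR_gt0; rewrite ltr_pwDl.
rewrite integral_itv_obnd_cbnd; last by mfun.
rewrite (@continuous_FTC2 _ _ phi)//.
- by rewrite phi0 sube0.
- apply: continuous_in_subspaceT => x /[!inE]/=; rewrite in_itv/= => /andP[x0 _].
  exact: cf.
- have dphi (x : R) : 0 <= x -> derivable phi x 1 by move=> /is_derive_phi [].
  have cphi (x : R) : 0 <= x -> {for x, continuous phi}.
    by move=> x0; apply/differentiable_continuous/derivable1_diffP/dphi.
  split.
  + by move=> x; rewrite in_itv/= => /andP[x0 _]; apply: dphi; exact: ltW.
  + exact/cvg_at_right_filter/cphi.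
  + exact/cvg_at_left_filter/cphi/ltW.
- move=> x; rewrite in_itv/= => /andP[x0 _]; rewrite derive1E.
  have [_ ->] := is_derive_phi (ltW x0).
  by rewrite powR_inv1// addr_ge0// ltW.
Qed.

Lemma integral_phi_powR A L : 0 < A -> 0 < L < 2^-1 ->
  (\int[mu]_(u in pos) (phi (A * u `^ (L - 1)))%:E =
   (A `^ ((1 - L)^-1) * (pi / sin (pi * (2 - (1 - L)^-1))))%:E)%E.
Proof.
move=> A0 /andP[L0 L2]; set p := (1 - L)^-1.
have L1 : 0 < 1 - L by lra.
have p1 : 1 < p by rewrite invf_cp1// gtrBl.
have p2 : p < 2 by rewrite /p invf_plt ?posrE//; lra.
pose E : set (R * R) := [set z | z.2 <= A * z.1 `^ (L - 1)].
have mE : measurable E.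
  rewrite -[E]setTI; apply: (@measurable_fun_ler _ _ _ _ snd (fun z =>
      A * z.1 `^ (L - 1)) _ _ measurableT [set true]) => //.
  by mfun.
pose f (z : R * R) := (z.2 * (1 + z.2) `^ (-1) * \1_E z)%:E.
have mf : measurable_fun setT f.
  apply/measurable_EFinP/measurable_funM; first by mfun.
  exact: measurable_indic.
transitivity (\int[mu]_(u in pos) \int[mu]_(w in pos) f (u, w))%E.
  apply: eq_integral => u; rewrite inE/= in_itv/= andbT => u0.
  rewrite phi_integral; last by rewrite mulr_ge0 ?powR_ge0// ltW.
  set v := A * _.
  have -> : `]0, v]%classic = (pos `&` `]-oo, v]) :> set R.
    by apply/seteqP; split=> x /=; rewrite !in_itv/= andbT => /andP.
  rewrite integral_mkcondr; apply: eq_integral => w _.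
  rewrite patchE /f/= indicE; case: ifPn => wv.
    rewrite (_ : _ \in E) ?mulr1//; move: wv; rewrite !inE/= in_itv//=.
  rewrite (_ : _ \in E = false) ?mulr0//; apply/negbTE; move: wv.
  by apply: contra; rewrite !inE/= ?in_itv.
rewrite fubini_tonelli_in//; last first.
  move=> u w; rewrite /= !in_itv/= !andbT => u0 w0.
  by rewrite lee_fin !mulr_ge0 ?powR_ge0 ?(ltW w0).
transitivity (\int[mu]_(w in pos) ((A `^ p)%:E * (w `^ ((2 - p) - 1) * (1 + w)`^(-1))%:E))%E.
  apply: eq_integral => w; rewrite inE/= in_itv/= andbT => w0.
  rewrite /f/=; under eq_integral do rewrite EFinM.
  rewrite ge0_integralZl//; last 2 first.
  - apply/measurable_EFinP/measurable_funTS.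
    apply: (@measurableT_comp _ _ _ _ _ _ (\1_E : R * R -> R)); first exact: measurable_indic.
    exact: pair2_measurable.
  - by rewrite lee_fin mulr_ge0 ?powR_ge0 ?(ltW w0).
  have -> : (\int[mu]_(u in pos) (\1_E (u, w))%:E = ((A / w) `^ p)%:E)%E.
    transitivity (\int[mu]_(u in pos) (\1_(`]-oo, (A / w) `^ p]%classic : set R) u)%:E)%E.
      apply: eq_integral => u; rewrite inE/= in_itv/= andbT => u0.
      rewrite !indicE; congr ((nat_of_bool _)%:R)%:E.
      have -> : ((u, w) \in E) = (u `^ (1 - L) <= A / w).
        have -> : (u `^ (1 - L) <= A / w) = (w <= A * u `^ (L - 1)).
          rewrite -(opprB 1 L) powRN ler_pdivlMr// ler_pdivlMr ?powR_gt0//.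
          by rewrite mulrC.
        by apply/idP/idP; rewrite !inE.
      rewrite mem_setE in_itv/=.
      have uE : u = (u `^ (1 - L)) `^ p by rewrite -powRrM divff ?gt_eqF// powRr1// ltW.
      have p0 : 0 < p by rewrite invr_gt0.
      have Aw : 0 <= A / w by rewrite divr_ge0 ?ltW.
      have [h|h] := leP (u `^ (1 - L)) (A / w).
        apply/esym; rewrite [X in X <= _]uE.
        by apply: ge0_ler_powR; rewrite ?nnegrE ?powR_ge0 ?(ltW p0).
      symmetry; apply: negbTE; rewrite -ltNge [X in _ < X]uE.
      by apply: gt0_ltr_powR; rewrite ?nnegrE ?powR_ge0.
    rewrite integral_indic//.
    have -> : `]-oo, (A / w) `^ p] `&` pos = `]0, (A / w) `^ p]%classic :> set R.
      apply/seteqP; split=> x /=; rewrite !in_itv/= ?andbT.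
        by move=> [-> ->].
      by move=> /andP[-> ->].
    by apply: (etrans (lebesgue_measure_itv _)); rewrite /= lte_fin powR_gt0 ?divr_gt0// sube0.
  rewrite -!EFinM; congr EFin.
  have -> : 2 - p - 1 = 1 + - p by ring.
  rewrite powRD ?(gt_eqF w0) ?implybT// powRr1 ?(ltW w0)//.
  rewrite powRM ?invr_ge0 ?(ltW w0) ?(ltW A0)// -(powR_inv1 (ltW w0)) -powRrM mulN1r.
  by ring.
rewrite ge0_integralZl//; last 3 first.
- by mfun.
- by move=> w _; rewrite lee_fin mulr_ge0 ?powR_ge0.
- by rewrite lee_fin powR_ge0.
rewrite EFinM -integral_powR_div1D; last by lra.
congr (_ * _)%E; apply: eq_integral => w; rewrite inE/= in_itv/= andbT => w0.
by rewrite powR_inv1// addr_ge0// ltW.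
Qed.

End phi.

(** * Comparison of sums with integrals of nonincreasing functions *)

Section sum_integral.
Context {R : realType}.
Variable g : R -> R.
Hypothesis mg : measurable_fun setT g.
Hypothesis g_ge0 : forall x : R, 0 < x -> 0 <= g x.
Hypothesis g_dec : forall x y : R, 0 < x -> x <= y -> g y <= g x.

Let mEg (D : set R) : measurable_fun D (EFin \o g).
Proof. exact/measurable_EFinP/measurable_funTS. Qed.

Let integral_cat n :
  (\int[mu]_(x in `]0%R, n.+1%:R]) (g x)%:E =
   \int[mu]_(x in `]0%R, n%:R]) (g x)%:E +
   \int[mu]_(x in `]n%:R, n.+1%:R]) (g x)%:E)%E.
Proof.
rewrite -ge0_integral_setU//=; [|exact: mEg| |].
- congr (integral _ _ _); rewrite -itv_bndbnd_setU ?bnd_simp ?ler0n//.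
  by rewrite ler_nat.
- by move=> x [|]; rewrite /= ?in_itv/= => /andP[x0 _];
    rewrite lee_fin g_ge0// (le_lt_trans _ x0).
- apply/disj_setPS => x [] /=; rewrite ?in_itv/= => /andP[_ +] /andP[+ _].
  by move=> /le_lt_trans /[apply]; rewrite ltxx.
Qed.

Let integral_unit n (c : R) :
  (\int[mu]_(x in `]n%:R, n.+1%:R]) (cst c%:E) x = c%:E)%E.
Proof.
rewrite integral_cst//= lebesgue_measure_itv/= lte_fin ltr_nat ltnSn.
by rewrite -EFinB -natrB// subSnn mule1.
Qed.

Lemma sum_le_integral n :
  ((\sum_(m < n) g m.+1%:R)%:E <= \int[mu]_(x in pos) (g x)%:E)%E.
Proof.
apply: (@le_trans _ _ (\int[mu]_(x in `]0%R, n%:R]) (g x)%:E)%E).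
  elim: n => [|n IH].
    by rewrite big_ord0; apply: integral_ge0 => x /=; rewrite ?in_itv/= => /andP[/g_ge0].
  rewrite big_ord_recr/= integral_cat EFinD leeD//.
  rewrite -(integral_unit n (g n.+1%:R)); apply: ge0_le_integral => //.
  - by move=> x _; rewrite lee_fin g_ge0.
  - exact: mEg.
  - by move=> x /=; rewrite ?in_itv/= => /andP[nx xn];
      rewrite lee_fin g_dec// (le_lt_trans _ nx).
apply: ge0_subset_integral => //; first exact: mEg.
  by move=> x /=; rewrite ?in_itv/= andbT => /g_ge0.
by move=> x /=; rewrite ?in_itv/= andbT => /andP[].
Qed.

Let integral_le_sumn n :
  (\int[mu]_(x in `]0%R, n.+1%:R]) (g x)%:E <=
   \int[mu]_(x in `]0%R, 1%R]) (g x)%:E + (\sum_(m < n) g m.+1%:R)%:E)%E.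
Proof.
elim: n => [|n IH]; first by rewrite big_ord0 adde0.
rewrite integral_cat big_ord_recr/= EFinD [leRHS]addeA leeD//.
rewrite -(integral_unit n.+1 (g n.+1%:R)); apply: ge0_le_integral => //.
- by move=> x /=; rewrite ?in_itv/= => /andP[nx _]; rewrite lee_fin g_ge0// (le_lt_trans _ nx).
- exact: mEg.
- by move=> x /=; rewrite ?in_itv/= => /andP[nx _]; rewrite lee_fin g_dec// ltW.
Qed.

(** Each cell of length one beyond 1 is dominated by the value at its left end. The cell at the
    origin is kept as an integral, since [g] may blow up there. *)
Lemma integral_le_sum (S : R) : (forall n, \sum_(m < n) g m.+1%:R <= S) ->
  (\int[mu]_(x in pos) (g x)%:E <= \int[mu]_(x in `]0%R, 1%R]) (g x)%:E + S%:E)%E.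
Proof.
move=> gS.
have c : (\int[mu]_(x in `]0%R, n.+1%:R]) (g x)%:E)%E @[n --> \oo] -->
    (\int[mu]_(x in pos) (g x)%:E)%E.
  rewrite (_ : pos = \bigcup_n `]0, n.+1%:R]%classic :> set R).
    apply: ge0_nondecreasing_set_cvg_integral => //.
    - by move=> m n mn; apply/subsetPset; apply: subset_itvl; rewrite bnd_simp ler_nat.
    - by move=> n; exact: mEg.
    - by move=> n x /=; rewrite ?in_itv/= => /andP[/g_ge0].
  apply/seteqP; split=> [x /=|x [n _] /=]; rewrite ?in_itv/= andbT; last by case/andP.
  by move=> x0; exists (Num.truncn x) => //=; rewrite ?in_itv/= x0 ltW// truncnS_gt.
rewrite -(cvg_lim _ c)//; apply: lime_le; first by apply/cvg_ex; eexists; exact: c.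
apply: nearW => n.
by rewrite (le_trans (integral_le_sumn n))// leeD2l// lee_fin.
Qed.

End sum_integral.

(** * Size of the coefficients and of the logarithmic moment generating function *)

Section acoef.
Context {R : realType}.
Variable L : R.
Hypothesis L01 : 0 < L < 2^-1.

Let L0 : 0 < L. Proof. by case/andP: L01. Qed.
Let L2 : L < 2^-1. Proof. by case/andP: L01. Qed.
Let G0 : 0 < Gamma L. Proof. exact: Gamma_gt0. Qed.

Lemma acoefE m : acoef m L = Gamma (L + m%:R) / (Gamma L * m`!%:R).
Proof. by rewrite /acoef gt_eqF. Qed.

Lemma acoef0m : acoef 0 L = 1.
Proof. by rewrite acoefE addr0 fact0 mulr1 divff// gt_eqF. Qed.

Lemma acoefS m : acoef m.+1 L = acoef m L * ((L + m%:R) / m.+1%:R).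
Proof.
have Lm : 0 < L + m%:R by rewrite ltr_wpDr.
rewrite !acoefE -natr1 addrA GammaS// natr1 factS natrM.
have f0 : m`!%:R != 0 :> R by rewrite pnatr_eq0 -lt0n fact_gt0.
have n0 : m.+1%:R != 0 :> R by rewrite pnatr_eq0.
have GL0 : Gamma L != 0 by rewrite gt_eqF.
move: (m.+1%:R : R) n0 (m`!%:R : R) f0 (Gamma L) GL0 => x x0 y y0 z z0.
by field; rewrite x0 y0 z0.
Qed.

Lemma acoef_gt0 m : 0 < acoef m L.
Proof.
have f0 : 0 < m`!%:R :> R by rewrite ltr0n fact_gt0.
by rewrite acoefE divr_gt0 ?mulr_gt0// ?Gamma_gt0 ?ltr_wpDr.
Qed.

Lemma acoef_le m : (0 < m)%N -> acoef m L <= L.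
Proof.
case: m => // m _; elim: m => [|m IH].
  by rewrite acoefS acoef0m addr0 divr1 mul1r.
rewrite acoefS (le_trans _ IH)// ler_piMr ?(ltW (acoef_gt0 _))//.
by rewrite ler_pdivrMr// mul1r -[leRHS]natr1 addrC lerD2l; move: L2 L0; lra.
Qed.

(** Wendel's inequality from [m] to [m + L]. *)
Lemma acoef_le_powR m : (0 < m)%N -> acoef m L <= m%:R `^ (L - 1) / Gamma L.
Proof.
case: m => // m _; rewrite acoefE invfM mulrA mulrAC ler_pM2r ?invr_gt0//.
have f0 : 0 < m.+1`!%:R :> R by rewrite ltr0n fact_gt0.
have c01 : 0 <= L <= 1 by move: L2 L0; lra.
rewrite ler_pdivrMr// addrC (le_trans (Gamma_le _ c01))//.
rewrite Gamma_nat factS natrM mulrA powRD ?pnatr_eq0 ?implybT// powR_inv1//.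
by rewrite divfK ?pnatr_eq0.
Qed.

(** Wendel's inequality from [L + m] to [m + 1], a shift by [1 - L], then [L + m <= m + 1]. *)
Lemma acoef_ge_powR m : m.+1%:R `^ (L - 1) / Gamma L <= acoef m L.
Proof.
rewrite acoefE invfM mulrA [leRHS]mulrAC ler_pM2r ?invr_gt0//.
have f0 : 0 < m`!%:R :> R by rewrite ltr0n fact_gt0.
have c01 : 0 <= 1 - L <= 1 by move: L2 L0; lra.
have Lm : 0 < L + m%:R by rewrite ltr_wpDr.
have P0 : 0 < m.+1%:R `^ (1 - L) :> R by rewrite powR_gt0.
rewrite ler_pdivlMr// -(opprB 1 L) powRN mulrC ler_pdivrMr// mulrC.
have := Gamma_le Lm c01; rewrite (_ : L + m%:R + (1 - L) = m.+1%:R);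
    last by rewrite -natr1; ring.
rewrite Gamma_nat => /le_trans; apply.
rewrite ler_wpM2r ?(ltW (Gamma_gt0 Lm))//; apply: ge0_ler_powR; rewrite ?nnegrE.
- by move: L2; lra.
- exact: ltW.
- by [].
- by rewrite -natr1 addrC lerD2l; move: L2 L0; lra.
Qed.

Definition log_mgf n (t : R) : R := \sum_(m < n) phi (t * acoef m L).
Definition log_mgf_coef : R := (Gamma L) `^ (- (1 - L)^-1) * (pi / sin (pi * (2 - (1 - L)^-1))).

Lemma log_mgf_nd t : 0 <= t -> nondecreasing_seq (log_mgf ^~ t).
Proof.
move=> t0; apply/nondecreasing_seqP => n; rewrite /log_mgf big_ord_recr/= lerDl.
by rewrite phi_ge0// mulr_ge0// ltW// acoef_gt0.
Qed.

Let g t (u : R) : R := phi (t / Gamma L * u `^ (L - 1)).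

Let mgt t : measurable_fun setT (g t).
Proof. by rewrite /g /phi; mfun. Qed.

Let g_ge0 t : 0 < t -> forall u, 0 < u -> 0 <= g t u.
Proof. by move=> t0 u u0; rewrite phi_ge0// mulr_ge0 ?powR_ge0// divr_ge0// ltW. Qed.

Let g_dec t : 0 < t -> forall u v : R, 0 < u -> u <= v -> g t v <= g t u.
Proof.
move=> t0 u v u0 uv; rewrite phi_le//.
  by rewrite mulr_ge0 ?powR_ge0// divr_ge0// ltW.
rewrite ler_wpM2l ?divr_ge0 ?(ltW t0) ?(ltW G0)//.
have v0 : 0 < v by exact: lt_le_trans u0 uv.
rewrite -(opprB 1 L) !powRN lef_pV2 ?posrE ?powR_gt0//.
apply: ge0_ler_powR; rewrite ?nnegrE ?(ltW u0) ?(ltW v0)//.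
by move: L2; lra.
Qed.

Let integral_g t : 0 < t ->
  (\int[mu]_(x in pos) (g t x)%:E = (log_mgf_coef * t `^ ((1 - L)^-1))%:E)%E.
Proof.
move=> t0; rewrite integral_phi_powR ?divr_gt0//; congr EFin.
rewrite powRM ?invr_ge0 ?(ltW t0) ?(ltW G0)// -(powR_inv1 (ltW G0)) -powRrM mulN1r.
by rewrite /log_mgf_coef; ring.
Qed.

(** The summand of index 0 is [phi t <= t], hence the extra [t]; the others are dominated by the
    integral through the upper power bound. *)
Lemma log_mgf_le n t : 0 < t -> log_mgf n t <= log_mgf_coef * t `^ ((1 - L)^-1) + t.
Proof.
move=> t0; apply: (@le_trans _ _ (log_mgf n.+1 t)).
  by apply: log_mgf_nd; [exact: ltW|].
rewrite /log_mgf big_ord_recl acoef0m mulr1 addrC lerD ?phi_le_id ?(ltW t0)//.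
have := sum_le_integral (mgt t) (g_ge0 t0) (g_dec t0) n.
rewrite integral_g// lee_fin; apply: le_trans; apply: ler_sum => m _.
rewrite /g phi_le//; first by rewrite mulr_ge0 ?ltW ?acoef_gt0.
by rewrite mulrAC -mulrA ler_pM2l// acoef_le_powR.
Qed.

Lemma log_mgf_ge (S t : R) : 0 < t -> (forall n, log_mgf n t <= S) ->
  log_mgf_coef * t `^ ((1 - L)^-1) - expR 1 * t <= S.
Proof.
move=> t0 LS; have := integral_le_sum (mgt t) (g_ge0 t0) (g_dec t0) (S := S).
have hS n : \sum_(m < n) g t m.+1%:R <= S.
  rewrite (le_trans _ (LS n))//; apply: ler_sum => m _.
  rewrite /g phi_le//; first by rewrite mulr_ge0 ?powR_ge0// divr_ge0// ltW.
  by rewrite mulrAC -mulrA ler_pM2l// acoef_ge_powR.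
move=> /(_ hS); rewrite integral_g// => H.
have h1 : (\int[mu]_(x in `]0%R, 1%R]) (g t x)%:E <= (expR 1 * t)%:E)%E.
  apply: (@le_trans _ _ ((expR 1 * (t / Gamma L))%:E * gamma_int L)%E); last first.
    by rewrite -GammaE// -EFinM lee_fin -mulrA divfK ?gt_eqF.
  rewrite /gamma_int -ge0_integralZl//; last 3 first.
  - by mfun.
  - by move=> x _; rewrite lee_fin mulr_ge0 ?powR_ge0 ?expR_ge0.
  - by rewrite lee_fin mulr_ge0 ?expR_ge0// divr_ge0 ?ltW.
  apply: (@le_trans _ _ (\int[mu]_(x in `]0%R, 1%R])
      ((expR 1 * (t / Gamma L))%:E * (x `^ (L - 1) * expR (- x))%:E))%E).
    apply: ge0_le_integral => //.
    - by move=> x /=; rewrite ?in_itv/= => /andP[x0 _]; rewrite lee_fin g_ge0.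
    - by apply/measurable_EFinP/measurable_funTS; exact: mgt.
    - by apply/measurable_EFinP; mfun.
    - move=> x /=; rewrite ?in_itv/= => /andP[x0 x1]; rewrite -EFinM lee_fin.
      apply: (le_trans (phi_le_id _)); first by rewrite mulr_ge0 ?powR_ge0// divr_ge0// ltW.
      rewrite (_ : _ * (x `^ _ * _) = (t / Gamma L * x `^ (L - 1)) * (expR 1 * expR
          (- x))); last by ring.
      apply: ler_peMr; first by rewrite mulr_ge0 ?powR_ge0// divr_ge0 ?ltW.
      by rewrite -expRD -[leLHS]expR0 ler_expR subr_ge0.
  apply: ge0_subset_integral => //.
  - by apply/measurable_EFinP; mfun.
  - by move=> x _; rewrite -EFinM lee_fin !mulr_ge0 ?powR_ge0 ?expR_ge0 ?invr_ge0// ltW.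
  - by move=> x /=; rewrite ?in_itv/= andbT => /andP[].
move: (le_trans H (leeD2r S%:E h1)); rewrite -EFinD lee_fin; lra.
Qed.

(** The estimate [log_mgf_le] at [t = 1], combined with [phi_ge_sqr]; all coefficients lie in
    [0, 1]. *)
Lemma sum_acoef_sqr n : \sum_(m < n) acoef m L ^+ 2 <= 4 * (log_mgf_coef + 1).
Proof.
have := log_mgf_le n ltr01; rewrite powR1 mulr1 => H.
rewrite -ler_pdivrMl// (le_trans _ H)// mulr_sumr; apply: ler_sum => m _.
rewrite mul1r mulrC phi_ge_sqr// (ltW (acoef_gt0 m))/=.
case: m => [[|m] mn] /=; first by rewrite acoef0m.
by rewrite (le_trans (acoef_le _))//; move: L2; lra.
Qed.

End acoef.

(** * The limits defining kappa and the Gumbel distribution *)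

Section mgf_factor.
Context {R : realType}.
Implicit Types b c : R.

Lemma ln1B_ge b : b < 1 -> - (b / (1 - b)) <= ln (1 - b).
Proof.
move=> b1; have b0 : 0 < 1 - b by rewrite subr_gt0.
rewrite lerNl -lnV ?posrE// (le_trans (_ : _ <= (1 - b)^-1 - 1))//.
  have := @le_ln1Dx R ((1 - b)^-1 - 1); rewrite subrKC; apply.
  by rewrite ltrBDr addNr invr_gt0.
by rewrite le_eqVlt; apply/orP; left; apply/eqP; field; rewrite gt_eqF.
Qed.

(** For [b < 1], the moment generating function at [b] of a centred standard exponential
    variable. *)
Definition mgf_factor b : R := expR (- b) / (1 - b).

Lemma mgf_factor_gt0 b : b < 1 -> 0 < mgf_factor b.
Proof. by move=> b1; rewrite divr_gt0 ?expR_gt0// subr_gt0. Qed.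

Lemma mgf_factorE b : b < 1 -> mgf_factor b = expR (- b - ln (1 - b)).
Proof. by move=> b1; rewrite expRD [expR (- ln _)]expRN lnK// posrE subr_gt0. Qed.

Lemma mgf_factor_ge1 b : b < 1 -> 1 <= mgf_factor b.
Proof.
move=> b1; rewrite /mgf_factor ler_pdivlMr ?subr_gt0// mul1r.
by have := expR_ge1Dx (- b).
Qed.

Lemma mgf_factor_le b c : 0 <= b -> b <= c -> c < 1 ->
  mgf_factor b <= expR (b ^+ 2 / (1 - c)).
Proof.
move=> b0 bc c1; have b1 : b < 1 by exact: le_lt_trans c1.
have b10 : 0 < 1 - b by rewrite subr_gt0.
rewrite mgf_factorE// ler_expR.
have := ln1B_ge b1; rewrite lerNl => /(lerD (lexx (- b))) /le_trans; apply.
rewrite (_ : - b + b / (1 - b) = b ^+ 2 / (1 - b)); last by field; rewrite gt_eqF.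
rewrite ler_wpM2l ?sqr_ge0// lef_pV2 ?posrE// ?subr_gt0//.
by rewrite lerD2l lerN2.
Qed.

Lemma prod_mgf_factor_le (a : nat -> R) (c S : R) n : c < 1 ->
  (forall m, 0 <= a m <= c) -> \sum_(m < n) a m ^+ 2 <= S ->
  \prod_(m < n) mgf_factor (a m) <= expR (S / (1 - c)).
Proof.
move=> c1 ac aS; have c10 : 0 < 1 - c by rewrite subr_gt0.
apply: (@le_trans _ _ (expR ((\sum_(m < n) a m ^+ 2) / (1 - c)))); last first.
  by rewrite ler_expR ler_pM2r// invr_gt0.
elim: n {aS} => [|n IH]; first by rewrite !big_ord0 mul0r expR0.
rewrite !big_ord_recr/= mulrDl expRD; have /andP[a0 ac'] := ac n.
apply: ler_pM => //; last exact: mgf_factor_le.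
  by apply: prodr_ge0 => m _; rewrite ltW// mgf_factor_gt0//;
     have /andP[_ /le_lt_trans->] := ac m.
by rewrite ltW// mgf_factor_gt0// (le_lt_trans ac').
Qed.

End mgf_factor.

Section kappa_limit.
Context {R : realType}.
Variable L : R.
Hypothesis L01 : 0 < L < 2^-1.

Definition kappa_prod n : R := \prod_(m < n) mgf_factor (acoef m.+1 L).

Let aL m : 0 <= acoef m.+1 L <= L.
Proof. by rewrite (ltW (acoef_gt0 L01 _)) acoef_le. Qed.

Let L1 : L < 1. Proof. by case/andP: L01 => ? ?; lra. Qed.

(** [kappa] is defined through [limn], so convergence has to be established: the factors are at
    least 1 and the products are bounded by means of the squared coefficients. *)
Lemma cvg_kappa_prod : (expR 1)^-1 * kappa_prod n @[n --> \oo] --> kappa L.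
Proof.
have E : kappa_prod = (fun n => \prod_(1 <= m < n.+1) (expR (- acoef m L) / (1 - acoef m L))).
  by apply/funext => n; rewrite big_add1/= big_mkord.
rewrite /kappa -E; apply: cvgMr.
apply: nondecreasing_is_cvgn.
  apply/nondecreasing_seqP => n; rewrite /kappa_prod big_ord_recr/=.
  have /andP[a0 aL'] := aL n.
  apply: ler_peMr; last by rewrite mgf_factor_ge1// (le_lt_trans aL').
  by apply: prodr_ge0 => m _; rewrite ltW// mgf_factor_gt0//;
     have /andP[_ /le_lt_trans->] := aL m.
exists (expR (4 * (log_mgf_coef L + 1) / (1 - L))) => _ [n _ <-].
apply: (@prod_mgf_factor_le _ (fun m => acoef m.+1 L)) => //.
by rewrite (le_trans _ (sum_acoef_sqr L01 n.+1))// big_ord_recl lerDr sqr_ge0.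
Qed.

(** A bound uniform in [n] for the moment generating function at 2 of the sum without its term of
    index 0; it exists because [2 * L < 1]. The constant 16 is the 4 of [sum_acoef_sqr] times the
    square of 2. *)
Lemma prod_mgf_factor2_le n : \prod_(m < n) mgf_factor (2 * acoef m.+1 L) <=
  expR (16 * (log_mgf_coef L + 1) / (1 - 2 * L)).
Proof.
apply: (@prod_mgf_factor_le _ (fun m => 2 * acoef m.+1 L)).
- by case/andP: L01 => ? ?; lra.
- by move=> m; have /andP[a0 a1] := aL m; rewrite mulr_ge0//= ler_pM2l.
- under eq_bigr do rewrite exprMn.
  rewrite -mulr_sumr (_ : 2 ^+ 2 = 4); last by ring.
  rewrite (_ : 16 * (log_mgf_coef L + 1) = 4 * (4 * (log_mgf_coef L + 1))); last by ring.
  rewrite ler_pM2l// (le_trans _ (sum_acoef_sqr L01 n.+1))//.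
  by rewrite big_ord_recl lerDr sqr_ge0.
Qed.

End kappa_limit.

Section gumbel.
Context {R : realType}.

Definition harmonic_sum n : R := \sum_(m < n) m.+1%:R^-1.

Let gam n : R := harmonic_sum n - ln n%:R.

Lemma cvg_euler_gamma : harmonic_sum n - ln n%:R @[n --> \oo] --> (euler_gamma : R).
Proof.
have -> : euler_gamma = limn gam :> R.
  rewrite /euler_gamma; congr (lim (_ @ \oo)); apply/funext => n.
  by rewrite /gam /harmonic_sum big_add1/= big_mkord.
(* Monotonicity starts at index 1 only: [ln 0] is 0 by default, so [gam 0 = 0] lies below
   [gam 1 = 1]. *)
suff : cvgn (fun n => gam n.+1).
  move=> /cvg_ex[l gl]; have gl' : gam n @[n --> \oo] --> l by rewrite -cvg_shiftS.
  by rewrite (cvg_lim _ gl').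
have lnD1 n : ln n.+2%:R <= ln n.+1%:R + n.+1%:R^-1 :> R.
  rewrite -lerBlDl -ln_div ?posrE// -(natr1 n.+1) mulrDl divff ?pnatr_eq0// mul1r.
  by apply: le_ln1Dx; rewrite (@lt_le_trans _ _ 0)// ltrN10.
have lnB1 n : ln n.+1%:R + n.+2%:R^-1 <= ln n.+2%:R :> R.
  have := @le_ln1Dx R (- n.+2%:R^-1); rewrite ltrN2 invf_lt1// ltr1n => /(_ isT).
  have -> : 1 - n.+2%:R^-1 = n.+1%:R / n.+2%:R :> R.
    by rewrite -[in RHS](addrK 1 n.+1%:R) natr1 mulrBl divff ?pnatr_eq0// mul1r.
  by rewrite ln_div ?posrE// lerBlDr addrC -lerBrDr.
apply: nonincreasing_is_cvgn.
  apply/nonincreasing_seqP => n; rewrite /gam [harmonic_sum n.+2]big_ord_recr/=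
      -/(harmonic_sum n.+1).
  by rewrite -addrA lerD2l lerBlDr addrC lerBrDl lnB1.
exists 0 => _ [n _ <-].
have HS k : ln k.+1%:R <= harmonic_sum k.
  elim: k => [|k IH]; first by rewrite ln1 /harmonic_sum big_ord0.
  by rewrite /harmonic_sum big_ord_recr/= (le_trans (lnD1 k))// lerD2r.
rewrite /gam subr_ge0 (le_trans _ (HS n.+1))// ler_ln ?posrE//.
by rewrite ler_nat.
Qed.

(** With [u n = expR (- (x + harmonic_sum n))], the product [n%:R * u n] tends to
    [expR (- x - euler_gamma)]. Two-sided bounds on [ln (1 - u n)] squeeze the n-th power. *)
Lemma cvg_gumbel_cdf (x : R) :
  (if 0 <= x + harmonic_sum n then (1 - expR (-
      (x + harmonic_sum n))) ^+ n else 0) @[n --> \oo] -->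
  gumbel_cdf x.
Proof.
pose u n := expR (- (x + harmonic_sum n)).
have c1 : n%:R * u n @[n --> \oo] --> expR (- x - euler_gamma).
  have : expR (- x - (harmonic_sum n - ln n%:R)) @[n --> \oo] --> expR (- x - euler_gamma).
    apply: continuous_cvg; first exact: continuous_expR.
    apply: cvgB; [exact: cvg_cst|exact: cvg_euler_gamma].
  apply: cvg_trans; apply: near_eq_cvg; near=> n.
  have n0 : 0 < n%:R :> R by rewrite ltr0n; near: n; exact: nbhs_infty_gt.
  by rewrite opprB addrCA expRD lnK ?posrE// /u opprD.
have u0 : u n @[n --> \oo] --> (0 : R).
  rewrite -[X in _ --> X](mul0r (expR (- x - euler_gamma))).
  have h0 : (n%:R : R)^-1 @[n --> \oo] --> (0 : R).
    by rewrite -cvg_shiftS; exact: cvg_harmonic.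
  have h : (n%:R : R)^-1 * (n%:R * u n) @[n --> \oo] --> 0 * expR (- x - euler_gamma).
    exact: cvgM h0 c1.
  apply: cvg_trans h; apply: near_eq_cvg; near=> n.
  have n0 : n%:R != 0 :> R by rewrite pnatr_eq0 -lt0n; near: n; exact: nbhs_infty_gt.
  by rewrite /= mulKf.
have u1 : \forall n \near \oo, u n < 1 by exact: (cvgr_lt 0).
apply: (@squeeze_cvgr _ _ _ _ (fun n => expR (- (n%:R * u n / (1 - u n))))
    (fun n => expR (- (n%:R * u n)))).
- near=> n; have un1 : u n < 1 by near: n.
  have un0 : 0 < u n by exact: expR_gt0.
  have un10 : 0 < 1 - u n by rewrite subr_gt0.
  rewrite ifT; last by move: un1; rewrite -[ltRHS]expR0 ltr_expR oppr_lt0 => /ltW.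
  rewrite -/(u n) -[1 - u n in X in _ <= X <= _]lnK ?posrE// -expRM_natl !ler_expR.
  have l1 := ln1B_ge un1; have l2 : ln (1 - u n) <= - u n.
    by apply: le_ln1Dx; rewrite ltrN2.
  apply/andP; split; last by rewrite -mulrN ler_wpM2l.
  by rewrite -mulrA -mulrN ler_wpM2l.
- apply: continuous_cvg; first exact: continuous_expR.
  apply: cvgN; rewrite -[X in _ --> X]divr1; apply: cvgM => //.
  apply: cvgV; first exact: oner_neq0.
  by rewrite -[X in _ --> X]subr0; apply: cvgB => //; exact: cvg_cst.
- apply: continuous_cvg; first exact: continuous_expR.
  exact: cvgN.
Unshelve. all: end_near. Qed.

Lemma acoefS0 m : acoef m.+1 0 = m.+1%:R^-1 :> R.
Proof. by rewrite /acoef eqxx. Qed.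

Lemma acoef00 : acoef 0 0 = 0 :> R.
Proof. by rewrite /acoef eqxx. Qed.

Lemma sum_acoef0_sqr n : \sum_(m < n) (acoef m 0 : R) ^+ 2 <= 2.
Proof.
apply: (@le_trans _ _ (\sum_(m < n.+2) (acoef m 0 : R) ^+ 2)).
  by rewrite 2!big_ord_recr/= -addrA lerDl addr_ge0 ?sqr_ge0.
(* The sharper bound telescopes, since 1/(n+2)^2 is at most 1/(n+1) - 1/(n+2). *)
apply: (@le_trans _ _ (2 - n.+1%:R^-1)); last by rewrite gerBl.
elim: n => [|n IH].
  by rewrite 2!big_ord_recr big_ord0/= acoef00 acoefS0 invr1; lra.
rewrite big_ord_recr/= acoefS0 (le_trans (lerD IH (lexx _)))//.
rewrite -addrA lerD2l lerNr opprD opprK addrC.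
have a0 : 0 < n.+1%:R :> R by [].
have b0 : 0 < n.+2%:R :> R by [].
rewrite -(natr1 n.+1); move: (n.+1%:R : R) a0 => a a0.
rewrite -subr_ge0 (_ : _ - _ = (a * (a + 1) ^+ 2)^-1).
  by rewrite invr_ge0 mulr_ge0 ?sqr_ge0// ltW.
have a10 : a + 1 != 0 by rewrite gt_eqF// addr_gt0.
by field; rewrite a10 gt_eqF.
Qed.

End gumbel.

(** * The law of the squared modulus of a Gaussian *)

Section density.
Local Open Scope ereal_scope.
Context d (T : measurableType d) (R : realType).
Variables (m nu : {measure set T -> \bar R}) (h : T -> R).
Hypothesis mh : measurable_fun setT h.
Hypothesis h_ge0 : forall x, (0 <= h x)%R.
Hypothesis nuE : forall A, measurable A -> nu A = \int[m]_(x in A) (h x)%:E.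

Import HBNNSimple.

Let integral_density_nnsfun (f : {nnsfun T >-> R}) :
  \int[nu]_x (f x)%:E = \int[m]_x ((f x)%:E * (h x)%:E).
Proof.
have mf r : measurable (f @^-1` [set r]) by exact: measurable_funPTI.
transitivity (\sum_(k \in range f) \int[nu]_x (k * \1_(f @^-1` [set k]) x)%:E).
  under eq_integral do rewrite fimfunE -fsumEFin//.
  rewrite ge0_integral_fsum//.
  - by move=> r; exact/measurable_EFinP/measurable_funM.
  - by move=> r x _; rewrite nnfun_muleindic_ge0.
transitivity (\sum_(k \in range f) \int[m]_x ((k * \1_(f @^-1` [set k]) x)%:E * (h x)%:E)).
  apply: eq_fsbigr => r /[!inE] -[t _ rE].
  have r0 : (0 <= r)%R by rewrite -rE.
  rewrite integralZl_indic_nnsfun// integral_indic// setIT nuE//.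
  under [RHS]eq_integral do rewrite EFinM -muleA.
  rewrite ge0_integralZl//; last 2 first.
  - apply: emeasurable_funM; last exact/measurable_EFinP.
    exact/measurable_EFinP/measurable_indic.
  - by move=> x _; rewrite mule_ge0// lee_fin.
  congr (_ * _); rewrite integral_mkcond; apply: eq_integral => x _.
  by rewrite patchE indicE; case: ifPn => _; rewrite ?mul1e ?mul0e.
rewrite -ge0_integral_fsum//; last 2 first.
- move=> r; apply: emeasurable_funM; last exact/measurable_EFinP.
  exact/measurable_EFinP/measurable_funM.
- by move=> r x _; rewrite mule_ge0 ?nnfun_muleindic_ge0// lee_fin.
apply: eq_integral => x _; rewrite -ge0_mule_fsuml; last first.
  by move=> r; rewrite nnfun_muleindic_ge0.
by rewrite fsumEFin// -fimfunE.
Qed.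

Lemma ge0_integral_density (f : T -> \bar R) : measurable_fun setT f ->
  (forall x, 0 <= f x) -> \int[nu]_x f x = \int[m]_x (f x * (h x)%:E).
Proof.
move=> mf f0; pose g := nnsfun_approx measurableT mf.
have gf x : (g n x)%:E @[n --> \oo] --> f x by exact: cvg_nnsfun_approx.
have ndg x : {homo (fun n => (g n x)%:E) : a b / (a <= b)%N >-> a <= b}.
  by move=> a b ab; rewrite lee_fin; exact/lefP/nd_nnsfun_approx.
have mg n : measurable_fun setT (EFin \o g n) by exact/measurable_EFinP.
transitivity (limn (fun n => \int[nu]_x (g n x)%:E)).
  rewrite -monotone_convergence//.
  - by apply: eq_integral => x _; apply/esym/cvg_lim.
  - by move=> n x _; rewrite lee_fin.
transitivity (limn (fun n => \int[m]_x ((g n x)%:E * (h x)%:E))).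
  by congr (limn _); apply/funext => n; exact: integral_density_nnsfun.
rewrite -monotone_convergence//.
- apply: eq_integral => x _; apply/cvg_lim => //.
  by apply: cvgeZr => //; exact: gf.
- by move=> n; apply: emeasurable_funM => //; exact/measurable_EFinP.
- by move=> n x _; rewrite mule_ge0// lee_fin.
- by move=> x _ a b ab; rewrite lee_wpmul2r ?lee_fin//; exact: ndg.
Qed.

End density.

Section squared_modulus.
Context {R : realType}.

Definition sqmod (z : R[i]) : R := Normc.normc z ^+ 2.

Lemma sqmodE (x y : R) : sqmod (x +i* y)%C = x ^+ 2 + y ^+ 2.
Proof. by rewrite /sqmod/= sqr_sqrtr// addr_ge0// sqr_ge0. Qed.

Lemma measurable_sqmod : measurable_fun [set: R[i]] sqmod.
Proof. exact: measurable_normc_sqr. Qed.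

Let slice (r : R) (x : R) : set R := [set y | x ^+ 2 + y ^+ 2 < r].

Let mslice r x : measurable (slice r x).
Proof.
rewrite -[slice r x]setTI.
apply: (@measurable_fun_ltr _ _ _ _ (fun y : R => x ^+ 2 + y ^+ 2)
    (cst r) _ _ measurableT [set true]) => //.
by mfun.
Qed.

Let disc r : set (R * R) := [set p | p.1 ^+ 2 + p.2 ^+ 2 < r].

Let mdisc r : measurable (disc r).
Proof.
rewrite -[disc r]setTI.
apply: (@measurable_fun_ltr _ _ _ _ (fun p : R * R => p.1 ^+ 2 + p.2 ^+ 2)
    (cst r) _ _ measurableT [set true]) => //.
by mfun.
Qed.

Let discE r : complex_lebesgue (sqmod @^-1` `]-oo, r[) =
  (\int[mu]_x mu (slice r x))%E.
Proof.
rewrite /complex_lebesgue /pushforward.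
rewrite (_ : pair_complex @^-1` _ = disc r); last first.
  by apply/seteqP; split=> -[x y]; rewrite /disc/= in_itv/= /pair_complex/= sqmodE.
rewrite /product_measure1; apply: eq_integral => x _ /=; congr mu.
by apply/seteqP; split=> y; rewrite /xsection/= inE.
Qed.

Let mfslice r : measurable_fun setT (fun x => mu (slice r x)).
Proof.
rewrite (_ : (fun x => _) = mu \o xsection (disc r)).
  by apply: measurable_fun_xsection; exact: mdisc.
apply/funext => x /=; congr mu.
by apply/seteqP; split=> y; rewrite /xsection/= inE.
Qed.

(** Scaling by the square root of [r] in each of the two coordinates multiplies the area by [r]. *)
Lemma complex_lebesgue_disc r : 0 < r ->
  complex_lebesgue (sqmod @^-1` `]-oo, r[) =
  (r%:E * complex_lebesgue (sqmod @^-1` `]-oo, 1%R[))%E.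
Proof.
move=> r0; rewrite !discE.
pose k := Num.sqrt r; have k0 : 0 < k by rewrite sqrtr_gt0.
have k2 : k ^+ 2 = r by rewrite sqr_sqrtr// ltW.
rewrite (ge0_integral_scale k0 measurableT (mfslice r))//= preimage_setT.
transitivity (k%:E * \int[mu]_x (k%:E * mu (slice 1 x)))%E.
  congr (_ * _)%E; apply: eq_integral => x _.
  rewrite (lebesgue_measure_scale k0 (mslice _ _)); congr (_ * _)%E; congr mu.
  apply/seteqP; split=> y; rewrite /slice/= !exprMn -mulrDr k2;
    by rewrite gtr_pMr.
rewrite ge0_integralZl//; [|exact: mfslice|by rewrite lee_fin ltW].
by rewrite muleA -EFinM -expr2 k2.
Qed.

Lemma complex_lebesgue_disc1_fin :
  complex_lebesgue (sqmod @^-1` `]-oo, 1%R[ : set R[i]) \is a fin_num.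
Proof.
rewrite ge0_fin_numE// discE.
apply: (@le_lt_trans _ _ (\int[mu]_x ((2 * \1_(`[(-1)%R, 1%R]%classic : set R) x)%:E))%E).
  apply: ge0_le_integral => //; first exact: mfslice.
    by apply/measurable_EFinP; apply: measurable_funM => //; exact: measurable_indic.
  move=> x _; rewrite indicE; case: (boolP (x \in _)) => [_|xI].
    rewrite mulr1; apply: (@le_trans _ _ (mu (`[(-1)%R, 1%R]%classic : set R))).
      apply: le_measure; rewrite ?inE//=; first exact: mslice.
      move=> y; rewrite /slice/= in_itv/= => xy.
      rewrite -ler_norml -(@ler_pXn2r _ 2)// ?nnegrE// expr1n real_normK ?num_real//.
      by rewrite (le_trans _ (ltW xy))// lerDr sqr_ge0.
    apply: (le_trans (_ : _ <= (1 - -1)%:E)%E); last by rewrite opprK.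
    by rewrite (lebesgue_measure_itv `[(-1)%R, 1%R])/= lte_fin (lt_trans (ltrN10 _)).
  rewrite (_ : slice 1 x = set0) ?measure0 ?mulr0//.
  apply/seteqP; split=> y //; rewrite /slice/= => xy; move: xI.
  rewrite notin_setE/= in_itv/= -ler_norml; apply.
  rewrite -(@ler_pXn2r _ 2)// ?nnegrE// expr1n real_normK ?num_real//.
  by rewrite (le_trans _ (ltW xy))// lerDl sqr_ge0.
under eq_integral do rewrite EFinM.
rewrite ge0_integralZl//.
- rewrite integral_indic// setIT.
  apply: (@le_lt_trans _ _ (2%:E * mu (`[(-1)%R, 1%R]%classic : set R))%E) => //.
  by rewrite (lebesgue_measure_itv `[(-1)%R, 1%R])/=; case: ifP => _;
      rewrite -?EFinD -EFinM ltry.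
- by apply/measurable_EFinP; exact: measurable_indic.
Qed.

(** The area of the unit disc, kept symbolic; the total mass of the Gaussian density later forces
    [pi^-1 * c = 1]. *)
Let c : R := fine (complex_lebesgue (sqmod @^-1` `]-oo, 1%R[ : set R[i])).

Let c_ge0 : 0 <= c. Proof. exact: fine_ge0. Qed.

Let complex_lebesgue_ray r :
  complex_lebesgue (sqmod @^-1` `]-oo, r[) = (c * Num.max 0 r)%:E.
Proof.
have [r0|r0] := ltP 0 r.
  by rewrite complex_lebesgue_disc// mulrC EFinM fineK// complex_lebesgue_disc1_fin.
rewrite mulr0 (_ : _ @^-1` _ = set0) ?measure0//.
apply/seteqP; split=> // z /=; rewrite in_itv/= => zr.
by have := lt_le_trans zr r0; rewrite ltNge sqr_ge0.
Qed.

Let lebesgue_ray r : mu (`]-oo, r[ `&` pos : set R) = (Num.max 0 r)%:E.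
Proof.
have -> : `]-oo, r[ `&` pos = `]0, r[%classic :> set R.
  apply/seteqP; split=> x /=; rewrite !in_itv/= ?andbT; first by move=> [-> ->].
  by move=> /andP[-> ->].
rewrite (lebesgue_measure_itv `]0%R, r[)/= lte_fin.
by case: ltP => r0; rewrite ?oppr0 ?adde0// sube0.
Qed.

(** Both sides are measures in [B] that agree, with finite values, on the rays []-oo, r[], whose
    preimages are discs; these rays are stable under intersection and generate the Borel sets. *)
Let complex_lebesgue_sqmod (B : set R) : measurable B ->
  complex_lebesgue (sqmod @^-1` B) = (c%:E * mu (B `&` pos))%E.
Proof.
move=> mB.
pose m1 : {measure set (measurableTypeR R) ->
    \bar R} := pushforward complex_lebesgue (sqmod : R[i] -> measurableTypeR R).
pose m2 : {measure set (measurableTypeR R) -> \bar R} := mscale (NngNum c_ge0)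
    (mrestr mu (measurable_itv `]0%R, +oo[)).
pose raysO n : set R := `]-oo, n%:R[%classic.
rewrite -[LHS]/(m1 measurable_sqmod B) -[RHS]/(m2 B).
apply: (@measure_unique _ R (measurableTypeR R)
    (@RGenInftyO.G R) raysO _ _ _ _ (m1 measurable_sqmod) m2) => //.
- exact: RGenInftyO.measurableE.
- move=> _ _ [x ->] [y ->]; exists (Num.min x y).
  by apply/seteqP; split=> z /=; rewrite !in_itv/= lt_min => /andP.
- by move=> n; exists n%:R.
- apply/seteqP; split=> // x _; exists (Num.truncn x).+1 => //.
  by rewrite /raysO/= in_itv/= truncnS_gt.
- move=> _ [r ->]; rewrite /m1 /m2 /pushforward /mscale /mrestr.
  rewrite -[LHS]/(complex_lebesgue (sqmod @^-1` `]-oo, r[)) complex_lebesgue_ray.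
  by rewrite -[RHS]/(c%:E * mu (`]-oo, r[ `&` pos : set R))%E lebesgue_ray EFinM.
- move=> n; rewrite -[X in (X < _)%E]/(complex_lebesgue (sqmod @^-1` `]-oo, n%:R[)).
  by rewrite complex_lebesgue_ray ltry.
Qed.

Section law.
Context d (T : measurableType d) (P : probability T R) (Z : {RV P >-> R[i]}).
Hypothesis gaussZ : standard_complex_gaussian Z.

Let indpos : R -> R := \1_(pos : set R).

Let mindpos : measurable_fun setT indpos.
Proof. exact: measurable_indic. Qed.

Let mZ : measurable_fun setT (fun w => sqmod (Z w)).
Proof. by apply: (measurableT_comp measurable_sqmod); exact: measurable_funP. Qed.

Let lawE (B : set R) : measurable B ->
  P ((fun w => sqmod (Z w)) @^-1` B) =
  (\int[mu]_(u in B) (pi^-1 * expR (- u) * (c * indpos u))%:E)%E.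
Proof.
move=> mB.
have mNB : measurable (sqmod @^-1` B).
  by rewrite -[_ @^-1` _]setTI; exact: measurable_sqmod.
transitivity (distribution P Z (sqmod @^-1` B)); first by [].
rewrite gaussZ//.
pose m1 : {measure set (measurableTypeR R) -> \bar R} :=
  pushforward complex_lebesgue (sqmod : R[i] -> measurableTypeR R).
pose g (u : R) := (pi^-1 * expR (- u))%:E.
have mg : measurable_fun setT g by rewrite /g; mfun.
have g0 u : (0 <= g u)%E by rewrite lee_fin mulr_ge0 ?expR_ge0// invr_ge0 pi_ge0.
transitivity (\int[m1 measurable_sqmod]_(u in B) g u)%E.
  rewrite [RHS](@ge0_integral_pushforward _ _ _
      (measurableTypeR R) R sqmod measurable_sqmod complex_lebesgue)//.
  exact: measurable_funTS.
rewrite [LHS]integral_mkcond.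
rewrite (@ge0_integral_density _ _ _ mu (m1 measurable_sqmod) (fun u => c * indpos u)).
- rewrite [RHS]integral_mkcond; apply: eq_integral => u _; rewrite !patchE.
  by case: ifPn => _; rewrite ?mul0e// EFinM.
- by apply: measurable_funM.
- by move=> u; rewrite mulr_ge0// indicE.
- move=> A mA; rewrite -[LHS]/(complex_lebesgue (sqmod @^-1` A)) complex_lebesgue_sqmod//.
  under eq_integral do rewrite EFinM.
  rewrite ge0_integralZl//; first by rewrite integral_indic// setIC.
    by apply/measurable_EFinP/measurable_funTS; exact: mindpos.
  by move=> u _; rewrite lee_fin /indpos indicE.
- exact/(measurable_restrictT _ _).1/measurable_funTS.
- by move=> u; rewrite patchE; case: ifP.
Qed.

Let integral_law (f : R -> \bar R) : measurable_fun setT f ->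
  (forall x, 0 <= f x)%E ->
  (\int[P]_w f (sqmod (Z w)) =
   \int[mu]_(u in pos) (f u * (pi^-1 * c * expR (- u))%:E))%E.
Proof.
move=> mf f0.
pose m1 : {measure set (measurableTypeR R) -> \bar R} :=
  pushforward P ((fun w => sqmod (Z w)) : T -> measurableTypeR R).
transitivity (\int[m1 mZ]_u f u)%E.
  by rewrite /m1 ge0_integral_pushforward.
rewrite (@ge0_integral_density _ _ _ mu (m1 mZ)
    (fun u => pi^-1 * expR (- u) * (c * indpos u)))//.
- rewrite [RHS]integral_mkcond; apply: eq_integral => u _; rewrite patchE /indpos indicE.
  case: ifPn => _; last by rewrite !mulr0 mule0.
  by rewrite mulr1 [(_ * c)%R]mulrAC.
- apply: measurable_funM; last exact: measurable_funM.
  by mfun.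
- by move=> u; rewrite !mulr_ge0 ?expR_ge0 ?invr_ge0 ?pi_ge0// /indpos indicE.
Qed.

Lemma integral_sqmod_gaussian (f : R -> \bar R) : measurable_fun setT f ->
  (forall x, 0 <= f x)%E ->
  (\int[P]_w f (sqmod (Z w)) = \int[mu]_(u in pos) (f u * (expR (- u))%:E))%E.
Proof.
move=> mf f0; rewrite integral_law//.
suff -> : pi^-1 * c = 1 by under eq_integral do rewrite mul1r.
(* Testing [integral_law] on the constant 1 gives probability one on the left and [pi^-1 * c] on the
   right. *)
have m1 : measurable_fun [set: R] (cst 1%E : R -> \bar R) by exact: measurable_cst.
have := integral_law m1 (fun=> lee01).
have -> : (\int[P]_w (cst 1 (sqmod (Z w)) : \bar R) = 1)%E.
  by rewrite -[RHS](@probability_setT _ _ _ P) -[RHS]mul1e -integral_cst.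
under eq_integral do rewrite /cst mul1e EFinM.
rewrite ge0_integralZl//.
- by rewrite integral_expRN mule1 => -[].
- by mfun.
- by rewrite lee_fin mulr_ge0// invr_ge0 pi_ge0.
Qed.

End law.

End squared_modulus.

(** * Functions of independent variables *)

Section integral_indep.
Local Open Scope ereal_scope.
Context d (T : measurableType d) (R : realType) (P : probability T R).
Variables (U V : {RV P >-> R}).
Hypothesis indUV : forall A B, measurable A -> measurable B ->
  P (U @^-1` A `&` V @^-1` B) = P (U @^-1` A) * P (V @^-1` B).

Let UV w := (U w, V w).

Let mUV : measurable_fun setT UV.
Proof. by apply: measurable_fun_pair. Qed.

Let integral_UV (g : R * R -> \bar R) : measurable_fun setT g ->
  (forall z, 0 <= g z) ->
  \int[P]_w g (U w, V w) = \int[distribution P U \x distribution P V]_z g z.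
Proof.
move=> mg g0; transitivity (\int[pushforward P UV]_z g z).
  by rewrite ge0_integral_pushforward.
pose m : {measure set (R * R) -> \bar R} := pushforward P UV.
apply: (@eq_measure_integral _ _ _ _ (distribution P U \x distribution P V) (m mUV)).
move=> A mA _; apply/esym; apply: (@product_measure_unique _ _ _ _ _ (distribution P U)
    (distribution P V) (m mUV)) => //.
Qed.

(** The joint law agrees with the product of the marginals on rectangles, hence everywhere, and
    Tonelli's theorem applies. The two orders serve different ends: exponential moments integrate
    out the new variable inside, Renyi's recursion keeps it outside. *)
Lemma integral_indep1 (g : R * R -> \bar R) : measurable_fun setT g ->
  (forall z, 0 <= g z) ->
  \int[P]_w g (U w, V w) = \int[P]_w \int[P]_w' g (U w, V w').
Proof.
move=> mg g0; rewrite integral_UV// fubini_tonelli1//.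
rewrite ge0_integral_distribution//; last 2 first.
- exact: measurable_fun_fubini_tonelli_F.
- by move=> x; exact: integral_ge0.
apply: eq_integral => w _ /=; rewrite /fubini_F ge0_integral_distribution//.
by apply: (measurableT_comp mg); exact: pair1_measurable.
Qed.

Lemma integral_indep2 (g : R * R -> \bar R) : measurable_fun setT g ->
  (forall z, 0 <= g z) ->
  \int[P]_w g (U w, V w) = \int[P]_w' \int[P]_w g (U w, V w').
Proof.
move=> mg g0; rewrite integral_UV// fubini_tonelli2//.
rewrite ge0_integral_distribution//; last 2 first.
- exact: measurable_fun_fubini_tonelli_G.
- by move=> x; exact: integral_ge0.
apply: eq_integral => w _ /=; rewrite /fubini_G ge0_integral_distribution//.
by apply: (measurableT_comp mg); exact: pair2_measurable.
Qed.

End integral_indep.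

Section indep_chain.
Local Open Scope ereal_scope.
Context d (T : measurableType d) (R : realType) (P : probability T R).
Variable E : nat -> {RV P >-> R}.

Definition cyl (s : seq nat) (B : nat -> set R) : set T :=
  \bigcap_(m in [set` s]) (E m @^-1` B m).

Hypothesis indE : forall (s : seq nat) (B : nat -> set R), uniq s ->
  (forall m, measurable (B m)) ->
  P (cyl s B) = \prod_(m <- s) P (E m @^-1` B m).

Let mpre (U : {RV P >-> R}) (A : set R) : measurable A -> measurable (U @^-1` A).
Proof. by move=> mA; rewrite -[X in measurable X]setTI; exact: measurable_funP. Qed.

Lemma measurable_cyl s B : (forall m, measurable (B m)) -> measurable (cyl s B).
Proof.
by move=> mB; apply: fin_bigcap_measurable => [|m _]; [exact: finite_seq|exact: mpre].
Qed.

(** An invariant for recursive constructions, with [D] the indices already consumed by [U].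
    Independence from whole cylinders, and not just from one further variable, is what survives the
    next step. *)
Definition indep_off (D : pred nat) (U : {RV P >-> R}) :=
  forall A s B, measurable A -> uniq s -> (forall m, m \in s -> ~~ D m) ->
  (forall m, measurable (B m)) ->
  P (U @^-1` A `&` cyl s B) = P (U @^-1` A) * P (cyl s B).

Lemma indep_off_cst D (u : R) : indep_off D (cst u : {RV P >-> R}).
Proof.
move=> A s B mA us sD mB; rewrite preimage_cst; case: ifPn => _.
  by rewrite setTI probability_setT mul1e.
by rewrite set0I measure0 mul0e.
Qed.

Let cyl_cons k s B C : k \notin s ->
  cyl (k :: s) (fun m => if m == k then C else B m) = E k @^-1` C `&` cyl s B.
Proof.
move=> ks; apply/seteqP; split=> w.
  move=> h; split; first by have := h k; rewrite /= eqxx; apply; rewrite mem_head.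
  move=> m /= ms; have := h m; rewrite /= inE ms orbT => /(_ isT).
  by case: eqP => // mk; move: ks; rewrite -mk ms.
move=> [wC wB] m /=; rewrite inE => /predU1P[->|ms]; first by rewrite eqxx.
by case: eqP => [->//|_]; exact: wB.
Qed.

Let cyl_indep k s B C : k \notin s -> uniq s -> measurable C ->
  (forall m, measurable (B m)) ->
  P (E k @^-1` C `&` cyl s B) = P (E k @^-1` C) * P (cyl s B).
Proof.
move=> ks us mC mB; rewrite -cyl_cons// indE/= ?ks//; last by move=> m; case: ifP.
rewrite big_cons eqxx indE//; congr (_ * _); apply: eq_big_seq => m ms.
by case: eqP => // mk; move: ks; rewrite -mk ms.
Qed.

Lemma indep_off_pair D U k : indep_off D U -> ~~ D k ->
  forall A B, measurable A -> measurable B ->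
  P (U @^-1` A `&` E k @^-1` B) = P (U @^-1` A) * P (E k @^-1` B).
Proof.
move=> iU kD A B mA mB.
have cE : cyl [:: k] (fun=> B) = E k @^-1` B.
  apply/seteqP; split=> w; first by move=> /(_ k); apply; rewrite /= mem_head.
  by move=> wB m /=; rewrite inE => /eqP ->.
by rewrite -cE iU// => m; rewrite inE => /eqP ->.
Qed.

(** Dynkin's argument on the sets [C] of the plane for which the event that (U, E k) lies in [C] is
    independent of the cylinder [X]. For rectangles, the condition on [E k] is moved into the
    cylinder; the claim is the case of [C] a preimage under [h]. *)
Lemma indep_off_step D U k (h : R * R -> R) (U' : {RV P >-> R}) :
  indep_off D U -> ~~ D k -> measurable_fun setT h ->
  (forall w, U' w = h (U w, E k w)) ->
  indep_off (fun m => D m || (m == k)) U'.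
Proof.
move=> iU kD mh U'E A s B mA us sD mB; set X := cyl s B.
have mX : measurable X by exact: measurable_cyl.
have ks : k \notin s by apply/negP => /sD; rewrite eqxx orbT.
have sD' m : m \in s -> ~~ D m by move=> /sD; rewrite negb_or => /andP[].
pose UE w := (U w, E k w).
have mUE : measurable_fun setT UE by apply: measurable_fun_pair.
have mpreUE C : measurable C -> measurable (UE @^-1` C).
  by move=> mC; rewrite -[X in measurable X]setTI; exact: mUE.
pose Q (C : set (R * R)) := P (UE @^-1` C `&` X) = P (UE @^-1` C) * P X.
suff QC C : measurable C -> Q C.
  have -> : U' @^-1` A = UE @^-1` (h @^-1` A).
    by apply/seteqP; split=> w; rewrite /= U'E.
  by apply: QC; rewrite -[X in measurable X]setTI; exact: mh.
move=> mC; apply: (dynkin_induction (measurable_prod_measurableType _ _)) => //.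
- move=> _ _ [A1 mA1 [B1 mB1 <-]] [A2 mA2 [B2 mB2 <-]].
  exists (A1 `&` A2); first exact: measurableI.
  by exists (B1 `&` B2); [exact: measurableI|rewrite setXI].
- by rewrite /Q preimage_setT setTI probability_setT mul1e.
- move=> _ [A1 mA1 [B1 mB1 <-]]; rewrite /Q.
  have -> : UE @^-1` (A1 `*` B1) = U @^-1` A1 `&` E k @^-1` B1 by [].
  rewrite (indep_off_pair iU kD)// -muleA -cyl_indep// -setIA.
  rewrite -cyl_cons// iU//=.
  + by rewrite ks.
  + by move=> m; rewrite inE => /predU1P[->//|]; exact: sD'.
  + by move=> m; case: ifP.
- move=> S mS QS; have mUS := mpreUE S mS.
  rewrite /Q preimage_setC setIC -setDE measureD//; last first.
    by rewrite -ge0_fin_numE// fin_num_measure.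
  rewrite setIC; transitivity (P X - P (UE @^-1` S) * P X); first by congr (_ - _).
  rewrite probability_setC// muleBl ?fin_num_measure// ?mul1e//.
- move=> F mF tF QF; rewrite /Q preimage_bigcup setI_bigcupl.
  rewrite measure_bigcup//; last 2 first.
  + by move=> n _; apply: measurableI => //; exact: mpreUE.
  + apply/trivIsetP => i j _ _ ij; rewrite setIACA -preimage_setI.
    by move/trivIsetP : tF => /(_ i j) ->//; rewrite preimage_set0 set0I.
  rewrite measure_bigcup//; last 2 first.
  + by move=> n _; exact: mpreUE.
  + apply/trivIsetP => i j _ _ ij; rewrite -preimage_setI.
    by move/trivIsetP : tF => /(_ i j) ->//; rewrite preimage_set0.
  have PX : P X = (fine (P X))%:E by rewrite fineK// fin_num_measure.
  rewrite muleC PX -nneseriesZl//.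
  by apply: eq_eseriesr => n _; rewrite -PX muleC; exact: QF.
by move: mC; rewrite measurable_prod_measurableType.
Qed.

End indep_chain.

Lemma measurable_ge_set d (T : measurableType d) (R : realType) (f : T -> R) e :
  measurable_fun setT f -> measurable [set w | e <= f w].
Proof.
move=> mf; have -> : [set w | e <= f w] = [set: T] `&` f @^-1` `[e, +oo[.
  by apply/seteqP; split => w /=; rewrite in_itv/= andbT => // -[].
exact: mf.
Qed.

Lemma measurable_gt_set d (T : measurableType d) (R : realType) (f : T -> R) e :
  measurable_fun setT f -> measurable [set w | e < f w].
Proof.
move=> mf; have -> : [set w | e < f w] = [set: T] `&` f @^-1` `]e, +oo[.
  by apply/seteqP; split => w /=; rewrite in_itv/= andbT => // -[].
exact: mf.
Qed.

Lemma measurable_lt_set d (T : measurableType d) (R : realType) (f : T -> R) e :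
  measurable_fun setT f -> measurable [set w | f w < e].
Proof.
move=> mf; have -> : [set w | f w < e] = [set: T] `&` f @^-1` `]-oo, e[.
  by apply/seteqP; split => w /=; rewrite in_itv/= => // -[].
exact: mf.
Qed.

Lemma measurable_le_set d (T : measurableType d) (R : realType) (f : T -> R) e :
  measurable_fun setT f -> measurable [set w | f w <= e].
Proof.
move=> mf; have -> : [set w | f w <= e] = [set: T] `&` f @^-1` `]-oo, e].
  by apply/seteqP; split => w /=; rewrite in_itv/= => // -[].
exact: mf.
Qed.

Section chain.
Context d (T : measurableType d) (R : realType) (P : probability T R).
Variable E : nat -> {RV P >-> R}.

Hypothesis indE : forall (s : seq nat) (B : nat -> set R), uniq s ->
  (forall m, measurable (B m)) ->
  P (cyl E s B) = (\prod_(m <- s) P (E m @^-1` B m))%E.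

Hypothesis lawE : forall m (f : R -> \bar R), measurable_fun setT f ->
  (forall u, 0 <= f u)%E ->
  (\int[P]_w f (E m w) = \int[mu]_(u in pos) (f u * (expR (- u))%:E))%E.

Definition rv_of (f : T -> R) (mf : measurable_fun setT f) : {RV P >-> R} :=
  HB.pack f (isMeasurableFun.Build _ _ _ _ f mf).

Section process.
Variable h : nat -> R * R -> R.
Hypothesis mh : forall m, measurable_fun setT (h m).
Variables (u0 : R) (N : nat).

(** A common form for the walk, the stopped walk and Renyi's sum, starting at index [N]. Each step
    uses one fresh variable, so independence is proved once for all three. *)
Fixpoint chain k w :=
  if k is k'.+1 then h (N + k') (chain k' w, E (N + k') w) else u0.

Lemma measurable_chain k : measurable_fun setT (chain k).
Proof.
elim: k => [|k IH]; first exact: measurable_cst.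
by apply: (measurableT_comp (mh _)); apply: measurable_fun_pair.
Qed.

Lemma indep_chain k :
  indep_off E (fun m => N <= m < N + k)%N (rv_of (measurable_chain k)).
Proof.
elim: k => [|k IH].
  by move=> A s B; exact: (@indep_off_cst _ _ _ P E _ u0).
have kD : ~~ (N <= N + k < N + k)%N by rewrite ltnn andbF.
have := indep_off_step indE (U' := rv_of (measurable_chain k.+1)) IH kD (mh (N + k)%N)
    (fun w => erefl).
move=> H A s B mA us sD mB; apply: H => // m /sD.
apply: contra => /orP[/andP[-> mk]|/eqP->]; first by rewrite addnS ltnW.
by rewrite leq_addr addnS ltnS leqnn.
Qed.

Variables (k m : nat).
Hypothesis km : ~~ (N <= m < N + k)%N.
Variable g : R * R -> \bar R.
Hypothesis mg : measurable_fun setT g.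
Hypothesis g_ge0 : forall z, (0 <= g z)%E.

Let indUV A B : measurable A -> measurable B ->
  P (rv_of (measurable_chain k) @^-1` A `&` E m @^-1` B) =
  (P (rv_of (measurable_chain k) @^-1` A) * P (E m @^-1` B))%E.
Proof. by move=> mA mB; exact: (indep_off_pair (@indep_chain k)). Qed.

(** The index [m] may be any one outside the window already used: the next step of the chain, or 0
    for a walk that starts at index 1. *)
Lemma integral_chain1 : (\int[P]_w g (chain k w, E m w) =
  \int[P]_w \int[mu]_(u in pos) (g (chain k w, u) * (expR (- u))%:E))%E.
Proof.
rewrite (@integral_indep1 _ _ _ _ (rv_of (measurable_chain k)) (E m))//.
apply: eq_integral => w _; apply: (lawE m (f := fun u => g (chain k w, u))) => //.
by apply: (measurableT_comp mg); exact: pair1_measurable.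
Qed.

Lemma integral_chain2 : (\int[P]_w g (chain k w, E m w) =
  \int[mu]_(u in pos) (\int[P]_w g (chain k w, u) * (expR (- u))%:E))%E.
Proof.
rewrite (@integral_indep2 _ _ _ _ (rv_of (measurable_chain k)) (E m))//.
rewrite (lawE m (f := fun u => \int[P]_w g (chain k w, u))%E)//.
  apply: (measurable_fun_fubini_tonelli_G (fun z : T * R => g (chain k z.1, z.2))) => //.
  apply: (measurableT_comp mg); apply: measurable_fun_pair => //.
  by apply: (measurableT_comp (measurable_chain k)).
by move=> u; exact: integral_ge0.
Qed.

End process.

Section walk.
Variable a : nat -> R.

Definition step m (z : R * R) : R := z.1 + a m * (z.2 - 1).

Lemma measurable_step m : measurable_fun setT (step m).
Proof. by rewrite /step; mfun. Qed.

Definition walk := chain step 0.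

Lemma walkE N k w : walk N k w = \sum_(i < k) a (N + i)%N * (E (N + i)%N w - 1).
Proof. by elim: k => [|k IH]; rewrite ?big_ord0// big_ord_recr/= -IH. Qed.

Lemma measurable_walk N k : measurable_fun setT (walk N k).
Proof. exact: (measurable_chain measurable_step). Qed.

Lemma integral_expR_step (c b : R) : b < 1 ->
  (\int[mu]_(u in pos) ((expR (c + b * (u - 1)))%:E * (expR (- u))%:E) =
   (expR c * mgf_factor b)%:E)%E.
Proof.
move=> b1; have b10 : 0 < 1 - b by rewrite subr_gt0.
transitivity (\int[mu]_(u in pos) ((expR (c - b))%:E * (expR (- ((1 - b) * u)))%:E))%E.
  apply: eq_integral => u _; rewrite -!EFinM; congr EFin.
  by rewrite -!expRD; congr expR; ring.
rewrite ge0_integralZl//; last by mfun.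
by rewrite integral_expR// -EFinM expRD mulrA.
Qed.

Lemma mgf_walk (t : R) N k : (forall i, (i < k)%N -> t * a (N + i)%N < 1) ->
  (\int[P]_w (expR (t * walk N k w))%:E =
   (\prod_(i < k) mgf_factor (t * a (N + i)%N))%:E)%E.
Proof.
elim: k => [|k IH] ta.
  rewrite big_ord0 -[RHS](@probability_setT _ _ _ P) -[RHS]mul1e -integral_cst//.
  by apply: eq_integral => w _; rewrite mulr0 expR0.
have kk : ~~ (N <= N + k < N + k)%N by rewrite ltnn andbF.
pose g (z : R * R) : \bar R := (expR (t * step (N + k) z))%:E.
have mg : measurable_fun setT g by rewrite /g /step; mfun.
have g0 z : (0 <= g z)%E by rewrite lee_fin expR_ge0.
rewrite -[LHS]/(\int[P]_w g (chain step 0 N k w, E (N + k)%N w))%E.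
rewrite (integral_chain1 measurable_step 0 kk mg g0).
have tk : t * a (N + k)%N < 1 by exact: ta.
transitivity (\int[P]_w ((mgf_factor (t * a (N + k)%N))%:E * (expR (t * walk N k w))%:E))%E.
  apply: eq_integral => w _; rewrite -EFinM mulrC -integral_expR_step//.
  by apply: eq_integral => u _; rewrite /g /step/= mulrDr mulrA.
rewrite ge0_integralZl//; last 2 first.
- apply/measurable_EFinP; apply: (measurableT_comp (@measurable_expR _)).
  by apply: measurable_funM => //; exact: measurable_walk.
- by rewrite lee_fin ltW// mgf_factor_gt0.
rewrite IH => [|i ik]; last by apply: ta; exact: ltnW.
by rewrite -EFinM big_ord_recr/= mulrC.
Qed.

End walk.

(** * Kolmogorov's maximal inequality *)

Section kolmogorov.
Variables (a : nat -> R) (e : R).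
Hypothesis e0 : 0 < e.

(* Stopping the walk when it leaves ]-e, e[ gives Kolmogorov's maximal
   inequality: the second moment of the stopped walk is at most sum a_i^2. *)
Definition stop_step m (z : R * R) : R := if e <= `|z.1| then z.1 else step a m z.

Lemma measurable_stop_step m : measurable_fun setT (stop_step m).
Proof.
apply: measurable_fun_if => //.
- by apply: measurable_fun_ler => //; apply: measurableT_comp.
- exact: measurable_funTS.
- by apply: measurable_funTS; exact: measurable_step.
Qed.

Let stopped := chain stop_step 0.

Let integral_sqr_step (x b : R) :
  (\int[mu]_(u in pos) (((x + b * (u - 1)) ^+ 2)%:E * (expR (- u))%:E) =
   (x ^+ 2 + b ^+ 2)%:E)%E.
Proof.
pose q (u : R) := x + b * (u - 1).
(* The antiderivative of [q u ^+ 2 * expR (- u)] given by two integrations by parts; its value at 0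
   simplifies to [- (x ^+ 2 + b ^+ 2)]. *)
pose F u := - (((q u) ^+ 2 + 2 * b * q u + 2 * b ^+ 2) * expR (- u)).
have cq : continuous q.
  move=> u; apply: cvgD; first exact: cvg_cst.
  by apply: cvgMr; apply: cvgB; [exact: cvg_id|exact: cvg_cst].
have cf (u : R) : {for u, continuous (fun u => q u ^+ 2 * expR (- u))}.
  apply: cvgM; last exact: continuous_expRN.
  by under eq_fun do rewrite expr2; apply: cvgM; exact: cq.
under eq_integral do rewrite -EFinM.
have := @ge0_FTC2_0y R (fun u => q u ^+ 2 * expR (- u)) (cst 0) F (- (x ^+ 2 + b ^+ 2)) 0.
have -> : (\int[mu]_(x in pos) (cst 0 x : R)%:E = 0)%E by rewrite integral0_eq.
rewrite add0e => H; suff : (\int[mu]_(u in pos)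
    (q u ^+ 2 * expR (- u))%:E + (- (x ^+ 2 + b ^+ 2))%:E = 0%:E)%E.
  by move/(congr1 (fun z => z + (x ^+ 2 + b ^+ 2)%:E)%E) => /=;
      rewrite -addeA -EFinD addNr adde0 add0e.
have cF (u : R) : {for u, continuous F}.
  apply: cvgN; apply: cvgM; last exact: continuous_expRN.
  apply: cvgD; last exact: cvg_cst.
  apply: cvgD; last by apply: cvgMr; exact: cq.
  by under eq_fun do rewrite expr2; apply: cvgM; exact: cq.
apply: H.
- by move=> u _; rewrite mulr_ge0 ?sqr_ge0 ?expR_ge0.
- by [].
- by move=> u _; exact: cf.
- by move=> u _; exact: cst_continuous.
- move=> u _; have d1 := is_derive_expRN u.
  have dq : is_derive u 1 q b by apply: is_derive_eq; rewrite /GRing.scale/=; ring.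
  have dq2 := is_derive_expn 1 dq.
  by apply: is_derive_eq; rewrite /GRing.scale/=; ring.
- have -> : - (x ^+ 2 + b ^+ 2) = F 0 by rewrite /F /q oppr0 expR0; ring.
  by apply: cvg_at_right_filter; exact: cF.
- pose A := (x - b) ^+ 2 + 2 * b * (x - b) + 2 * b ^+ 2.
  pose B := 2 * b * (x - b) + 2 * b ^+ 2.
  have : - (A * expR (- u) + B * (u `^ 1 * expR (- u)) + b ^+ 2 * (u `^ 2 * expR (- u)))
      @[u --> +oo] --> - (A * 0 + B * 0 + b ^+ 2 * 0).
    apply: cvgN; apply: cvgD; last by apply: cvgMr; exact: cvg_powR_expR.
    apply: cvgD; last by apply: cvgMr; exact: cvg_powR_expR.
    by apply: cvgMr; exact: cvgr_expR.
  rewrite !mulr0 !addr0 oppr0; apply: cvg_trans; apply: near_eq_cvg; near=> u.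
  have u0 : 0 <= u by near: u; exact: nbhs_pinfty_ge.
  have u2 : u `^ 2 = u ^+ 2 by rewrite -powR_mulrn.
  by rewrite powRr1// u2 /F /q /A /B; ring.
Unshelve. all: end_near. Qed.

(** Integrating out the last variable adds [a (N + k) ^+ 2] to the second moment while the walk
    still runs, the cross term having mean zero, and adds nothing once it is stopped. *)
Let stopped_sqr N k :
  (\int[P]_w ((stopped N k w) ^+ 2)%:E <= (\sum_(i < k) a (N + i)%N ^+ 2)%:E)%E.
Proof.
elim: k => [|k IH].
  by rewrite big_ord0 integral0_eq// => w _; rewrite /stopped/= expr0n.
have kk : ~~ (N <= N + k < N + k)%N by rewrite ltnn andbF.
pose g (z : R * R) : \bar R := ((stop_step (N + k) z) ^+ 2)%:E.
have mg : measurable_fun setT g.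
  by apply/measurable_EFinP/measurable_funX; exact: measurable_stop_step.
have g0 z : (0 <= g z)%E by rewrite lee_fin sqr_ge0.
rewrite -[X in (X <= _)%E]/(\int[P]_w g (chain stop_step 0 N k w, E (N + k)%N w))%E.
rewrite (integral_chain1 measurable_stop_step 0 kk mg g0).
pose b w : R := if e <= `|stopped N k w| then 0 else a (N + k)%N ^+ 2.
have mst : measurable_fun setT (stopped N k) by exact: measurable_chain
    measurable_stop_step _ _ _.
have mb : measurable_fun setT b.
  apply: measurable_fun_if => //.
  by apply: measurable_fun_ler => //; apply: measurableT_comp.
have b0 w : 0 <= b w by rewrite /b; case: ifP => _; rewrite ?sqr_ge0.
apply: (@le_trans _ _ (\int[P]_w (((stopped N k w) ^+ 2)%:E + (b w)%:E))%E).
  rewrite le_eqVlt; apply/orP; left; apply/eqP; apply: eq_integral => w _.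
  rewrite -EFinD /g /stop_step /b -[chain _ _ _ _ _]/(stopped N k w) /=.
  case: ifPn => we; last by rewrite integral_sqr_step.
  under eq_integral do rewrite muleC.
  rewrite ge0_integralZr//; last 2 first.
  - by mfun.
  - by rewrite lee_fin sqr_ge0.
  by rewrite integral_expRN mul1e addr0.
rewrite ge0_integralD//; last 4 first.
- by move=> w _; rewrite lee_fin sqr_ge0.
- by apply/measurable_EFinP/measurable_funX.
- by move=> w _; rewrite lee_fin.
- exact/measurable_EFinP.
rewrite big_ord_recr/= EFinD leeD//.
rewrite -[leRHS]mule1 -(@probability_setT _ _ _ P) -integral_cst//.
apply: ge0_le_integral => //.
- by move=> w _; rewrite lee_fin.
- exact/measurable_EFinP.
- by move=> w _; rewrite lee_fin /b; case: ifP => _; rewrite ?sqr_ge0.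
Qed.

Lemma prob_stopped N k :
  (P [set w | (e <= `|stopped N k w|)%R] <=
   ((\sum_(i < k) a (N + i)%N ^+ 2) / e ^+ 2)%:E)%E.
Proof.
have mst : measurable_fun setT (stopped N k) by exact: measurable_chain
    measurable_stop_step _ _ _.
have mA : measurable [set w | e <= `|stopped N k w|].
  by apply: measurable_ge_set; apply: measurableT_comp.
have e2 : 0 < e ^+ 2 by rewrite exprn_gt0.
rewrite EFinM muleC lee_pdivlMl//.
apply: le_trans (stopped_sqr N k).
rewrite -[X in P X](setIT) -integral_indic// -ge0_integralZl//; last 2 first.
- exact/measurable_EFinP/measurable_indic.
- by rewrite lee_fin ltW.
apply: ge0_le_integral => //.
- by move=> w _; rewrite mule_ge0// lee_fin ltW.
- by apply: measurable_funeM; exact/measurable_EFinP/measurable_indic.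
- exact/measurable_EFinP/measurable_funX.
- move=> w _; rewrite -EFinM lee_fin indicE; case: (boolP (w \in _)) => [|_].
    rewrite inE/= => we; rewrite mulr1 -[leRHS]real_normK ?num_real//.
    by rewrite ler_pXn2r ?nnegrE// ltW.
  by rewrite mulr0 sqr_ge0.
Qed.

(** An exit of the walk at any time up to [k] is still visible in the stopped walk at time [k], so a
    bound at that single time controls the maximum. The dichotomy [H] is proved by induction. *)
Lemma walk_stopped N k j w : (j <= k)%N -> e <= `|walk a N j w| ->
  e <= `|stopped N k w|.
Proof.
have H : e <= `|stopped N k w| \/
    (stopped N k w = walk a N k w /\ forall j, (j <= k)%N -> `|walk a N j w| < e).
  elim: k {j} => [|k [IH|[IH1 IH2]]].
  - by right; split=> // j; rewrite leqn0 => /eqP ->; rewrite /walk/= normr0.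
  - by left; rewrite /stopped/= /stop_step/= -[chain _ _ _ _ _]/(stopped N k w) IH.
  - have kE : stopped N k.+1 w = walk a N k.+1 w.
      rewrite /stopped/= /stop_step/= -[chain stop_step _ _ _ _]/(stopped N k w) IH1.
      by rewrite leNgt (IH2 k).
    have [ke|ke] := leP e `|walk a N k.+1 w|; first by left; rewrite kE.
    right; split=> // j; rewrite leq_eqVlt => /predU1P[->//|]; rewrite ltnS; exact: IH2.
by case: H => // -[_ H] jk; rewrite leNgt H.
Qed.

End kolmogorov.

End chain.

(** * Almost sure convergence *)

Lemma walk_shift d (T : measurableType d) (R : realType) (P : probability T R)
    (E : nat -> {RV P >-> R}) (a : nat -> R) N k w :
  walk E a 0 (N + k) w - walk E a 0 N w = walk E a N k w.
Proof.
rewrite !walkE; apply/eqP; rewrite subr_eq addrC; apply/eqP.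
rewrite big_split_ord/=; congr (_ + _); apply: eq_bigr => i _.
Qed.

Section convergence.
Context d (T : measurableType d) (R : realType) (P : probability T R).
Variable E : nat -> {RV P >-> R}.

Hypothesis indE : forall (s : seq nat) (B : nat -> set R), uniq s ->
  (forall m, measurable (B m)) ->
  P (cyl E s B) = (\prod_(m <- s) P (E m @^-1` B m))%E.

Hypothesis lawE : forall m (f : R -> \bar R), measurable_fun setT f ->
  (forall u, 0 <= f u)%E ->
  (\int[P]_w f (E m w) = \int[mu]_(u in pos) (f u * (expR (- u))%:E))%E.

Variables (a : nat -> R) (M : R).
Hypothesis aM : forall n, \sum_(i < n) a i ^+ 2 <= M.

Let sum_sqr_tail (e : R) : 0 < e ->
  exists N, forall k, \sum_(i < k) a (N + i)%N ^+ 2 <= e.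
Proof.
move=> e0; pose s n := \sum_(i < n) a i ^+ 2.
have nds : nondecreasing_seq s.
  by apply/nondecreasing_seqP => n; rewrite /s big_ord_recr/= lerDl sqr_ge0.
have cs : cvgn s.
  by apply: nondecreasing_is_cvgn => //; exists M => _ [n _ <-]; exact: aM.
have [N _ HN] : \forall n \near \oo, limn s - e < s n.
  by apply: (cvgr_gt _ cs); rewrite ltrBlDr ltrDl.
exists N => k; have := HN N (leqnn _); have := nondecreasing_cvgn_le nds cs (N + k).
rewrite {1}/s big_split_ord/= -/(s N) => H1 H2.
by rewrite -(lerD2l (s N)) (le_trans H1)// -lerBlDr ltW.
Qed.

Let stopped e := chain E (stop_step a e) 0.

Let stop_event e N k := [set w | e <= `|stopped e N k w|].

Let measurable_stop_event e N k : measurable (stop_event e N k).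
Proof.
apply: measurable_ge_set; apply: measurableT_comp => //.
exact: measurable_chain (measurable_stop_step _ _) _ _ _.
Qed.

(** On this event the increments of the walk reach size [e] after every index; a path that is not
    Cauchy lies in [bad k.+1%:R^-1] for some [k]. *)
Let bad e := \bigcap_N \bigcup_k stop_event e N k.

(** Given [r], start at an [N] beyond which the squared coefficients sum to at most [r * e ^+ 2].
    The maximal inequality then bounds the probability by [r], uniformly in the number of steps. *)
Let bad0 e : 0 < e -> P (bad e) = 0%E.
Proof.
move=> e0.
have mU N : measurable (\bigcup_k stop_event e N k).
  exact: bigcupT_measurable.
have mbad : measurable (bad e) by exact: bigcapT_measurable.
apply/eqP; rewrite eq_le measure_ge0 andbT; apply/lee_addgt0Pr => r r0.
rewrite add0e; have [N HN] := sum_sqr_tail (mulr_gt0 r0 (exprn_gt0 2 e0)).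
apply: (@le_trans _ _ (P (\bigcup_k stop_event e N k))).
  by apply: le_measure; rewrite ?inE// => w /(_ N); exact.
have nd : nondecreasing_seq (stop_event e N).
  apply/nondecreasing_seqP => k; apply/subsetPset => w.
  by rewrite /stop_event/= /stopped/= {2}/stop_step/= => H; rewrite H.
have := @nondecreasing_cvg_mu _ _ _ P _ (measurable_stop_event e N) (mU N) nd.
move=> cP; rewrite -(cvg_lim _ cP)//; apply: lime_le; first exact: cvgP cP.
apply: nearW => k; apply: (le_trans (prob_stopped indE lawE a e0 N k)).
by rewrite lee_fin ler_pdivrMr ?exprn_gt0.
Qed.

Lemma walk_cvg_ae : {ae P, forall w, cvgn (fun n => walk E a 0 n w)}.
Proof.
have mbad e : measurable (bad e).
  by apply: bigcapT_measurable => N; exact: bigcupT_measurable.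
apply: (@negligibleS _ _ _ _ (\bigcup_k bad k.+1%:R^-1)); last first.
  apply: negligible_bigcup => k; apply/negligibleP => //; exact: bad0.
move=> w /= /cvgn_cauchy_nat/existsNP[k /forallNP kN]; exists k => // N _.
have /existsNP[n /not_implyP[Nn /negP]] := kN N.
rewrite -leNgt -{1}(subnKC Nn) walk_shift => H.
by exists (n - N)%N => //; apply: walk_stopped H.
Qed.

End convergence.

(** * Limits of tail probabilities *)

Lemma integral_truncated (R : realType) (f F : R -> R) (c : R) : 0 <= c ->
  continuous f -> (forall u : R, is_derive u 1 F (f u)) ->
  (\int[mu]_(u in pos) (if u <= c then f u else 0)%:E = (F c - F 0)%:E)%E.
Proof.
move=> c0 cf dF.
transitivity (\int[mu]_(u in `]0%R, c]) (f u)%:E)%E.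
  rewrite integral_mkcond [RHS]integral_mkcond; apply: eq_integral => u _.
  rewrite !patchE !mem_setE !in_itv/= andbT.
  by case: (ltP 0 u) => //= _; case: ifP.
have cF : continuous F.
  by move=> u; apply: differentiable_continuous; apply/derivable1_diffP;
      exact: (@ex_derive _ _ _ _ _ _ _ (dF u)).
have mf : measurable_fun setT f by exact: continuous_measurable_fun.
rewrite integral_itv_obnd_cbnd; last by apply/measurable_EFinP; exact: measurable_funTS.
move: c0; rewrite le_eqVlt => /predU1P[<-|c0].
  by rewrite set_itv1 subrr integral_set1.
rewrite (@continuous_FTC2 _ _ F)//.
- exact: continuous_subspaceT.
- split => [u _||]; first by exact: (@ex_derive _ _ _ _ _ _ _ (dF u)).
  + by apply: cvg_at_right_filter; exact: cF.
  + by apply: cvg_at_left_filter; exact: cF.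
- by move=> u _; rewrite derive1E; exact: derive_val.
Qed.

Section portmanteau.
Context d (T : measurableType d) (R : realType) (P : probability T R).

(** Because the inequality is strict, almost every path with [Y < x] has [S n < x] from some rank
    on. The sets [A n] of such paths increase, and each is contained in the events of index at least
    [n]. *)
Lemma prob_limit_lt (S : nat -> T -> R) (Y : T -> R) (x : R) (c : \bar R) :
  (forall n, measurable_fun setT (S n)) -> measurable_fun setT Y ->
  {ae P, forall w, S n w @[n --> \oo] --> Y w} ->
  (\forall n \near \oo, P [set w | (S n w < x)%R] <= c)%E ->
  (P [set w | (Y w < x)%R] <= c)%E.
Proof.
move=> mS mY cS [N _ HN].
have mlt (f : T -> R) : measurable_fun setT f -> measurable [set w | f w < x].
  exact: measurable_lt_set.
pose A n := \bigcap_(k in [set k | (n <= k)%N]) [set w | S k w < x].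
have mA n : measurable (A n) by apply: bigcap_measurableType => k _; exact: mlt.
have mU : measurable (\bigcup_n A n) by exact: bigcupT_measurable.
have ndA : nondecreasing_seq A.
  by move=> m n mn; apply/subsetPset => w H k /= nk; apply: H => /=; exact: leq_trans nk.
case: cS => B [mB PB0 sB].
apply: (@le_trans _ _ (P (B `|` \bigcup_n A n))).
  apply: le_measure; rewrite ?inE//; [exact: mlt|exact: measurableU|].
  move=> w /= Yx; case: (pselect (S n w @[n --> \oo] --> Y w)) => [H|H].
    have [n _ Hn] := cvgr_lt _ H _ Yx.
    by right; exists n => // k /= /Hn.
  by left; apply: sB.
apply: (le_trans (measureU2 _ mB mU)); rewrite -[X in (X <=
    _)%E]/(P B + P (\bigcup_n A n))%E PB0 add0e.
have cP := @nondecreasing_cvg_mu _ _ _ P _ mA mU ndA.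
rewrite -(cvg_lim _ cP)//; apply: lime_le; first exact: cvgP cP.
exists N => // n Nn; apply: le_trans (HN _ Nn).
by apply: le_measure; rewrite ?inE//; [exact: mlt|move=> w /(_ n (leqnn n))].
Qed.

Lemma prob_limit_gt (S : nat -> T -> R) (Y : T -> R) (x : R) (c : \bar R) :
  (forall n, measurable_fun setT (S n)) -> measurable_fun setT Y ->
  {ae P, forall w, S n w @[n --> \oo] --> Y w} ->
  (\forall n \near \oo, P [set w | (x < S n w)%R] <= c)%E ->
  (P [set w | (x < Y w)%R] <= c)%E.
Proof.
move=> mS mY cS HN.
have E (f : T -> R) : [set w | x < f w] = [set w | - f w < - x].
  by apply/seteqP; split => w /=; rewrite ltrN2.
rewrite E; apply: (@prob_limit_lt (fun n w => - S n w)).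
- by move=> n; apply: measurableT_comp.
- exact: measurableT_comp.
- by move: cS; apply: filterS => w H; exact: cvgN.
- by near do rewrite -E; exact: HN.
Unshelve. all: end_near. Qed.

End portmanteau.

(** * The distribution function of the partial sums at L = 0 *)

Section gumbel.
Context d (T : measurableType d) (R : realType) (P : probability T R).
Variable E : nat -> {RV P >-> R}.

Hypothesis indE : forall (s : seq nat) (B : nat -> set R), uniq s ->
  (forall m, measurable (B m)) ->
  P (cyl E s B) = (\prod_(m <- s) P (E m @^-1` B m))%E.

Hypothesis lawE : forall m (f : R -> \bar R), measurable_fun setT f ->
  (forall u, 0 <= f u)%E ->
  (\int[P]_w f (E m w) = \int[mu]_(u in pos) (f u * (expR (- u))%:E))%E.

Let hstep m (z : R * R) : R := z.1 + m%:R^-1 * z.2.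

Let measurable_hstep m : measurable_fun setT (hstep m).
Proof. by rewrite /hstep; mfun. Qed.

Let hsum := chain E hstep 0 1.

Let F n (x : R) := if 0 <= x then (1 - expR (- x)) ^+ n else 0.

(* Renyi's representation: this sum has the law of the maximum of n iid exponential variables *)
Let prob_hsum_le n x : P [set w | (hsum n w <= x)%R] = (F n x)%:E.
Proof.
elim: n x => [|n IH] x.
  rewrite /F expr0 /hsum/=; case: ifPn => x0.
    by rewrite -[RHS](@probability_setT _ _ _ P); congr (P _); apply/seteqP; split.
  by rewrite -[RHS](measure0 P); congr (P _); apply/seteqP; split => // w /=;
      rewrite (negbTE x0).
have kk : ~~ (1 <= 1 + n < 1 + n)%N by rewrite ltnn andbF.
pose g (z : R * R) : \bar R := (\1_[set y : R | y <= x] (hstep (1 + n) z))%:E.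
have mx : measurable [set y : R | y <= x] by rewrite -set_itvNyc.
have mg : measurable_fun setT g.
  apply/measurable_EFinP; apply: (measurableT_comp (@measurable_indic _ _ _ setT _ mx)).
  exact: measurable_hstep.
have g0 z : (0 <= g z)%E by rewrite lee_fin indicE.
have mc k y : measurable [set w | hsum k w <= y].
  by apply: measurable_le_set; exact: measurable_chain.
transitivity (\int[P]_w g (chain E hstep 0 1 n w, E (1 + n)%N w))%E.
  rewrite -[X in P X]setIT -integral_indic//.
(* With the last variable [u] held fixed, the inner probability is the induction hypothesis at the
   level [x - n.+1%:R^-1 * u]. *)
rewrite (integral_chain2 indE lawE measurable_hstep 0 kk mg g0).
have n0 : 0 < n.+1%:R :> R by [].
transitivity (\int[mu]_(u in pos) (F n (x - n.+1%:R^-1 * u) * expR (- u))%:E)%E.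
  apply: eq_integral => u _; rewrite EFinM -IH; congr (_ * _)%E.
  rewrite -[in RHS](setIT [set w | _]) -integral_indic//.
  apply: eq_integral => w _; rewrite /g /hstep/= !indicE add1n; congr ((_ _)%:R%:E).
  by apply/idP/idP; rewrite !inE/= lerBrDr.
rewrite /F; case: ifPn => x0; last first.
  rewrite integral0_eq// => u; rewrite /= in_itv/= andbT => u0.
  rewrite ifN ?mul0r// -ltNge subr_lt0; move: x0; rewrite -ltNge => x0.
  by rewrite (lt_trans x0)// mulr_gt0// invr_gt0.
(* With [v = expR (- (n.+1%:R^-1 * u))] the integrand equals [(v - expR (- x)) ^+ n * v], and the
   derivative of [v] is [- n.+1%:R^-1 * v]; hence this antiderivative. *)
pose G (u : R) := - (expR (- (n.+1%:R^-1 * u)) - expR (- x)) ^+ n.+1.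
pose f (u : R) := (1 - expR (- (x - n.+1%:R^-1 * u))) ^+ n * expR (- u).
have cv (u : R) : (fun u : R => n.+1%:R^-1 * u) @ u --> n.+1%:R^-1 * u.
  by apply: cvgMr; exact: cvg_id.
transitivity (\int[mu]_(u in pos) (if u <= n.+1%:R * x then f u else 0)%:E)%E.
  apply: eq_integral => u _; rewrite /f subr_ge0 ler_pdivrMl//.
  by case: ifP; rewrite ?mul0r.
rewrite (_ : (1 - _) ^+ _ = G (n.+1%:R * x) - G 0); last first.
  rewrite /G mulrA mulVf ?gt_eqF// mul1r subrr mulr0 oppr0 expR0 expr0n/= oppr0.
  by rewrite sub0r opprK.
apply: integral_truncated.
- by rewrite mulr_ge0// ltW.
- move=> u; apply: cvgM; last exact: continuous_expRN.
  apply: (@cvg_comp _ _ _ _ (fun y : R => y ^+ n)); last exact: exprn_continuous.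
  apply: cvgB; first exact: cvg_cst.
  apply: (@cvg_comp _ _ _ (fun u : R => x - n.+1%:R^-1 * u) (fun y => expR (- y)));
      last exact: continuous_expRN.
  by apply: cvgB; [exact: cvg_cst|exact: cv].
- move=> u.
  have d0 : is_derive u 1 (fun u : R => n.+1%:R^-1 * u) n.+1%:R^-1.
    by apply: is_derive_eq; rewrite /GRing.scale/=; ring.
  have d1 : is_derive u 1 (fun u : R => expR (- (n.+1%:R^-1 * u)) - expR (- x))
     (- (n.+1%:R^-1 * expR (- (n.+1%:R^-1 * u)))).
    by apply: is_derive_eq; rewrite /GRing.scale/=; ring.
  have d2 := is_derive_expn n d1.
  apply: is_derive_eq; rewrite /f.
  have -> : 1 - expR (- (x - n.+1%:R^-1 * u)) =
     (expR (- (n.+1%:R^-1 * u)) - expR (- x)) * expR (n.+1%:R^-1 * u).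
    by rewrite mulrBl -!expRD addNr expR0; congr (_ - expR _); ring.
  rewrite exprMn -expRM_natl -mulrA.
  have -> : expR (- (n.+1%:R^-1 * u)) = expR (n%:R * (n.+1%:R^-1 * u)) * expR (- u).
    rewrite -expRD; congr expR.
    by rewrite -natr1; field; rewrite natr1.
  set A := _ ^+ n; set B := expR (n%:R * _); set C := expR (- u).
  by field; rewrite addrC natr1.
Qed.

Lemma prob_walk_acoef0 n x :
  P [set w | (walk E (acoef ^~ 0) 0 n.+1 w <= x)%R] = (F n (x + harmonic_sum n))%:E.
Proof.
rewrite -prob_hsum_le; congr (P _).
suff W w : walk E (acoef ^~ 0) 0 n.+1 w + harmonic_sum n = hsum n w.
  by apply/seteqP; split => w /=; rewrite -W lerD2r.
rewrite walkE big_ord_recl/= acoef00 mul0r add0r /harmonic_sum -big_split/=.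
have -> : hsum n w = \sum_(i < n) i.+1%:R^-1 * E i.+1 w.
  by elim: n => [|n IHn]; rewrite ?big_ord0// big_ord_recr/= -IHn.
apply: eq_bigr => i _; rewrite add0n acoefS0.
by ring.
Qed.

End gumbel.

Section limits.
Context d (T : measurableType d) (R : realType) (P : probability T R).

Lemma prob_le_gt (f : T -> R) (x : R) : measurable_fun setT f ->
  P [set w | (f w <= x)%R] = (1 - P [set w | (x < f w)%R])%E.
Proof.
move=> mf; have -> : [set w | f w <= x] = ~` [set w | x < f w].
  by apply/seteqP; split => w /=; rewrite leNgt => /negP.
by rewrite probability_setC//; exact: measurable_gt_set.
Qed.

Variables (S : nat -> T -> R) (Y : T -> R).
Hypothesis mS : forall n, measurable_fun setT (S n).
Hypothesis mY : measurable_fun setT Y.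
Hypothesis cS : {ae P, forall w, S n w @[n --> \oo] --> Y w}.

Lemma prob_limit_gt_le (x c : R) (u : nat -> R) : u n @[n --> \oo] --> c ->
  (forall n, P [set w | (x < S n w)%R] <= (u n)%:E)%E ->
  (P [set w | (x < Y w)%R] <= c%:E)%E.
Proof.
move=> uc Su; apply/lee_addgt0Pr => e e0; apply: (prob_limit_gt mS mY cS).
have ce : c < c + e by rewrite ltrDl.
near=> n; apply: (le_trans (Su n)); rewrite -EFinD lee_fin ltW//.
by near: n; exact: cvgr_lt uc _ ce.
Unshelve. all: end_near. Qed.

Lemma prob_limit_lt_le (x c : R) (u : nat -> R) : u n @[n --> \oo] --> c ->
  (forall n, P [set w | (S n w < x)%R] <= (u n)%:E)%E ->
  (P [set w | (Y w < x)%R] <= c%:E)%E.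
Proof.
move=> uc Su; apply/lee_addgt0Pr => e e0; apply: (prob_limit_lt mS mY cS).
have ce : c < c + e by rewrite ltrDl.
near=> n; apply: (le_trans (Su n)); rewrite -EFinD lee_fin ltW//.
by near: n; exact: cvgr_lt uc _ ce.
Unshelve. all: end_near. Qed.

(** Limits of partial sums control strict events only; continuity of the bound lets the level
    decrease to [x]. *)
Lemma prob_le_right_cont (x : R) (v : R -> R) : v y @[y --> x] --> v x ->
  (forall y, x < y -> (P [set w | (Y w < y)%R] <= (v y)%:E)%E) ->
  (P [set w | (Y w <= x)%R] <= (v x)%:E)%E.
Proof.
move=> cv Yv; set A := [set w | _].
have mA : measurable A by exact: measurable_le_set.
have PA : P A \is a fin_num by exact: fin_num_measure.
rewrite -(fineK PA) lee_fin.
have cv' : v y @[y --> x^'+] --> v x by exact: cvg_at_right_filter.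
rewrite -(cvg_lim (@Rhausdorff R) cv'); apply: limr_ge; first exact: cvgP cv'.
near=> y; rewrite -lee_fin fineK//.
have xy : x < y by near: y; exact: nbhs_right_gt.
apply: le_trans (Yv y xy); apply: le_measure; rewrite ?inE//.
  exact: measurable_lt_set.
by move=> w /= /le_lt_trans; exact.
Unshelve. all: end_near. Qed.

End limits.

Lemma integral_expR_tail (R : realType) (c : R) : 0 <= c ->
  (\int[mu]_(u in pos) ((\1_[set u : R | (c < u)%R] u)%:E * (expR (- u))%:E) =
      (expR (- c))%:E)%E.
Proof.
move=> c0.
have mc : measurable [set u : R | c < u].
  by apply: (@measurable_gt_set _ _ R id).
have mle : measurable [set u : R | u <= c].
  by apply: (@measurable_le_set _ _ R id).
have mi : measurable_fun (pos : set R) (fun u : R =>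
    (\1_[set u : R | (c < u)%R] u)%:E * (expR (- u))%:E)%E.
  apply: emeasurable_funM; last by mfun.
  by apply: measurable_funTS; exact/measurable_EFinP/measurable_indic.
have H : (\int[mu]_(u in pos) ((\1_[set u : R | (c < u)%R] u)%:E * (expR (- u))%:E) +
   \int[mu]_(u in pos) (if (u <= c)%R then expR (- u) else 0)%:E = 1)%E.
  rewrite -ge0_integralD//.
  - rewrite -(@integral_expRN R); apply: eq_integral => u _.
    rewrite indicE -EFinM -EFinD; congr EFin.
    have -> : (u \in [set u | c < u]) = (c < u) by apply/idP/idP; rewrite inE.
    by case: ltP => _; rewrite ?mul0r ?mul1r ?add0r ?addr0.
  - by move=> u _; rewrite lee_fin; case: ifP => // _; exact: expR_ge0.
  - apply/measurable_EFinP; apply: measurable_funTS; apply: measurable_fun_ifT => //.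
      exact: measurable_fun_ler.
    by mfun.
have dN (u : R) : is_derive u 1 (fun u : R => - expR (- u)) (expR (- u)).
  by have d1 := is_derive_expRN u; apply: is_derive_eq; rewrite opprK.
have I := integral_truncated c0 (@continuous_expRN R) dN.
rewrite {}I in H.
move: H; rewrite oppr0 expR0 opprK => /(congr1 (fun z => z - (- expR (- c) + 1)%:E)%E).
by rewrite addeK// -EFinB => ->; congr EFin; ring.
Qed.

Lemma integral_expR_tail_min (R : realType) (c : R) :
  (\int[mu]_(u in pos) ((\1_[set u : R | (c < u)%R] u)%:E * (expR (- u))%:E) =
   (Num.min 1 (expR (- c)))%:E)%E.
Proof.
have [c0|c0] := leP 0 c.
  by rewrite integral_expR_tail// min_r// -expR0 ler_expR oppr_le0.
rewrite min_l; last by rewrite -expR0 ler_expR oppr_ge0 ltW.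
rewrite -(@integral_expRN R); apply: eq_integral => u; rewrite inE/= in_itv/= andbT => u0.
by rewrite indicE mem_set ?mul1e//= (lt_trans c0).
Qed.

(** * Tails of the partial sums *)

Section tails.
Context d (T : measurableType d) (R : realType) (P : probability T R).
Variable E : nat -> {RV P >-> R}.

Hypothesis indE : forall (s : seq nat) (B : nat -> set R), uniq s ->
  (forall m, measurable (B m)) ->
  P (cyl E s B) = (\prod_(m <- s) P (E m @^-1` B m))%E.

Hypothesis lawE : forall m (f : R -> \bar R), measurable_fun setT f ->
  (forall u, 0 <= f u)%E ->
  (\int[P]_w f (E m w) = \int[mu]_(u in pos) (f u * (expR (- u))%:E))%E.

Variable L : R.
Hypothesis L01 : 0 < L < 2^-1.

Let S n := walk E (acoef ^~ L) 0 n.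
Let Y n := walk E (acoef ^~ L) 1 n.

Let measurable_Y n : measurable_fun setT (Y n).
Proof. exact: measurable_walk. Qed.

Let SE n w : S n.+1 w = Y n w + (E 0 w - 1).
Proof.
rewrite /S /Y !walkE big_ord_recl/= acoef0m// mul1r addrC; congr (_ + _).
Qed.

Let measurable_indic_gt (x : R) : measurable_fun setT (fun z : R * R =>
  (\1_[set y : R | (x < y)%R] (z.1 + (z.2 - 1)))%:E : \bar R).
Proof.
apply/measurable_EFinP; apply: (measurableT_comp (@measurable_indic _ _ _ setT _ _));
    last by mfun.
exact: (@measurable_gt_set _ _ R id).
Qed.

Let prob_S n x : P [set w | (x < S n.+1 w)%R] =
  (\int[P]_w (Num.min 1 (expR (- (x + 1 - Y n w))))%:E)%E.
Proof.
under eq_integral do rewrite -integral_expR_tail_min.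
have k0 : ~~ (1 <= 0 < 1 + n)%N by [].
pose g (z : R * R) : \bar R := (\1_[set y : R | (x < y)%R] (z.1 + (z.2 - 1)))%:E.
transitivity (\int[P]_w g (chain E (step (acoef ^~ L)) 0 1 n w, E 0 w))%E.
  rewrite -[X in P X]setIT -integral_indic//; last first.
    by apply: measurable_gt_set; exact: measurable_walk.
  by apply: eq_integral => w _; rewrite /g !indicE/= -SE; congr ((_ _)%:R%:E);
      apply/idP/idP; rewrite !inE.
rewrite (integral_chain1 indE lawE (measurable_step _) 0 k0 (measurable_indic_gt x)).
  apply: eq_integral => w _; apply: eq_integral => u _; congr (_ * _)%E.
  rewrite !indicE/= -/(Y n w); congr ((_ _)%:R%:E).
  have e : (x + 1 - Y n w < u) = (x < Y n w + (u - 1)).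
    by rewrite -subr_gt0 -[RHS]subr_gt0; congr (0 < _); ring.
  by apply/idP/idP; rewrite !inE/= e.
by move=> z; rewrite lee_fin indicE.
Qed.

Let expR_Y (t : R) n : (forall i, (i < n)%N -> t * acoef i.+1 L < 1) ->
  (\int[P]_w (expR (t * Y n w))%:E =
   (\prod_(i < n) mgf_factor (t * acoef i.+1 L))%:E)%E.
Proof. by move=> H; rewrite (mgf_walk indE lawE). Qed.

Let acoef_lt1_2 i : 2 * acoef i.+1 L < 1.
Proof.
rewrite mulrC -ltr_pdivlMr// div1r.
by have /andP[_ L2] := L01; apply: le_lt_trans L2; exact: acoef_le.
Qed.

Let acoef_lt1 i : acoef i.+1 L < 1.
Proof.
by apply: le_lt_trans (acoef_lt1_2 i); rewrite ler_peMl ?ler1n// ltW// acoef_gt0.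
Qed.

Let C := expR (16 * (log_mgf_coef L + 1) / (1 - 2 * L)).

Let first_moment (x : R) n :
  (\int[P]_w (expR (- (x + 1 - Y n w)))%:E = ((expR 1)^-1 * kappa_prod L n * expR (- x))%:E)%E.
Proof.
transitivity (\int[P]_w ((expR (- (x + 1)))%:E * (expR (1 * Y n w))%:E))%E.
  by apply: eq_integral => w _; rewrite -EFinM -expRD; congr (expR _)%:E; ring.
rewrite ge0_integralZl//; last first.
  by apply/measurable_EFinP; apply: (measurableT_comp (@measurable_expR _));
      apply: measurable_funM.
rewrite expR_Y; last by move=> i _; rewrite mul1r.
under eq_bigr do rewrite mul1r.
rewrite -EFinM -/(kappa_prod L n); congr EFin.
have -> : - (x + 1) = - x - 1 by ring.
by rewrite expRD (expRN 1); set a := _^-1; ring.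
Qed.

Let second_moment (x : R) n :
  (\int[P]_w ((expR (- (x + 1 - Y n w))) ^+ 2)%:E <= (C * expR (- (2 * x)))%:E)%E.
Proof.
rewrite (_ : (\int[P]_w _)%E = \int[P]_w ((expR (- (2 * x + 2)))%:E * (expR
    (2 * Y n w))%:E))%E; last first.
  by apply: eq_integral => w _; rewrite -EFinM -expRM_natl -expRD; congr (expR _)%:E; ring.
rewrite ge0_integralZl//; last first.
  by apply/measurable_EFinP; apply: (measurableT_comp (@measurable_expR _));
      apply: measurable_funM.
rewrite expR_Y; last by move=> i _.
rewrite -EFinM lee_fin mulrC ler_pM ?expR_ge0//.
- by apply: prodr_ge0 => i _; rewrite ltW// mgf_factor_gt0.
- exact: prod_mgf_factor2_le.
- by rewrite ler_expR; lra.
Qed.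

Let measurable_w (x : R) n :
  measurable_fun setT (fun w => (expR (- (x + 1 - Y n w)))%:E : \bar R).
Proof.
apply/measurable_EFinP; apply: (measurableT_comp (@measurable_expR _)).
by apply: measurableT_comp => //; apply: measurable_funB.
Qed.

Let measurable_min (x : R) n : measurable_fun setT
  (fun w => (Num.min 1 (expR (- (x + 1 - Y n w))))%:E : \bar R).
Proof.
apply/measurable_EFinP; apply: measurable_minr => //.
apply/measurable_EFinP; exact: measurable_w.
Qed.

Lemma prob_walk_gt_le x n :
  (P [set w | (x < S n.+1 w)%R] <= ((expR 1)^-1 * kappa_prod L n * expR (- x))%:E)%E.
Proof.
rewrite prob_S -first_moment; apply: ge0_le_integral => //.
by move=> w _; rewrite lee_fin ge_min lexx orbT.
Qed.

(** Integrates the pointwise inequality b <= min(1, b) + b^2, with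
    [b = expR (- (x + 1 - Y n w))]. *)
Lemma prob_walk_gt_ge x n :
  (((expR 1)^-1 * kappa_prod L n * expR (- x))%:E <=
    P [set w | (x < S n.+1 w)%R] + (C * expR (- (2 * x)))%:E)%E.
Proof.
rewrite prob_S -first_moment; apply: (le_trans _ (leeD2l _ (second_moment x n))).
have m2 : measurable_fun setT (fun w => (expR (- (x + 1 - Y n w)) ^+ 2)%:E : \bar R).
  by apply/measurable_EFinP; apply: measurable_funX; apply/measurable_EFinP;
      exact: measurable_w.
rewrite -ge0_integralD//; apply: ge0_le_integral => //.
  by apply: emeasurable_funD => //; exact: measurable_min.
move=> w _; rewrite -EFinD lee_fin; set b := expR _.
have b0 : 0 < b by exact: expR_gt0.
have [b1|b1] := leP 1 b; last by rewrite lerDl sqr_ge0.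
by rewrite (@le_trans _ _ (b ^+ 2)) ?lerDr// expr2 ler_peMl// ltW.
Qed.

Let expR_S (t : R) n : 0 < t ->
  (\int[P]_w (expR (- (t * S n w)))%:E = (expR (log_mgf L n t))%:E)%E.
Proof.
move=> t0; under eq_integral do rewrite -mulNr.
rewrite (mgf_walk indE lawE) => [|i _]; last first.
  by rewrite add0n mulNr (lt_trans _ ltr01)// oppr_lt0 mulr_gt0// acoef_gt0.
congr EFin; rewrite /log_mgf expR_sum; apply: eq_bigr => i _; rewrite add0n.
have a0 : 0 < t * acoef i L by rewrite mulr_gt0// acoef_gt0.
rewrite /mgf_factor /phi mulNr !opprK expRD expRN lnK// posrE; lra.
Qed.

Lemma prob_walk_lt_le x t n : 0 < t ->
  (P [set w | (S n w < - x)%R] <=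
   (expR (log_mgf_coef L * t `^ ((1 - L)^-1) + t - t * x))%:E)%E.
Proof.
move=> t0; have mA : measurable [set w | S n w < - x].
  by apply: measurable_lt_set; exact: measurable_walk.
apply: (@le_trans _ _ ((expR (- (t * x)))%:E * (expR (log_mgf L n t))%:E)%E); last first.
  rewrite -EFinM lee_fin [in leRHS]addrC expRD ler_wpM2l ?expR_ge0// ler_expR.
  exact: log_mgf_le.
rewrite -expR_S// -ge0_integralZl//; last first.
  apply/measurable_EFinP; apply: (measurableT_comp (@measurable_expR _)).
  by apply: measurableT_comp => //; apply: measurable_funM => //; exact: measurable_walk.
rewrite -[X in P X]setIT -integral_indic//; apply: ge0_le_integral => //.
- exact/measurable_EFinP/measurable_indic.
- apply: emeasurable_funM => //.
  apply/measurable_EFinP; apply: (measurableT_comp (@measurable_expR _)).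
  by apply: measurableT_comp => //; apply: measurable_funM => //; exact: measurable_walk.
move=> w _; rewrite -EFinM lee_fin -expRD indicE; case: (boolP (_ \in _)) => [|_];
    last exact: expR_ge0.
rewrite inE/= => Sx; rewrite -expR0 ler_expR -opprD -mulrDr oppr_ge0 pmulr_rle0//.
by lra.
Qed.

(* Splits E e^(- t S_n) according to whether S_n lies in [-y, -x[, above or below;
   the two outer parts are bounded by tilting with t - h and t + h. *)
Lemma prob_walk_lt_ge t h x y n : 0 < h -> h < t -> x < y ->
  (expR (log_mgf L n t) <=
   expR (t * y) * fine (P [set w | (S n w < - x)%R]) +
   (expR (h * x + (log_mgf_coef L * (t - h) `^ (1 - L)^-1 + (t - h))) +
    expR (- (h * y) + (log_mgf_coef L * (t + h) `^ (1 - L)^-1 + (t + h)))))%R.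
Proof.
move=> h0 ht xy; have mA : measurable [set w | S n w < - x].
  by apply: measurable_lt_set; exact: measurable_walk.
have PA : P [set w | S n w < - x] \is a fin_num by exact: fin_num_measure.
have t0 : 0 < t by lra.
have th0 : 0 < t - h by lra.
have th1 : 0 < t + h by lra.
have me (c : R) : measurable_fun setT (fun w => (expR (- (c * S n w)))%:E : \bar R).
  apply/measurable_EFinP; apply: (measurableT_comp (@measurable_expR _)).
  by apply: measurableT_comp => //; apply: measurable_funM => //; exact: measurable_walk.
have ez (c : R) f : (0 <= (expR c)%:E * (expR f)%:E :> \bar R)%E.
  by rewrite -EFinM lee_fin mulr_ge0 ?expR_ge0.
have mi : measurable_fun setT (fun w => (\1_[set w | (S n w < - x)%R] w)%:E : \bar R).
  exact/measurable_EFinP/measurable_indic.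
have e0 (c : R) : (0 <= (expR c)%:E :> \bar R)%E by rewrite lee_fin expR_ge0.
have H : ((expR (log_mgf L n t))%:E <= (expR (t * y))%:E * P [set w | (S n w < - x)%R] +
   ((expR (h * x))%:E * (expR (log_mgf L n (t - h)))%:E +
    (expR (- (h * y)))%:E * (expR (log_mgf L n (t + h)))%:E))%E.
  rewrite -(expR_S n t0) -(expR_S n th0) -(expR_S n th1) -[X in P X]setIT -integral_indic//
      -!ge0_integralZl//.
  rewrite -ge0_integralD//; last 2 first.
  - by apply: emeasurable_funM.
  - by apply: emeasurable_funM.
  rewrite -ge0_integralD//; last 3 first.
  - by apply: emeasurable_funM.
  - by move=> w _; rewrite adde_ge0.
  - by apply: emeasurable_funD; apply: emeasurable_funM.
  apply: ge0_le_integral => //.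
    by apply: emeasurable_funD; [|apply: emeasurable_funD]; apply: emeasurable_funM.
  move=> w _; rewrite -!EFinM -!EFinD lee_fin -!expRD indicE.
  (* In each region [- (t * S n w)] is at most one exponent on the right: [t * y] in the middle,
     [- (h * y) - (t + h) * S n w] below [- y], and [h * x - (t - h) * S n w] from [- x] upwards. *)
  have [Sx|xS] := ltP (S n w) (- x).
    rewrite mem_set//= mulr1.
    have [yS|Sy] := leP (- y) (S n w).
      apply: (@le_trans _ _ (expR (t * y))); last first.
        by rewrite lerDl addr_ge0 ?expR_ge0.
      by rewrite ler_expR -mulrN ler_pM2l//; lra.
    apply: (@le_trans _ _ (expR (- (h * y) + - ((t + h) * S n w)))); last first.
      by rewrite addrA lerDr addr_ge0 ?expR_ge0.
    rewrite ler_expR -subr_ge0.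
    have -> : - (h * y) - (t + h) * S n w - - (t * S n w) = h * (- y - S n w) by ring.
    by rewrite mulr_ge0 ?subr_ge0// ltW.
  rewrite memNset/=; last by apply/negP; rewrite -leNgt.
  rewrite mulr0 add0r.
  apply: (@le_trans _ _ (expR (h * x + - ((t - h) * S n w)))); last first.
    by rewrite lerDl expR_ge0.
  rewrite ler_expR -subr_ge0.
  have -> : h * x - (t - h) * S n w - - (t * S n w) = h * (x + S n w) by ring.
  by rewrite mulr_ge0 ?(ltW h0)// -lerBlDl sub0r.
rewrite -lee_fin EFinD EFinM fineK//; apply: (le_trans H); apply: leeD => //.
rewrite -!EFinM -EFinD lee_fin.
by apply: lerD; rewrite [leRHS]expRD ler_wpM2l ?expR_ge0// ler_expR; exact: log_mgf_le.
Qed.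

End tails.

(** * Transfer of the bounds to the limit *)

Section law_of_X.
Context d (T : measurableType d) (R : realType) (P : probability T R).
Variable zeta : nat -> {RV P >-> R[i]}.
Hypothesis indZ : mutually_independent zeta.
Hypothesis gaussZ : forall m, standard_complex_gaussian (zeta m).

Let measurable_E m : measurable_fun setT (fun w => sqmod (zeta m w)).
Proof. exact: (measurableT_comp measurable_sqmod). Qed.

Let E m : {RV P >-> R} := rv_of P (measurable_E m).

Let indE (s : seq nat) (B : nat -> set R) : uniq s ->
  (forall m, measurable (B m)) ->
  P (cyl E s B) = (\prod_(m <- s) P (E m @^-1` B m))%E.
Proof.
move=> us mB; apply: (indZ (B := fun m => sqmod @^-1` B m) us) => m.
by rewrite -[X in measurable X]setTI; exact: measurable_sqmod.
Qed.

Let lawE m (f : R -> \bar R) : measurable_fun setT f ->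
  (forall u, 0 <= f u)%E ->
  (\int[P]_w f (E m w) = \int[mu]_(u in pos) (f u * (expR (- u))%:E))%E.
Proof. exact: integral_sqmod_gaussian. Qed.

Let S L n := walk E (acoef ^~ L) 0 n.

Let measurable_S L n : measurable_fun setT (S L n).
Proof. exact: measurable_walk. Qed.

Let cvg_S L M : (forall n, \sum_(i < n) acoef i L ^+ 2 <= M) ->
  {ae P, forall w, S L n w @[n --> \oo] --> X zeta L w}.
Proof.
move=> /(@walk_cvg_ae _ _ _ _ _ indE lawE (acoef ^~ L)); apply: filterS => w cw.
rewrite /X/= /Xfun [X in series X](_ : _ = fun m => acoef m L * (E m w - 1))//.
have -> : series (fun m => acoef m L * (E m w - 1)) = (fun n => S L n w); last exact: cw.
by apply/funext => n; rewrite /S walkE /series/= big_mkord; apply: eq_bigr.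
Qed.

Let cvg_SS L M : (forall n, \sum_(i < n) acoef i L ^+ 2 <= M) ->
  {ae P, forall w, S L n.+1 w @[n --> \oo] --> X zeta L w}.
Proof. by move=> /cvg_S; apply: filterS => w; rewrite -cvg_shiftS. Qed.

Let mX L : measurable_fun setT (X zeta L).
Proof. exact: measurable_funP. Qed.

(** One inequality bounds the events [X < y] for [y > x] and uses the continuity of the Gumbel
    distribution function; the other bounds the complementary event [x < X]. *)
Lemma cdf_X0 x : cdf (X zeta 0) x = (gumbel_cdf x)%:E.
Proof.
have -> : cdf (X zeta 0) x = P [set w | (X zeta 0 w <= x)%R].
  by congr (P _); apply/seteqP; split => w; rewrite /= in_itv.
pose F n (x : R) : R := if 0 <= x then (1 - expR (- x)) ^+ n else 0.
have SF n y : P [set w | (S 0 n.+1 w <= y)%R] = (F n (y + harmonic_sum n))%:E.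
  exact: (prob_walk_acoef0 indE lawE).
have cS := cvg_SS (@sum_acoef0_sqr R).
apply/eqP; rewrite eq_le; apply/andP; split.
  apply: (@prob_le_right_cont _ _ _ P _ (mX 0) x (@gumbel_cdf R)).
    apply: (@cvg_comp _ _ _ (fun y : R => expR (- y - euler_gamma)) (fun u => expR (- u)));
      last exact: continuous_expRN.
    apply: (@cvg_comp _ _ _ (fun y : R => - y - euler_gamma) expR); last exact: continuous_expR.
    by apply: cvgB; [apply: cvgN; exact: cvg_id|exact: cvg_cst].
  move=> y xy; apply: (prob_limit_lt_le (fun n => measurable_S 0 n.+1)
      (mX 0) cS (@cvg_gumbel_cdf R y)).
  move=> n; rewrite -[leRHS]SF; apply: le_measure; rewrite ?inE//.
  - exact: measurable_lt_set.
  - exact: measurable_le_set.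
  - by move=> w /= /ltW.
rewrite prob_le_gt//.
have PA : P [set w | (x < X zeta 0 w)%R] \is a fin_num.
  by apply: fin_num_measure; exact: measurable_gt_set.
rewrite leeBrDr// addeC -leeBrDr// -EFinB.
have c1 : 1 - F n (x + harmonic_sum n) @[n --> \oo] --> 1 - gumbel_cdf x.
  by apply: cvgB; [exact: cvg_cst|exact: cvg_gumbel_cdf].
apply: (prob_limit_gt_le (fun n => measurable_S 0 n.+1) (mX 0) cS c1) => n.
have := SF n x; rewrite prob_le_gt; last exact: measurable_S.
have PB : P [set w | (x < S 0 n.+1 w)%R] \is a fin_num.
  by apply: fin_num_measure; exact: measurable_gt_set.
rewrite -(fineK PB) -EFinB => -[<-]; rewrite lee_fin; lra.
Qed.

Variable L : R.
Hypothesis L01 : 0 < L < 2^-1.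

Let cS := cvg_S (sum_acoef_sqr L01).

Lemma prob_X_gt_le x : (P [set w | (x < X zeta L w)%R] <= (kappa L * expR (- x))%:E)%E.
Proof.
have c1 : (expR 1)^-1 * kappa_prod L n * expR (- x) @[n --> \oo] --> kappa L * expR (- x).
  by apply: cvgMl; exact: cvg_kappa_prod.
apply: (prob_limit_gt_le (fun n => measurable_S L n.+1) (mX L) (cvg_SS (sum_acoef_sqr L01)) c1).
by move=> n; exact: (prob_walk_gt_le indE lawE L01).
Qed.

(** A lower bound on an open event is not preserved by the limit, so the complement is bounded from
    above: first [X < y] for [y > x], then [y] decreases to [x]. *)
Lemma prob_X_gt_ge x :
  ((kappa L * expR (- x) - expR (16 * (log_mgf_coef L + 1) / (1 - 2 * L)) * expR (-
      (2 * x)))%:E <=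
   P [set w | (x < X zeta L w)%R])%E.
Proof.
set K := expR (16 * _ / _); have PA : P [set w | (x < X zeta L w)%R] \is a fin_num.
  by apply: fin_num_measure; exact: measurable_gt_set.
pose v y := 1 - (kappa L * expR (- y) - K * expR (- (2 * y))).
suff : (P [set w | (X zeta L w <= x)%R] <= (v x)%:E)%E.
  by rewrite prob_le_gt// /v -(fineK PA) -EFinB !lee_fin => ?; lra.
apply: (@prob_le_right_cont _ _ _ P _ (mX L)).
  apply: cvgB; first exact: cvg_cst.
  apply: cvgB; apply: cvgMr; first exact: continuous_expRN.
  apply: (@cvg_comp _ _ _ (fun y : R => 2 * y) (fun u => expR (- u)));
    last exact: continuous_expRN.
  by apply: cvgMr; exact: cvg_id.
move=> y xy.
pose u n := 1 - ((expR 1)^-1 * kappa_prod L n * expR (- y) - K * expR (- (2 * y))).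
have c1 : u n @[n --> \oo] --> v y.
  apply: cvgB; first exact: cvg_cst.
  apply: cvgB; last exact: cvg_cst.
  by apply: cvgMl; exact: cvg_kappa_prod.
apply: (prob_limit_lt_le (fun n => measurable_S L n.+1) (mX L)
    (cvg_SS (sum_acoef_sqr L01)) c1) => n.
apply: (@le_trans _ _ (P [set w | (S L n.+1 w <= y)%R])).
  apply: le_measure; rewrite ?inE//.
  - exact: measurable_lt_set.
  - exact: measurable_le_set.
  - by move=> w /= /ltW.
have PB : P [set w | (y < S L n.+1 w)%R] \is a fin_num.
  by apply: fin_num_measure; exact: measurable_gt_set.
rewrite prob_le_gt; last exact: measurable_S.
have := prob_walk_gt_ge indE lawE L01 y n.
by rewrite -/(S L n.+1) -(fineK PB) -EFinB -EFinD !lee_fin /u -/K => ?; lra.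
Qed.

Lemma prob_X_lt_le x t : 0 < t ->
  (fine (P [set w | (X zeta L w < - x)%R]) <=
   expR (log_mgf_coef L * t `^ ((1 - L)^-1) + t - t * x))%R.
Proof.
move=> t0; rewrite -lee_fin fineK; last first.
  by apply: fin_num_measure; exact: measurable_lt_set.
apply: (prob_limit_lt (measurable_S L) (mX L) cS); apply: nearW => n.
exact: (prob_walk_lt_le indE lawE L01).
Qed.

(** The gap between [z] and [x] absorbs the passage from strict to weak inequalities in the limit.
    The [- 1] in the exponent is slack: some finite partial sum then exceeds the exponent [b], and
    so do all later ones. *)
Lemma prob_X_lt_ge t h z x y : 0 < h -> h < t -> z < x -> x < y ->
  (expR (- (t * y)) *
   (expR (log_mgf_coef L * t `^ (1 - L)^-1 - expR 1 * t - 1) -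
   (expR (h * x + (log_mgf_coef L * (t - h) `^ (1 - L)^-1 + (t - h))) +
    expR (- (h * y) + (log_mgf_coef L * (t + h) `^ (1 - L)^-1 + (t + h))))) <=
   fine (P [set w | (X zeta L w < - z)%R]))%R.
Proof.
move=> h0 ht zx xy; set q := _ + expR _; set b := _ - 1.
have t0 : 0 < t by lra.
have [N HN] : exists N, b < log_mgf L N t.
  apply: contrapT => /forallNP H.
  (* If every partial sum stayed at or below [b], then [log_mgf_ge] would contradict the slack of
     one. *)
  have : log_mgf_coef L * t `^ (1 - L)^-1 - expR 1 * t <= b.
    by apply: (log_mgf_ge L01) => // n; rewrite leNgt; apply/negP; exact: H.
  by rewrite /b lerBrDr gerDl ler10.
pose c := expR (- (t * y)) * (expR b - q); rewrite -/c.
have fnum (A : set T) : measurable A -> P A \is a fin_num by exact: fin_num_measure.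
have mlt : measurable [set w | X zeta L w < - z] by exact: measurable_lt_set.
have mgt : measurable [set w | - x < X zeta L w] by exact: measurable_gt_set.
have : (P [set w | (- x < X zeta L w)%R] <= (1 - c)%:E)%E.
  apply: (prob_limit_gt (measurable_S L) (mX L) cS); exists N => // n /= Nn.
  have mSl : measurable [set w | S L n w < - x] by exact: measurable_lt_set.
  have mSg : measurable [set w | - x < S L n w] by exact: measurable_gt_set.
  apply: (@le_trans _ _ (1 - P [set w | (S L n w < - x)%R])%E).
    rewrite -probability_setC//; apply: le_measure; rewrite ?inE//.
      exact: measurableC.
    by move=> w /= Sx; apply/negP; rewrite -leNgt ltW.
  have := prob_walk_lt_ge indE lawE L01 n h0 ht xy.
  rewrite -/(S L n) -/q -(fineK (fnum _ mSl)) -EFinB lee_fin /=.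
  set f := fine _ => H; rewrite lerD2l lerN2 /c.
  rewrite expRN ler_pdivrMl ?expR_gt0// lerBlDr (le_trans _ H)// ler_expR ltW//.
  by apply: lt_le_trans HN _; apply: log_mgf_nd Nn => //; rewrite ltW.
rewrite -(fineK (fnum _ mgt)) lee_fin => H.
have : (P [set w | (X zeta L w <= - x)%R] <= P [set w | (X zeta L w < - z)%R])%E.
  apply: le_measure; rewrite ?inE//; first exact: measurable_le_set.
  by move=> w /= /le_lt_trans; apply; rewrite ltrN2.
rewrite prob_le_gt// -(fineK (fnum _ mgt)) -(fineK (fnum _ mlt)) -EFinB lee_fin => ?; lra.
Qed.

End law_of_X.

(** * The lower tail rate *)

Section lower_tail.
Context {R : realType}.
Variable L : R.
Hypothesis L01 : 0 < L < 2^-1.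

Let p := (1 - L)^-1.
(** [A] and [B] come from the Legendre transform of C t^p: the equation A t^(p - 1) = z has the
    solution t = B z^(1/L - 1), because 1/(p - 1) = 1/L - 1. *)
Let A := p * log_mgf_coef L.
Let B := A `^ (- (L^-1 - 1)).

Let L0 : 0 < L. Proof. by case/andP: L01. Qed.
Let L1 : L < 1. Proof. by have /andP[_ L2] := L01; apply: (lt_trans L2);
    rewrite invf_lt1 ?ltr1n. Qed.
Let p0 : 0 < p. Proof. by rewrite invr_gt0 subr_gt0. Qed.
Let p1 : 1 < p. Proof. by rewrite invf_gt1 ?subr_gt0// gtrBl. Qed.
Let p2 : p < 2.
Proof.
have /andP[_ L2] := L01; rewrite invf_plt ?posrE ?subr_gt0//.
by move: L2; lra.
Qed.

Let sin_gt0 : 0 < sin (pi * (2 - p)).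
Proof.
have p20 : 0 < 2 - p by rewrite subr_gt0.
have p21 : 2 - p < 1 by move: p1; lra.
by apply: sin_gt0_pi; rewrite ?in_itv/= ?mulr_gt0 ?pi_gt0 ?gtr_pMr ?pi_gt0.
Qed.

Let A_gt0 : 0 < A.
Proof. by rewrite mulr_gt0// mulr_gt0 ?powR_gt0 ?Gamma_gt0// divr_gt0 ?pi_gt0. Qed.

Let B_gt0 : 0 < B. Proof. exact: powR_gt0. Qed.

(** The 2 pi periodicity and oddness of the sine give sin(pi (2 - p)) = - sin(pi p), which is where
    the minus sign before [sinc] comes from. The power of [Gamma L] is p (1/L - 1) = 1/L. *)
Lemma lambdaE : lambda L = L * B.
Proof.
have piL : pi / (1 - L) = pi * p :> R by [].
pose q := sin (pi * (2 - p)) / (pi * p).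
have q0 : 0 < q by rewrite divr_gt0// mulr_gt0 ?pi_gt0.
have sq : - sinc (pi / (1 - L)) = q.
  rewrite /sinc piL /q mulrBr [pi * 2]mulrC mulr_natl addrC sinD2pi sinN.
  by rewrite mulNr.
have AE : A = Gamma L `^ (- p) / q.
  have := @pi_gt0 R; rewrite /A /log_mgf_coef -/p /q => pi0.
  have := lt0r_neq0 pi0; have := lt0r_neq0 sin_gt0; have := lt0r_neq0 p0.
  by set S := sin _; set g := _ `^ _; move: pi => r; clearbody p S => *; field;
      apply/and3P; split.
rewrite /lambda sq /B AE powRM ?powR_ge0 ?invr_ge0 ?(ltW q0)//.
rewrite -(powR_inv1 (ltW q0)) -!powRrM mulN1r opprK mulrA.
congr (_ * _ `^ _ * _).
have Ln : L != 0 by rewrite gt_eqF.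
have Ln1 : 1 - L != 0 by rewrite gt_eqF// subr_gt0.
by rewrite /p; field; rewrite Ln1 Ln.
Qed.

Variable f : R -> R.
Hypothesis f_le : forall x t, 0 < t ->
  f x <= expR (log_mgf_coef L * t `^ p + t - t * x).
Hypothesis f_ge : forall t h z x y, 0 < h -> h < t -> z < x -> x < y ->
  expR (- (t * y)) *
   (expR (log_mgf_coef L * t `^ p - expR 1 * t - 1) -
   (expR (h * x + (log_mgf_coef L * (t - h) `^ p + (t - h))) +
    expR (- (h * y) + (log_mgf_coef L * (t + h) `^ p + (t + h))))) <= f z.

(* the optimal t in Chernoff's bound, solving C p t^(p - 1) = z *)
Let tz z := B * z `^ L^-1 / z.

Let tzE z : 0 < z -> tz z = (z / A) `^ (L^-1 - 1).
Proof.
move=> z0; rewrite /tz powRM ?invr_ge0 ?(ltW z0) ?(ltW A_gt0)//.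
rewrite -(powR_inv1 (ltW A_gt0)) -powRrM mulN1r -/B [RHS]mulrC -mulrA.
by rewrite powRB ?(gt_eqF z0) ?implybT// powRr1// ltW.
Qed.

Let tz_gt0 z : 0 < z -> 0 < tz z.
Proof. by move=> z0; rewrite tzE// powR_gt0// divr_gt0. Qed.

(** The critical point equation C p t^(p - 1) = z multiplied by t / p. The Chernoff exponent is
    therefore - L t z, up to the error t. *)
Let tz_powR z : 0 < z -> log_mgf_coef L * tz z `^ p = (1 - L) * (tz z * z).
Proof.
move=> z0; have Ln : L != 0 by rewrite gt_eqF.
have Ln1 : 1 - L != 0 by rewrite gt_eqF// subr_gt0.
have zA : 0 < z / A by rewrite divr_gt0.
have -> : tz z `^ p = tz z * (z / A).
  rewrite tzE// -powRrM.
  have -> : (L^-1 - 1) * p = (L^-1 - 1) + 1 by rewrite /p; field; rewrite Ln.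
  by rewrite powRD ?(gt_eqF zA) ?implybT// powRr1// ltW.
have A0 : log_mgf_coef L * p != 0 by rewrite mulrC gt_eqF.
move: A0; rewrite mulf_eq0 => /norP[C0 _].
by rewrite /A /p; set t := tz z; field; rewrite Ln1.
Qed.

Let ldev_le x : 0 < x -> f x <= expR (- ((lambda L - B / x) * x `^ L^-1)).
Proof.
move=> x0; apply: (le_trans (f_le x (tz_gt0 x0))); rewrite ler_expR tz_powR//.
rewrite le_eqVlt; apply/orP; left; apply/eqP; rewrite lambdaE /tz.
by field; rewrite gt_eqF.
Qed.

(** Factor out [1 + s] and apply the tangent bound to the exponent [p - 1], which lies in [0, 1].
    The exact coefficient [p - 1] of the square matters for the tilting in [ldev_ge]. *)
Let powR_le_quad (s : R) : -1 <= s -> (1 + s) `^ p <= 1 + p * s + (p - 1) * s ^+ 2.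
Proof.
move=> s1; have s0 : 0 <= 1 + s by rewrite -lerBlDl sub0r.
have [e|n] := eqVneq (1 + s) 0.
  have -> : s = -1 by apply/eqP; rewrite -subr_eq0 opprK addrC e.
  by rewrite subrr powR0 ?gt_eqF// sqrrN expr1n; lra.
have -> : p = 1 + (p - 1) by ring.
rewrite powRD ?n ?implybT// powRr1//.
apply: (@le_trans _ _ ((1 + s) * (1 + (p - 1) * (1 + s - 1)))).
  apply: ler_wpM2l => //; apply: powR_le_tangent => //.
  by rewrite subr_ge0 (ltW p1)/= lerBlDr ltW.
by rewrite le_eqVlt; apply/orP; left; apply/eqP; ring.
Qed.

(* Tilts to the mean - z with z = x / (1 - 2 e), and h = e t in [f_ge]. *)
Let ldev_ge e : 0 < e < 2^-1 -> exists M, forall x, M <= x ->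
  expR (- (((L + e) * B * (1 - 2 * e) `^ (- L^-1) + M / x) * x `^ L^-1)) <= f x.
Proof.
move=> /andP[e0 e2].
have e21 : 0 < 1 - 2 * e by rewrite subr_gt0 mulrC -ltr_pdivlMr// div1r.
pose D := B * (1 - 2 * e) `^ (- L^-1).
have D0 : 0 < D by rewrite mulr_gt0// powR_gt0.
pose K := (expR 1 : R); have K0 : 0 < K by exact: expR_gt0.
pose M1 := (K + 6) / ((1 - L) * e ^+ 2).
have L10 : 0 < 1 - L by rewrite subr_gt0.
have den0 : 0 < (1 - L) * e ^+ 2 by rewrite mulr_gt0// exprn_gt0.
have M10 : 0 < M1 by rewrite divr_gt0// addr_gt0.
(* The summands of [M] ensure in turn [x >= 1], [t >= 1] through [z >= A], the inequality [We], and
   the absorption of the final error [K * t + 2] into [M / x]. *)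
pose M := 1 + A + M1 + (K * D * (1 - 2 * e) + 2).
have KD : 0 < K * D * (1 - 2 * e) by apply: mulr_gt0 => //; exact: mulr_gt0.
exists M => x Mx.
have x1 : 1 <= x by move: Mx A_gt0; rewrite /M; lra.
have x0 : 0 < x by exact: lt_le_trans x1.
pose z := x / (1 - 2 * e).
have xz : x <= z by rewrite ler_pdivlMr// ler_piMr ?(ltW x0)//; lra.
have z0 : 0 < z by exact: lt_le_trans xz.
have xzE : x = z * (1 - 2 * e) by rewrite /z divfK// gt_eqF.
pose t := tz z; have t0 : 0 < t by exact: tz_gt0.
have t1 : 1 <= t.
  rewrite /t tzE//; have e1 : 1 `^ (L^-1 - 1) = 1 :> R by rewrite powR1.
  rewrite -[leLHS]e1.
  have le1 : 1 <= z / A.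
    by rewrite ler_pdivlMr// mul1r; move: Mx xz KD M10; rewrite /M; lra.
  have Li : 0 <= L^-1 - 1 by rewrite subr_ge0 invf_ge1 ?(ltW L1).
  by apply: (ge0_ler_powR Li) => //; rewrite nnegrE (le_trans ler01).
pose W := (1 - L) * (t * z).
have WE : log_mgf_coef L * t `^ p = W by exact: tz_powR.
have W0 : 0 < W by apply: mulr_gt0 => //; exact: mulr_gt0.
have tzW : t * z = p * W by rewrite /W /p mulKf// gt_eqF.
have We : (K + 6) * t <= W * e ^+ 2.
  have : K + 6 <= z * ((1 - L) * e ^+ 2).
    by rewrite -ler_pdivrMr//; move: Mx xz KD A_gt0; rewrite /M /M1; lra.
  rewrite -(ler_pM2l t0) mulrC => /le_trans; apply.
  by rewrite le_eqVlt; apply/orP; left; apply/eqP; rewrite /W; ring.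
have powE s : -1 <= s -> log_mgf_coef L * (t + s * t) `^ p <=
    W * (1 + p * s + (p - 1) * s ^+ 2).
  move=> s1; have s0 : 0 <= 1 + s by rewrite -lerBlDl sub0r.
  have -> : t + s * t = t * (1 + s) by ring.
  rewrite powRM ?(ltW t0)// mulrA WE.
  by apply: ler_wpM2l; [exact: ltW|exact: powR_le_quad].
have := @f_ge t (e * t) x (z * (1 - e)) (z * (1 + e)).
have h0 : 0 < e * t by rewrite mulr_gt0.
have ht : e * t < t by rewrite gtr_pMl//; lra.
move=> /(_ h0 ht); rewrite {1}xzE !ltr_pM2l// => /(_ ltac:(lra) ltac:(lra)).
apply: le_trans.
(* A common bound for the two outer parts. In both exponents the terms linear in [e] cancel; the
   windows at distance [e * z] gain [p * e ^+ 2 * W], against a second-order loss of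
   [(p - 1) * e ^+ 2 * W]. *)
pose Q := expR (W * (1 - e ^+ 2) + 2 * t).
have Q1 : expR (e * t * (z * (1 - e)) + (log_mgf_coef L * (t - e * t) `^ p + (t - e * t))) <= Q.
  rewrite ler_expR.
  have := powE (- e); rewrite mulNr => /(_ ltac:(lra)) H.
  have -> : e * t * (z * (1 - e)) = e * (1 - e) * (t * z) by ring.
  rewrite tzW; apply: (@le_trans _ _ (e * (1 - e) * (p * W) + (W * (1 + p * - e +
      (p - 1) * (- e) ^+ 2) + (t - e * t)))).
    by rewrite lerD2l lerD2r.
  rewrite -subr_ge0 (_ : _ - _ = t + e * t); last by ring.
  by rewrite addr_ge0// ltW.
have Q2 : expR (- (e * t * (z * (1 + e))) + (log_mgf_coef L * (t + e * t) `^ p +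
    (t + e * t))) <= Q.
  rewrite ler_expR.
  have H := powE e ltac:(lra).
  have -> : e * t * (z * (1 + e)) = e * (1 + e) * (t * z) by ring.
  rewrite tzW; apply: (@le_trans _ _ (- (e * (1 + e) * (p * W)) + (W * (1 + p * e +
      (p - 1) * e ^+ 2) + (t + e * t)))).
    by rewrite lerD2l lerD2r.
  rewrite -subr_ge0 (_ : _ - _ = t - e * t); last by ring.
  by rewrite subr_ge0 ltW.
rewrite WE -/K; set b := W - K * t - 1.
(* By [We] the exponents differ by at least [4 * t - 1], hence by at least 3, and [expR 3 >= 1 + 3].
   This is the reason for the 6 in [M1]. The outer parts then take at most half of [expR b]. *)
have Qb : 4 * Q <= expR b.
  have -> : b = (W * (1 - e ^+ 2) + 2 * t) + (W * e ^+ 2 - (K + 2) * t - 1) by rewrite /b; ring.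
  rewrite expRD mulrC ler_wpM2l ?expR_ge0//.
  by apply: le_trans (expR_ge1Dx _); move: We t1; lra.
apply: (@le_trans _ _ (expR (- (t * (z * (1 + e)))) * (expR b * expR (-1)))); last first.
  rewrite ler_wpM2l ?expR_ge0//.
  apply: (@le_trans _ _ (expR b * 2^-1)); last by have := expR_gt0 b; lra.
  by rewrite ler_wpM2l ?expR_ge0// expRN lef_pV2 ?posrE ?expR_gt0// (le_trans _ (expR_ge1Dx 1)).
rewrite -!expRD ler_expR.
have zL : z `^ L^-1 = x `^ L^-1 * (1 - 2 * e) `^ (- L^-1).
  by rewrite /z powRM ?invr_ge0 ?ltW// -(powR_inv1 (ltW e21)) -powRrM mulN1r.
have tzD : t * z = D * x `^ L^-1.
  by rewrite /t /tz divfK ?gt_eqF// zL /D; ring.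
have tD : t = D * (1 - 2 * e) * (x `^ L^-1 / x).
  apply: (mulIf (lt0r_neq0 z0)); rewrite tzD /z; field.
  by rewrite !gt_eqF.
have xL : 1 <= x `^ L^-1 / x.
  rewrite ler_pdivlMr// mul1r -{1}(powRr1 (ltW x0)) ler_powR// invf_ge1 ?ltW//.
have -> : - (t * (z * (1 + e))) + (b - 1) = - ((L + e) * (t * z) + K * t + 2).
  by rewrite /b /W; ring.
rewrite lerN2 tzD tD.
have -> : ((L + e) * B * (1 - 2 * e) `^ (- L^-1) + M / x) * x `^ L^-1 =
  (L + e) * (D * x `^ L^-1) + M * (x `^ L^-1 / x) by rewrite /D; ring.
rewrite -addrA lerD2l.
have -> : M = K * D * (1 - 2 * e) + (1 + A + M1 + 2) by rewrite /M; ring.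
set r := _ / x in xL *.
have : 0 <= (1 + A + M1) * r by rewrite mulr_ge0 ?(le_trans ler01 xL)// !addr_ge0 ?ltW.
set u := (1 + A + M1) => ur.
have : 0 <= u * r + 2 * r - 2 by lra.
move=> /le_trans; rewrite -subr_ge0; apply.
by rewrite le_eqVlt; apply/orP; left; apply/eqP; ring.
Qed.

Let cvg_rate : (L + e) * B * (1 - 2 * e) `^ (- L^-1) @[e --> (0 : R)] --> L * B.
Proof.
have -> : L * B = (L + 0) * B * (1 - 2 * 0) `^ (- L^-1).
  by rewrite mulr0 subr0 powR1 mulr1 addr0.
apply: cvgM.
  by apply: cvgMl; apply: cvgD; [exact: cvg_cst|exact: cvg_id].
apply: (@cvg_comp _ _ _ (fun e : R => 1 - 2 * e) (fun u => u `^ (- L^-1))).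
  by apply: cvgB; [exact: cvg_cst|apply: cvgMr; exact: cvg_id].
by apply: continuous_powR_gt0; rewrite mulr0 subr0.
Qed.

(** [eps] is the difference between the normalized logarithm and [lambda L]. It is at least
    [- B / x] by Chernoff's bound; from above, [e] is fixed first so that the tilted rate is within
    [r / 2] of [L * B], and then [x] is taken large. *)
Lemma lower_tail_rate : exists2 eps : R -> R, eps x @[x --> +oo] --> (0 : R) &
  \forall x \near +oo,
    0 < f x /\ ln (f x) = - (lambda L + eps x) * x `^ L^-1.
Proof.
have fpos : \forall x \near +oo, 0 < f x.
  (* Any admissible [e] would do: this instance only serves to make [f] eventually positive, so that
     logarithms can be taken. *)
  have [|M HM] := @ldev_ge 4^-1; first by apply/andP; split; lra.
  near=> x; apply: (lt_le_trans (expR_gt0 _)); apply: HM.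
  by near: x; exact: nbhs_pinfty_ge (num_real _).
exists (fun x => - ln (f x) / x `^ L^-1 - lambda L); last first.
  near=> x; split; first by near: x.
  have x0 : 0 < x by near: x; exact: nbhs_pinfty_gt.
  by field; rewrite gt_eqF// powR_gt0.
apply/cvgrPdist_le => r r0.
have [e e12 er] : exists2 e : R, 0 < e < 2^-1 &
    (L + e) * B * (1 - 2 * e) `^ (- L^-1) < L * B + r / 2.
  near (0 : R)^'+ => e; exists e.
    apply/andP; split; first by near: e; exact: nbhs_right_gt.
    by near: e; apply: nbhs_right_lt; rewrite invr_gt0.
  near: e; apply: (cvgr_lt _ (cvg_at_right_filter cvg_rate)).
  by rewrite ltrDl divr_gt0.
have [M HM] := ldev_ge e12.
near=> x.
have x0 : 0 < x by near: x; exact: nbhs_pinfty_gt.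
have f0 : 0 < f x by near: x.
have X0 : 0 < x `^ L^-1 by exact: powR_gt0.
have := ldev_le x0; rewrite -ler_ln ?posrE ?expR_gt0// expRK => H1.
have /HM : M <= x by near: x; exact: nbhs_pinfty_ge (num_real _).
rewrite -ler_ln ?posrE ?expR_gt0// expRK => H2.
have H3 : lambda L - B / x <= - ln (f x) / x `^ L^-1.
  by rewrite ler_pdivlMr// lerNr.
have H4 : - ln (f x) / x `^ L^-1 <= (L + e) * B * (1 - 2 * e) `^ (- L^-1) + M / x.
  by rewrite ler_pdivrMr// lerNl.
have H5 : B / x <= r.
  by rewrite ler_pdivrMr// -ler_pdivrMl//; near: x; exact: nbhs_pinfty_ge (num_real _).
have H6 : M / x <= r / 2.
  by rewrite ler_pdivrMr// -ler_pdivrMl ?divr_gt0.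
rewrite sub0r normrN ler_norml; move: H3 H4 H5 H6 er; rewrite lambdaE.
set u := B / x; set v := M / x; set a := _ / _ `^ _; set b := _ * _ `^ _.
by move=> *; apply/andP; split; lra.
Unshelve. all: end_near. Qed.

End lower_tail.

Theorem theorem2 (d : measure_display) (T : measurableType d) (R : realType)
    (P : probability T R) (zeta : nat -> {RV P >-> R[i]})
    (zeta_indep : mutually_independent zeta)
    (zeta_gauss : forall m : nat, standard_complex_gaussian (zeta m)) :
  (forall x : R, cdf (X zeta 0) x = (gumbel_cdf x)%:E) /\
  (forall L : R, 0 < L < 2^-1 ->
    (exists2 eps : R -> R, eps x @[x --> +oo] --> (0 : R) &
       \forall x \near +oo,
         P [set w | x < X zeta L w] = ((kappa L + eps x) * expR (- x))%:E) /\
    (exists2 eps : R -> R, eps x @[x --> +oo] --> (0 : R) &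
       \forall x \near +oo,
         lne (P [set w | X zeta L w < - x]) =
         (- (lambda L + eps x) * x `^ L^-1)%:E)).
Proof.
split=> [x|L L01]; first exact: cdf_X0.
have mX : measurable_fun setT (X zeta L) by exact: measurable_funP.
split.
  have PA x : P [set w | x < X zeta L w] \is a fin_num.
    by apply: fin_num_measure; exact: measurable_gt_set.
  exists (fun x => fine (P [set w | x < X zeta L w]) * expR x - kappa L); last first.
    by apply: nearW => x; rewrite addrC subrK -mulrA -expRD subrr expR0 mulr1 fineK.
  pose K := expR (16 * (log_mgf_coef L + 1) / (1 - 2 * L)).
  have cK : - (K * expR (- x)) @[x --> +oo] --> (0 : R).
    by rewrite -oppr0 -(mulr0 K); apply: cvgN; apply: cvgMr; exact: cvgr_expR.
  (* The upper tail never exceeds [kappa L * expR (- x)], so [eps] is at most 0; the second-moment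
     correction gives the lower bound [- (K * expR (- x))]. *)
  apply: (squeeze_cvgr _ cK (cvg_cst 0)); near=> x.
  have := prob_X_gt_le zeta_indep zeta_gauss L01 x.
  have := prob_X_gt_ge zeta_indep zeta_gauss L01 x.
  rewrite -(fineK (PA x)) !lee_fin -/K => H1 H2.
  have qE y : y * expR x * expR (- x) = y by rewrite -mulrA -expRD subrr expR0 mulr1.
  apply/andP; split.
    rewrite -(ler_pM2r (expR_gt0 (- x))) mulrBl qE.
    apply: le_trans (lerB H1 (lexx _)).
    rewrite (_ : expR (- (2 * x)) = expR (- x) * expR (- x)); last first.
      by rewrite -expRD; congr expR; ring.
    by rewrite le_eqVlt; apply/orP; left; apply/eqP; ring.
  rewrite subr_le0 -(ler_pM2r (expR_gt0 (- x))) qE.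
  exact: H2.
pose f x := fine (P [set w | X zeta L w < - x]).
have PE x : P [set w | X zeta L w < - x] = (f x)%:E.
  by rewrite fineK//; apply: fin_num_measure; exact: measurable_lt_set.
have [eps eps0 feps] := lower_tail_rate L01 (f := f)
  (fun x t t0 => prob_X_lt_le zeta_indep zeta_gauss L01 x t0)
  (fun t h z x y => @prob_X_lt_ge _ _ _ _ _ zeta_indep zeta_gauss _ L01 t h z x y).
exists eps => //; near=> x.
have [f0 fE] : 0 < f x /\ ln (f x) = - (lambda L + eps x) * x `^ L^-1 by near: x.
by rewrite PE -fE lne_EFin.
Unshelve. all: end_near. Qed.
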